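(* Assume the following. (a) $b$ and $\sigma$ are continuous on $H\times\Lambda_0$ and there is $C>0$ such that $\|b(x,a)-b(x',a)\|_H\le C\|x-x'\|_H$, $\|\sigma(x,a)-\sigma(x',a)\|_{L_2(\Xi,H)}\le C\|x-x'\|_H$, $\|b(x,a)\|_H\le C(1+\|x\|_H+\|a\|_\Lambda)$ and $\|\sigma(x,a)\|_{L_2(\Xi,H)}\le C(1+\|x\|_H+\|a\|_\Lambda)$ for all $x,x'\in H$, $a\in\Lambda_0$. (b) $l$ is continuous on $H\times\Lambda_0$ and there is $C>0$ such that $|l(x,a)-l(x',a)|\le C\|x-x'\|_H$, $|l(x,a)|\le C(1+\|x\|_H+\|a\|_\Lambda^2)$ and $|g(x)-g(x')|\le C\|x-x'\|_H$ for all $x,x'\in H$, $a\in\Lambda_0$; moreover, if $\Lambda_0$ is unbounded, $l$ and $g$ are bounded from below. Then there are constants $C_1,C_2$ independent of $T$ such that $$|V(t,x)-V(t,y)|\le C_1\mathrm e^{C_2(T-t)}\|x-y\|_H$$ for all $t\in[0,T]$ and $x,y\in H$.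
   Context: $H$ and $\Xi$ are real separable Hilbert spaces, $\Lambda$ is a real separable Banach space, $\Lambda_0\subset\Lambda$ is convex, $p>2$ and $0<T<\infty$ are fixed. $L_2(\Xi,H)$ is the space of Hilbert--Schmidt operators. $A:\mathcal D(A)\subset H\to H$ is linear, densely defined and maximal dissipative; it generates a $C_0$-semigroup of contractions $(\mathrm e^{sA})_{s\ge 0}$. The coefficients are functions $b:H\times\Lambda\to H$, $\sigma:H\times\Lambda\to L_2(\Xi,H)$, $l:H\times\Lambda\to\mathbb R$, $g:H\to\mathbb R$. For $t\in[0,T]$, a reference probability space $(\Omega,\mathscr F,(\mathscr F^t_s)_{s\in[t,T]},\mathbb P,(W(s))_{s\in[t,T]})$ is fixed: $(\Omega,\mathscr F,\mathbb P)$ is complete, $W$ is a cylindrical Wiener process in $\Xi$ with $W(t)=0$ $\mathbb P$-a.s., and $\mathscr F^t_s$ is generated by $\{W(\tau):t\le\tau\le s\}$ and the $\mathbb P$-null sets. $\mathcal U_t$ is the set of all $\mathscr F^t_s$-progressively measurable $a(\cdot):[t,T]\times\Omega\to\Lambda_0$ with $\mathbb E\int_t^T\|a(s)\|_\Lambda^p\,\mathrm ds<\infty$. $X(\cdot;t,x,a(\cdot))$ is the mild solution with continuous trajectories of $\mathrm dX(s)=[AX(s)+b(X(s),a(s))]\mathrm ds+\sigma(X(s),a(s))\mathrm dW(s)$, $X(t)=x$, i.e. $X(s)=\mathrm e^{(s-t)A}x+\int_t^s\mathrm e^{(s-r)A}b(X(r),a(r))\mathrm dr+\int_t^s\mathrm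 e^{(s-r)A}\sigma(X(r),a(r))\mathrm dW(r)$. Further $J(t,x;a(\cdot))=\mathbb E\big[\int_t^T l(X(s),a(s))\mathrm ds+g(X(T))\big]$ with $X(s)=X(s;t,x,a(\cdot))$, and the value function is $V(t,x)=\inf_{a(\cdot)\in\mathcal U_t}J(t,x;a(\cdot))$. *)

(* Defs.v *)
(* MathComp / MathComp-Analysis, over an arbitrary [R : realType]. *)
From HB Require Import structures.
From mathcomp Require Import all_boot all_order all_algebra.
From mathcomp Require Import all_classical all_reals all_analysis.

Set Implicit Arguments.
Unset Strict Implicit.
Unset Printing Implicit Defensive.

Import Order.TTheory GRing.Theory Num.Theory numFieldNormedType.Exports.
Local Open Scope classical_set_scope.
Local Open Scope ring_scope.

Definition separable (T : topologicalType) : Prop :=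
  exists D : set T, countable D /\ dense D.

Definition borel (T : ptopologicalType) := g_sigma_algebraType (@open T).

(* A Hilbert space is a Banach space [H] together with an inner product
   inducing its norm. *)
Definition norm_from_dot (R : realType) (H : completeNormedModType R)
  (dot : {dot H for idfun}) : Prop := forall x, `|x| ^+ 2 = dot x x.

Section Operators.
Variables (R : realType) (H Xi : completeNormedModType R).
Variables (dotH : {dot H for idfun}) (dotXi : {dot Xi for idfun}).

(* An unbounded operator is a domain [D] with a total function [A] whose
   values outside [D] are ignored. *)
Definition linear_operator (D : set H) (A : H -> H) : Prop :=
  D 0 /\ forall (c : R) u v, D u -> D v ->
    D (c *: u + v) /\ A (c *: u + v) = c *: A u + A v.

Definition dissipative (D : set H) (A : H -> H) : Prop :=
  forall x, D x -> dotH (A x) x <= 0.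

Definition maximal_dissipative (D : set H) (A : H -> H) : Prop :=
  [/\ linear_operator D A, dissipative D A &
    forall (D' : set H) (A' : H -> H),
      linear_operator D' A' -> dissipative D' A' ->
      D `<=` D' -> (forall x, D x -> A' x = A x) -> D' `<=` D].

Record C0_contraction_semigroup (S : R -> H -> H) : Prop := {
  sg_linear : forall s, 0 <= s -> linear (S s);
  sg_contraction : forall s x, 0 <= s -> `|S s x| <= `|x|;
  sg_0 : forall x, S 0 x = x;
  sg_add : forall r s x, 0 <= r -> 0 <= s -> S (r + s) x = S r (S s x);
  sg_continuous : forall x, S s x @[s --> 0^'+] --> x }.

Definition infinitesimal_generator (D : set H) (A : H -> H) (S : R -> H -> H)
    : Prop :=
  forall x y, (D x /\ A x = y) <->
    (h^-1 *: (S h x - x) @[h --> 0^'+] --> y).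

(* Complete orthonormal system, of any (at most countable, [Xi] being
   separable) cardinality. *)
Definition orthonormal_basis (E : set Xi) : Prop :=
  (forall e e', E e -> E e' -> dotXi e e' = (e == e')%:R) /\
  (forall x, (forall e, E e -> dotXi e x = 0) -> x = 0).

(* [E] is an orthonormal basis of [Xi] in the next three definitions, whose
   values do not depend on its choice when [T] is linear and continuous. *)
Definition hs_sqnorm (E : set Xi) (T : Xi -> H) : \bar R :=
  \esum_(e in E) (`|T e| ^+ 2)%:E.

Definition hilbert_schmidt (E : set Xi) (T : Xi -> H) : Prop :=
  [/\ linear T, continuous T & (hs_sqnorm E T < +oo)%E].

Definition hs_norm (E : set Xi) (T : Xi -> H) : R :=
  Num.sqrt (fine (hs_sqnorm E T)).

End Operators.

Section Stochastic.
Variables (R : realType) (H Xi : completeNormedModType R).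
Variables (dotXi : {dot Xi for idfun}) (E : set Xi).
Variables (d : measure_display) (Omega : measurableType d).
Variables (P : probability Omega R).

Local Notation leb := (@lebesgue_measure R).

(* A cylindrical process in [Xi]: [W s xi] stands for the real random variable
   "<W(s), xi>", which is all that exists when dim Xi is infinite. *)
Variables (W : R -> Xi -> Omega -> R) (t : R).

(* Generators of the sigma-algebra of the filtration at time [s]. *)
Definition filtration_gen (s : R) : set (set Omega) :=
  [set A | (exists tau xi (B : set R),
      [/\ t <= tau <= s, measurable B & A = W tau xi @^-1` B])
    \/ P.-negligible A].

Definition increment (r s : R) (xi : Xi) (w : Omega) : R :=
  W s xi w - W r xi w.

Record reference_space (T : R) : Prop := {
  rs_complete : measure_is_complete P;
  rs_measurable : forall s xi, t <= s <= T -> measurable_fun setT (W s xi);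
  rs_linear : forall s (c : R) xi eta, t <= s <= T ->
    {ae P, forall w, W s (c *: xi + eta) w = c * W s xi w + W s eta w};
  rs_0 : forall xi, {ae P, forall w, W t xi w = 0};
  rs_continuous : forall xi,
    {ae P, forall w, {within `[t, T], continuous (fun s => W s xi w)}};
  rs_gaussian : forall r s (xi : Xi), t <= r -> r < s -> s <= T -> xi != 0 ->
    forall B : set R, measurable B ->
      P (increment r s xi @^-1` B) =
      normal_prob 0 (Num.sqrt (s - r) * `|xi|) B;
  rs_independent : forall r s xi, t <= r -> r <= s -> s <= T ->
    forall (A : set Omega) (B : set R),
      <<s filtration_gen r >> A -> measurable B ->
      P (A `&` (increment r s xi @^-1` B)) =
      (P A * P (increment r s xi @^-1` B))%E }.

Definition progressive (K : completeNormedModType R) (T : R)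
    (f : R -> Omega -> K) : Prop :=
  forall s, t <= s <= T ->
    measurable_fun
      (`[t, s] `*` setT : set (R * g_sigma_algebraType (filtration_gen s)))
      (fun z : R * g_sigma_algebraType (filtration_gen s) =>
         (f z.1 z.2 : borel K)).

(* [is_bochner D f y]: [f] is Bochner integrable on [D] for the Lebesgue
   measure, with integral [y]. *)
Definition is_bochner (D : set R) (f : R -> H) (y : H) : Prop :=
  measurable_fun D (f : R -> borel H) /\
  exists (k : nat -> nat) (A : nat -> nat -> set R) (h : nat -> nat -> H),
  [/\ forall n i, (i < k n)%N -> measurable (A n i) /\ (leb (A n i) < +oo)%E,
      (\int[leb]_(r in D)
        (`|f r - \sum_(i < k n) \1_(A n i) r *: h n i|)%:E)%E
        @[n --> \oo] --> 0%E &
      \sum_(i < k n) fine (leb (D `&` A n i)) *: h n i @[n --> \oo] --> y].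

(* The elementary integrand 1_{]lo, hi] x A} (xi (x) h), where xi (x) h is the
   rank-one operator eta |-> <xi, eta> h. *)
Record elementary := Elementary {
  el_lo : R; el_hi : R; el_event : set Omega; el_dir : Xi; el_val : H }.

Definition elementary_adapted (s : R) (c : elementary) : Prop :=
  [/\ t <= el_lo c, el_lo c <= el_hi c, el_hi c <= s &
      <<s filtration_gen (el_lo c) >> (el_event c)].

Definition elementary_op (c : elementary) (r : R) (w : Omega) (eta : Xi) : H :=
  (\1_`]el_lo c, el_hi c] r * \1_(el_event c) w * dotXi (el_dir c) eta)
    *: el_val c.

Definition elementary_int (c : elementary) (w : Omega) : H :=
  (\1_(el_event c) w * increment (el_lo c) (el_hi c) (el_dir c) w)
    *: el_val c.

(* [is_ito s Phi I]: [Phi] is a square-integrable progressively measurable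
   process of Hilbert-Schmidt operators on [t, s], and [I] is (a version of)
   its Ito integral over [t, s], i.e. the L^2 limit of the integrals of finite
   sums of elementary integrands converging to [Phi] in
   L^2([t, s] x Omega; L_2(Xi, H)). *)
Definition is_ito (s : R) (Phi : R -> Omega -> Xi -> H) (I : Omega -> H)
    : Prop :=
  [/\ forall r w, t <= r <= s -> hilbert_schmidt E (Phi r w),
      forall xi, progressive s (fun r w => Phi r w xi),
      measurable_fun setT (I : Omega -> borel H) &
      exists (k : nat -> nat) (c : nat -> nat -> elementary),
      [/\ forall n i, (i < k n)%N -> elementary_adapted s (c n i),
          (\int[P]_w \int[leb]_(r in `[t, s])
             hs_sqnorm E (fun eta => (Phi r w eta -
               \sum_(i < k n) elementary_op (c n i) r w eta)%R))%E
            @[n --> \oo] --> 0%E &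
          (\int[P]_w (`|I w - \sum_(i < k n) elementary_int (c n i) w|
             ^+ 2)%:E)%E
            @[n --> \oo] --> 0%E]].

End Stochastic.

Section Control.
Variables (R : realType) (H Xi Lambda : completeNormedModType R).
Variables (dotXi : {dot Xi for idfun}) (E : set Xi).
Variables (S : R -> H -> H) (Lambda0 : set Lambda) (p : R).
Variables (b : H * Lambda -> H) (sigma : H * Lambda -> Xi -> H).
Variables (l : H * Lambda -> R) (g : H -> R).
Variables (d : measure_display) (Omega : measurableType d).
Variables (P : probability Omega R) (W : R -> Xi -> Omega -> R) (t T : R).

Local Notation leb := (@lebesgue_measure R).

(* Controls are indexed by all of [R]; only their values on [t, T] matter. *)
Definition admissible : set (R -> Omega -> Lambda) :=
  [set a | [/\ forall s w, t <= s <= T -> Lambda0 (a s w),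
      progressive P W t T a &
      (\int[P]_w \int[leb]_(s in `[t, T]) (`|a s w| `^ p)%:E < +oo)%E]].

Definition mild_solution (x : H) (a : R -> Omega -> Lambda)
    (X : R -> Omega -> H) : Prop :=
  [/\ progressive P W t T X,
      {ae P, forall w, {within `[t, T], continuous (fun s => X s w)}},
      (\int[P]_w \int[leb]_(s in `[t, T]) (`|X s w| ^+ 2)%:E < +oo)%E &
      forall s, t <= s <= T -> exists drift noise : Omega -> H,
      [/\ {ae P, forall w,
            is_bochner `[t, s] (fun r => S (s - r) (b (X r w, a r w)))
              (drift w)},
          is_ito dotXi E P W t s
            (fun r w xi => S (s - r) (sigma (X r w, a r w) xi)) noise &
          {ae P, forall w, X s w = S (s - t) x + drift w + noise w}]].

(* [X x a] is the trajectory X(.; t, x, a). *)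
Variable X : H -> (R -> Omega -> Lambda) -> R -> Omega -> H.

Definition cost (x : H) (a : R -> Omega -> Lambda) : \bar R :=
  (\int[P]_w (\int[leb]_(s in `[t, T]) (l (X x a s w, a s w))%:E
              + (g (X x a T w))%:E))%E.

Definition value (x : H) : \bar R :=
  ereal_inf [set cost x a | a in admissible].

End Control.

(* Main.v *)
Require Import Defs.
From HB Require Import structures.
From mathcomp Require Import all_boot all_order all_algebra.
From mathcomp Require Import all_classical all_reals all_analysis.
From mathcomp Require Import measurable_realfun ring lra.

Set Implicit Arguments.
Unset Strict Implicit.
Unset Printing Implicit Defensive.

Import Order.TTheory GRing.Theory Num.Theory numFieldNormedType.Exports.
Local Open Scope classical_set_scope.
Local Open Scope ring_scope.

(** The difference Z of two trajectories driven by the same control is, up to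
    its initial term, a sum of a deterministic and a stochastic convolution whose
    integrands are bounded by a multiple of |Z|. The semigroup being contractive,
    the isometry of the Ito integral and Cauchy-Schwarz (with a weight
    exp(-lam (s - r)), which keeps constants independent of T) give
      E|Z(s)|^2 <= 3 |x - y|^2 + K int_t^s exp(lam (s - r)) E|Z(r)|^2 dr,
    hence E|Z(s)| <= 4 exp(lam (s - t)) |x - y| by Gronwall. As l and g are
    Lipschitz in x, uniformly in the control, the costs of a given control
    started at x and y differ by a multiple of exp(lam (T - t)) |x - y|, and so
    do their infima, provided these are finite. Finiteness follows from the
    lower bounds on l and g or, when Lambda0 is bounded, from a moment estimate
    obtained by comparing X with the zero process.

    The Ito integral is an L^2 limit of elementary integrals, so its isometry
    (up to a factor 9) reduces to that of sums of elementary integrands, in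
    which the second moment of a Wiener increment enters only through the
    unevaluated second moment of the standard normal law. *)

(** * Inner products and orthonormal bases *)

(** The obstacle is that [is_ito] supplies each integrand with an approximating sequence of its own
    and yields only an L^2 limit. Two Ito integrals are therefore compared through their
    approximants: the difference of two elementary sums is again an elementary sum, which obeys the
    exact isometry, and the squared three-term triangle inequality is used once for the integrals
    and once for the integrands, whence [9 = 3 * 3]. The exponent comes from the requirement
    [K / lam <= 1 / 2], met by [lam = 2 * K + 1]: in the norm weighted by exp(2 lam (s - t)) the
    integral inequality becomes a contraction. First moments are deduced from second moments by
    [2 * y <= delta + y ^+ 2 / delta], with [delta] of the expected size. Finiteness of the value
    cannot be bypassed: in the extended reals [+oo - +oo] is [-oo], with absolute value [+oo].
    Separability of [H] enters through the Borel structure: a countable dense set reduces sums and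
    distances of Borel maps to distances to fixed points. *)

Section DotProduct.
Variables (R : realType) (H : completeNormedModType R) (dot : {dot H for idfun}).

Lemma dotC (x y : H) : dot x y = dot y x.
Proof. by rewrite hermC /= expr0 mul1r. Qed.

Lemma dotDr (x y z : H) : dot x (y + z) = dot x y + dot x z.
Proof. exact: linearDr. Qed.

Lemma dotDl (x y z : H) : dot (x + y) z = dot x z + dot y z.
Proof. exact: linearDl. Qed.

Lemma dotZr (a : R) (x y : H) : dot x (a *: y) = a * dot x y.
Proof. exact: linearZr_LR. Qed.

Lemma dotZl (a : R) (x y : H) : dot (a *: x) y = a * dot x y.
Proof. exact: linearZl_LR. Qed.

Lemma dotBl (x y z : H) : dot (x - y) z = dot x z - dot y z.
Proof. exact: linearBl. Qed.

Lemma dotBr (x y z : H) : dot x (y - z) = dot x y - dot x z.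
Proof. exact: linearBr. Qed.

Lemma dot0l (x : H) : dot 0 x = 0.
Proof. exact: linear0l. Qed.

Lemma dot0r (x : H) : dot x 0 = 0.
Proof. exact: linear0r. Qed.

Lemma dot_suml (I : Type) (r : seq I) (P : pred I) (F : I -> H) x :
  dot (\sum_(i <- r | P i) F i) x = \sum_(i <- r | P i) dot (F i) x.
Proof. exact: linear_sumlz. Qed.

Lemma dot_sumr (I : Type) (r : seq I) (P : pred I) (F : I -> H) x :
  dot x (\sum_(i <- r | P i) F i) = \sum_(i <- r | P i) dot x (F i).
Proof. exact: linear_sumr. Qed.

Hypothesis normE : norm_from_dot dot.

Lemma sqnormD (x y : H) :
  `|x + y| ^+ 2 = `|x| ^+ 2 + 2 * dot x y + `|y| ^+ 2.
Proof. by rewrite !normE !dotDl !dotDr (dotC y x); ring. Qed.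

Lemma sqnormB (x y : H) :
  `|x - y| ^+ 2 = `|x| ^+ 2 - 2 * dot x y + `|y| ^+ 2.
Proof. by rewrite !normE !dotBl !dotBr (dotC y x); ring. Qed.

Lemma sqnorm_sumZ n (c : 'I_n -> R) (h : 'I_n -> H) :
  `|\sum_i c i *: h i| ^+ 2 = \sum_i \sum_j c i * c j * dot (h i) (h j).
Proof.
rewrite normE dot_suml; apply: eq_bigr => i _.
rewrite dot_sumr; apply: eq_bigr => j _.
by rewrite dotZl dotZr mulrA.
Qed.

(** Cauchy-Schwarz: the squared norms of [|y| x + |x| y] and [|y| x - |x| y] are nonnegative, and
    expanding them bounds [dot x y] from both sides after division by [|x| |y|]. *)
Lemma dot_le (x y : H) : `|dot x y| <= `|x| * `|y|.
Proof.
have [->|x0] := eqVneq x 0; first by rewrite dot0l !normr0 mul0r.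
have [->|y0] := eqVneq y 0; first by rewrite dot0r !normr0 mulr0.
have xy0 : 0 < `|x| * `|y| by rewrite mulr_gt0 ?normr_gt0.
have := sqr_ge0 `| `|y| *: x - `|x| *: y|.
have := sqr_ge0 `| `|y| *: x + `|x| *: y|.
rewrite sqnormD sqnormB !normrZ !dotZl !dotZr !normr_id => h1 h2.
rewrite ler_norml -(ler_pM2l xy0) -[X in _ && X](ler_pM2l xy0).
by apply/andP; split; nra.
Qed.

Lemma dot_continuous (x : H) : continuous (dot x).
Proof.
move=> y; apply/cvgrPdist_lt => /= e e0.
apply/nbhs_ballP; exists (e / (1 + `|x|)) => /=.
  by rewrite divr_gt0// ltr_pwDl.
move=> z; rewrite -ball_normE /= => yz.
rewrite -dotBr (le_lt_trans (dot_le _ _))//.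
rewrite (@le_lt_trans _ _ ((1 + `|x|) * `|y - z|))//.
  by rewrite ler_wpM2r// lerDr.
by rewrite mulrC -ltr_pdivlMr ?ltr_pwDl.
Qed.

Lemma dot_cvg (x : H) (u : nat -> H) (l : H) :
  u n @[n --> \oo] --> l -> dot x (u n) @[n --> \oo] --> dot x l.
Proof.
move=> ul; apply/cvgrPdist_lt => e e0.
have /cvgrPdist_lt/(_ _ e0) := @dot_continuous x l.
move=> /ul; apply.
Qed.

End DotProduct.

(** A convergent real sequence [s] that dominates the squared increments makes [u] Cauchy. Applied
    to Fourier partial sums, with [s] the sums of squared coefficients. *)
Lemma cvgn_of_sqdist (R : realType) (H : completeNormedModType R)
    (u : nat -> H) (s : R^nat) : cvgn s ->
  (forall m n, (m <= n)%N -> `|u n - u m| ^+ 2 <= s n - s m) -> cvgn u.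
Proof.
move=> cs us; apply: cauchy_cvg; apply: cauchy_exP => e e0.
have /cvgrPdist_lt/(_ (e ^+ 2 / 2) ltac:(by rewrite divr_gt0// exprn_gt0))[N _ sN] := cs.
exists (u N); exists N => // n /= Nn; rewrite -ball_normE /= distrC.
rewrite -ltr_sqr ?nnegrE//; last exact: ltW.
rewrite (le_lt_trans (us _ _ Nn))// [ltRHS]splitr.
rewrite (_ : s n - s N = (limn s - s N) - (limn s - s n)); last by ring.
apply: le_lt_trans (ler_norm _) _; apply: le_lt_trans (ler_normB _ _) _.
by apply: ltrD; [exact: sN (leqnn _)|exact: sN].
Qed.

Lemma separable_seq (R : realType) (K : completeNormedModType R) :
  separable K -> exists q : nat -> K, forall x e, 0 < e -> exists n, `|x - q n| < e.
Proof.
move=> [D [cD dD]].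
have [f injf] := countable_injP _ cD.
exists (fun n => xget 0 [set x | D x /\ f x = n]) => x e e0.
have [|y [/= xy Dy]] := dD (ball x e) _ (ball_open x e).
  by exists x; apply: ballxx.
exists (f y); case: xgetP => [z _ [Dz fzy]|/(_ y)]; last by case.
by rewrite (injf z y) ?inE//; move: xy; rewrite -ball_normE.
Qed.

(** Distinct orthonormal vectors are at distance sqrt 2, so the index of a point of the dense
    sequence within 1/2 of a basis vector determines that vector. *)
Lemma orthonormal_countable (R : realType) (Xi : completeNormedModType R)
    (dot : {dot Xi for idfun}) (normE : norm_from_dot dot) (E : set Xi) :
  separable Xi -> orthonormal_basis dot E -> countable E.
Proof.
move=> /separable_seq[q dq] [onE _].
pose near_pt x := cid (dq x 2^-1 ltac:(by rewrite invr_gt0)).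
apply/countable_injP; exists (fun x => sval (near_pt x)) => e e'.
rewrite !inE => Ee Ee' qee'; apply: contrapT => /eqP ne.
have : `|e - e'| < 1.
  set n := sval (near_pt e) in qee'.
  rewrite (_ : e - e' = (e - q n) - (e' - q n)); last first.
    by rewrite opprB addrA subrK.
  rewrite (le_lt_trans (ler_normB _ _))//.
  have := svalP (near_pt e); have := svalP (near_pt e').
  by rewrite -qee' -/n /=; lra.
rewrite -ltr_sqr ?nnegrE// (sqnormB normE)// !normE !onE// !eqxx (negbTE ne) /=.
by lra.
Qed.

(* A basis listed as a sequence, padded with zeros. *)
Definition onb_seq (R : realType) (Xi : completeNormedModType R)
    (dot : {dot Xi for idfun}) (E : set Xi) (e : nat -> Xi) :=
  [/\ forall i j, i != j -> dot (e i) (e j) = 0,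
      forall i, dot (e i) (e i) = 1 \/ e i = 0,
      forall x, (forall i, dot (e i) x = 0) -> x = 0 &
      forall a : Xi -> \bar R, a 0 = 0%E -> (forall x, 0 <= a x)%E ->
        \esum_(x in E) a x = (\sum_(0 <= i <oo) a (e i))%E].

Lemma onb_seq_exists (R : realType) (Xi : completeNormedModType R)
    (dot : {dot Xi for idfun}) (E : set Xi) :
  countable E -> orthonormal_basis dot E -> exists e, onb_seq dot E e.
Proof.
move=> cE [onE complE].
have /countable_bijP[K] := cE; rewrite card_eq_sym => /card_set_bijP[f bf].
have [funf injf surf] := bf.
(* [K] is a set of natural numbers, finite or not, in bijection with [E]; indices outside it receive
   the zero vector. *)
exists (fun i => if i \in K then f i else 0); split.
- move=> i j ij; case: ifPn => iK; last by rewrite dot0l.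
  case: ifPn => jK; last by rewrite dot0r.
  rewrite onE; [|exact/funf/set_mem..].
  by case: eqP => // /injf; rewrite iK jK => /(_ erefl erefl) /eqP; rewrite (negbTE ij).
- move=> i; case: ifPn => iK; [left|by right].
  by rewrite onE ?eqxx//; exact/funf/set_mem.
- move=> x x0; apply: complE => e /surf[i Ki <-].
  by have := x0 i; rewrite mem_set.
- move=> a a0 age0; rewrite (@reindex_esum _ _ _ K E f)// nneseries_esumT//.
  rewrite esum_mkcond; apply: eq_esum => i _.
  by case: ifPn.
Qed.

Section Parseval.
Variables (R : realType) (Xi : completeNormedModType R).
Variables (dot : {dot Xi for idfun}) (normE : norm_from_dot dot).
Variables (E : set Xi) (e : nat -> Xi) (he : onb_seq dot E e).

Let proj (x : Xi) n := \sum_(k < n) dot (e k) x *: e k.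
Let coef (x : Xi) n := \sum_(k < n) dot (e k) x ^+ 2.

Let dot_proj_ge x n j : (n <= j)%N -> dot (e j) (proj x n) = 0.
Proof.
have [orth _ _ _] := he.
move=> nj; rewrite /proj dot_sumr big1// => k _.
by rewrite dotZr orth ?mulr0// gtn_eqF// (leq_trans (ltn_ord k) nj).
Qed.

(** At a padded index [e n = 0], and the coefficient itself vanishes. *)
Let sqnorm_e x n : dot (e n) x ^+ 2 * `|e n| ^+ 2 = dot (e n) x ^+ 2.
Proof.
have [_ unit _ _] := he.
by rewrite normE; case: (unit n) => ->; rewrite ?mulr1// !dot0l expr0n mul0r.
Qed.

(** Pythagoras: each new term [dot (e n) x *: e n] is orthogonal to the previous ones. *)
Let projD x m n : (m <= n)%N ->
  `|proj x n - proj x m| ^+ 2 = coef x n - coef x m.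
Proof.
elim: n => [|n IH]; first by rewrite leqn0 => /eqP ->; rewrite !subrr normr0 expr0n.
rewrite leq_eqVlt => /orP[/eqP <-|]; first by rewrite !subrr normr0 expr0n.
rewrite ltnS => mn.
rewrite {1}/proj big_ord_recr /= -/(proj x n) addrAC (sqnormD normE) (IH mn).
rewrite dotZr dotC dotBr !dot_proj_ge// subrr !mulr0 addr0.
rewrite normrZ exprMn real_normK ?num_real// sqnorm_e.
by rewrite [in RHS]/coef big_ord_recr /= -/(coef x n) addrAC.
Qed.

Let dot_proj x z n : dot (proj x n) z = \sum_(k < n) dot (e k) x * dot (e k) z.
Proof. by rewrite /proj dot_suml; apply: eq_bigr => k _; rewrite dotZl. Qed.

(** Bessel's inequality, from the nonnegativity of [|x - proj x n| ^+ 2]. *)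
Let coef_le x n : coef x n <= `|x| ^+ 2.
Proof.
have := sqr_ge0 `|x - proj x n|; rewrite (sqnormB normE).
have := projD x (leq0n n); rewrite {2}/proj {2}/coef !big_ord0 !subr0 => ->.
rewrite dotC dot_proj; under eq_bigr do rewrite -expr2.
by rewrite -/(coef x n); lra.
Qed.

Let coef_cvg x : cvgn (coef x).
Proof.
apply: nondecreasing_is_cvgn.
  apply/nondecreasing_seqP => n.
  by rewrite /coef big_ord_recr /= lerDl sqr_ge0.
by exists (`|x| ^+ 2) => _ [n _ <-].
Qed.

(** The Fourier sums are Cauchy by Bessel and Pythagoras; the difference between [x] and their limit
    is orthogonal to every [e j], hence zero by completeness of the system. *)
Let proj_cvg x : proj x n @[n --> \oo] --> x.
Proof.
have [orth unit compl _] := he.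
have cp : cvgn (proj x).
  apply: (@cvgn_of_sqdist _ _ _ (coef x)) => [|m n mn]; last by rewrite projD.
  exact: coef_cvg.
suff xl : x = limn (proj x).
  by move: (cp : proj x n @[n --> \oo] --> limn (proj x)); rewrite -xl.
apply/eqP; rewrite -subr_eq0; apply/eqP/compl => j.
rewrite dotBr; apply/eqP; rewrite subr_eq0; apply/eqP.
suff : dot (e j) (proj x n) @[n --> \oo] --> dot (e j) x.
  move=> h; apply/esym; apply: (@cvg_unique _ _ (dot (e j) (proj x n) @[n --> \oo])) => //.
  exact: (dot_cvg normE).
(* From index [j + 1] on, the pairing of the partial sum with [e j] is constant. *)
apply/cvgrPdist_lt => eps eps0; exists j.+1 => //= n /= jn.
suff -> : dot (e j) (proj x n) = dot (e j) x by rewrite subrr normr0.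
rewrite dotC dot_proj (bigD1 (Ordinal jn)) //= big1 ?addr0; last first.
  move=> k; rewrite -val_eqE /= => kj.
  by rewrite orth// mulr0.
by case: (unit j) => ->; rewrite ?mulr1// !dot0l mul0r.
Qed.

(** The bilinear form is the one needed: the Hilbert-Schmidt norm of a finite-rank operator expands
    into mixed products of the coefficients of two vectors. *)
Lemma parseval x z :
  \sum_(k < n) dot (e k) x * dot (e k) z @[n --> \oo] --> dot x z.
Proof.
rewrite (_ : (fun n => _) = (fun n => dot z (proj x n))); last first.
  by apply/funext => n; rewrite -dot_proj dotC.
have -> : dot x z = dot z x by exact: dotC.
exact: (dot_cvg normE).
Qed.

(** The condition [T 0 = 0] makes the padding of [e] contribute nothing. *)
Lemma hs_sqnorm_seq (H : completeNormedModType R) (T : Xi -> H) : T 0 = 0 ->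
  hs_sqnorm E T = (\sum_(0 <= i <oo) (`|T (e i)| ^+ 2)%:E)%E.
Proof.
have [_ _ _ es] := he.
move=> T0; apply: (es (fun x => (`|T x| ^+ 2)%:E)) => [|x].
  by rewrite T0 normr0 expr0n.
by rewrite lee_fin sqr_ge0.
Qed.

End Parseval.

(** * Borel measurability of vector-valued maps *)

Section BorelMeasurability.
Variables (R : realType).

Lemma measurable_borelP d (T : measurableType d) (D : set T)
    (K : completeNormedModType R) (f : T -> K) :
  (measurable D -> forall U : set K, open U -> measurable (D `&` f @^-1` U)) ->
  measurable_fun D (f : T -> borel K).
Proof.
move=> h mD; apply: (@measurability _ _ _ (borel K) _ _ (@open K) erefl) => //.
by move=> _ [U oU <-]; exact: h.
Qed.

Lemma measurable_of_lt d (T : measurableType d) (D : set T) (f : T -> R) :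
  (measurable D -> forall c, measurable (D `&` [set x | f x < c])) ->
  measurable_fun D f.
Proof.
move=> h; move=> mD; apply: (measurability _ (RGenInftyO.measurableE R)) => //.
move=> _ [_ [c ->] <-].
rewrite (_ : _ @^-1` _ = [set x | f x < c]); first exact: h.
by apply/seteqP; split => x /=; rewrite in_itv.
Qed.

Lemma continuous_measurable_borel (K L : completeNormedModType R) (f : K -> L) :
  continuous f -> measurable_fun setT (f : borel K -> borel L).
Proof.
move=> /continuousP cf; apply: measurable_borelP => _ U oU; rewrite setTI; apply: sub_sigma_algebra.
exact: cf.
Qed.

Lemma continuous_measurable_borelR (K : completeNormedModType R) (f : K -> R) :
  continuous f -> measurable_fun setT (f : borel K -> R).
Proof.
move=> /continuousP cf; apply: measurable_of_lt => _ c.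
rewrite setTI; apply: sub_sigma_algebra.
rewrite (_ : mkset _ = f @^-1` [set x | x < c]) //.
by apply: cf; exact: open_lt.
Qed.

Lemma measurable_continuous_comp d (T : measurableType d) (D : set T)
    (K L : completeNormedModType R) (phi : K -> L) (f : T -> K) :
  continuous phi -> measurable_fun D (f : T -> borel K) ->
  measurable_fun D (fun x => phi (f x) : borel L).
Proof.
move=> cphi mf.
exact: (measurableT_comp (continuous_measurable_borel cphi) mf).
Qed.

Lemma measurable_continuous_compR d (T : measurableType d) (D : set T)
    (K : completeNormedModType R) (phi : K -> R) (f : T -> K) :
  continuous phi -> measurable_fun D (f : T -> borel K) ->
  measurable_fun D (fun x => phi (f x)).
Proof.
move=> cphi mf.
exact: (measurableT_comp (continuous_measurable_borelR cphi) mf).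
Qed.

Lemma measurable_norm_borel d (T : measurableType d) (D : set T)
    (K : completeNormedModType R) (f : T -> K) :
  measurable_fun D (f : T -> borel K) -> measurable_fun D (fun x => `|f x|).
Proof. by apply: measurable_continuous_compR; exact: norm_continuous. Qed.

Lemma measurable_scale_borel d (T : measurableType d) (D : set T)
    (K : completeNormedModType R) (f : T -> R) (h : K) :
  measurable_fun D f -> measurable_fun D (fun x => f x *: h : borel K).
Proof.
move=> mf; apply: (@measurableT_comp _ _ _ _ _ _ (fun r : R => r *: h : borel K) _ f) => //.
apply: measurable_borelP => _ U oU; rewrite setTI; apply: open_measurable.
have /continuousP := @scalel_continuous _ K h.
exact.
Qed.

Section Separable.
Variables (K : completeNormedModType R) (sepK : separable K).

(** In a separable space each open set is a countable union of balls with centres [q n] and radii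
    [1 / (k + 1)], so distances to fixed points decide measurability. *)
Lemma measurable_to_borel d (T : measurableType d) (D : set T) (f : T -> K) :
  (measurable D -> forall c r, measurable (D `&` [set x | `|f x - c| < r])) ->
  measurable_fun D (f : T -> borel K).
Proof.
have [q dq] := separable_seq sepK.
move=> h mD; move: mD; apply: measurable_borelP => mD U oU.
pose good n k := ball (q n) k.+1%:R^-1 `<=` U.
rewrite (_ : D `&` _ = \bigcup_n \bigcup_(k in good n)
    (D `&` [set x | `|f x - q n| < k.+1%:R^-1])); last first.
  apply/seteqP; split => [x [Dx Ufx]|x [n _ [k gk [Dx fx]]]]; last first.
    by split => //; apply: gk; rewrite -ball_normE /= distrC.
  have /nbhs_ballP[e /= e0 eU] := open_nbhs_nbhs (conj oU Ufx).
  have [k ke] : exists k, k.+1%:R^-1 < e / 2.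
    have [k _ hk] := near_infty_natSinv_lt (PosNum (divr_gt0 e0 (ltr0Sn R 1))).
    by exists k; apply: hk => /=.
  have [n qn] := dq (f x) k.+1%:R^-1 ltac:(by rewrite invr_gt0).
  exists n => //; exists k => // y; rewrite -ball_normE /= => qy.
  apply: eU; rewrite -ball_normE /=.
  rewrite (_ : f x - y = (f x - q n) + (q n - y)); last by rewrite addrA subrK.
  rewrite (splitr e); apply: le_lt_trans (ler_normD _ _) _.
  by apply: ltrD; apply: lt_trans ke.
apply: bigcupT_measurable => n; apply: bigcup_measurable => k _; exact: h.
Qed.

(** [|f - g| < c] holds exactly when some [q n] satisfies [|f - q n| + |g - q n| < c]; this
    countable description takes the place of a measurable pair in [K * K]. *)
Lemma measurable_dist_borel d (T : measurableType d) (D : set T) (f g : T -> K) :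
  measurable_fun D (f : T -> borel K) -> measurable_fun D (g : T -> borel K) ->
  measurable_fun D (fun x => `|f x - g x|).
Proof.
have [q dq] := separable_seq sepK.
move=> mf mg; apply: measurable_of_lt => mD c.
have mc n (h : T -> K) : measurable_fun D (h : T -> borel K) ->
    measurable_fun D (fun x => `|h x - q n|).
  move=> mh; apply: (@measurable_continuous_compR _ _ _ K (fun y => `|y - q n|)) => // y.
  apply: (@continuous_comp _ _ _ (fun y => y - q n) (fun y => `|y|)).
    by apply: cvgB; [exact: cvg_id|exact: cvg_cst].
  exact: norm_continuous.
rewrite (_ : D `&` _ = \bigcup_n
    (D `&` [set x | `|f x - q n| + `|g x - q n| < c])); last first.
  apply/seteqP; split => [x [Dx /= fgx]|x [n _ [Dx /= fx]]]; last first.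
    split => //=; rewrite (_ : f x - g x = (f x - q n) - (g x - q n)); last first.
      by rewrite opprB addrA subrK.
    by rewrite (le_lt_trans (ler_normB _ _)).
  (* With [q n] within half of the slack of [f x], the two distances together exceed [|f x - g x|]
     by less than the slack. *)
  have [n qn] := dq (f x) ((c - `|f x - g x|) / 2) ltac:(lra).
  exists n => //; split => //=.
  rewrite (_ : g x - q n = (g x - f x) + (f x - q n)); last by rewrite addrA subrK.
  have := ler_normD (g x - f x) (f x - q n); rewrite (distrC (g x)).
  by lra.
apply: bigcupT_measurable => n.
have := measurable_fun_ltr (measurable_funD (mc n _ mf) (mc n _ mg)) (measurable_cst c).
move=> /(_ mD [set true]); rewrite (_ : _ @^-1` _ =
  [set x | `|f x - q n| + `|g x - q n| < c]); first by apply.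
by apply/seteqP; split => x /=.
Qed.

(** The distance from [f + g] to [c] is the distance from [f] to [c - g], which
    [measurable_dist_borel] handles. *)
Lemma measurable_addv d (T : measurableType d) (D : set T) (f g : T -> K) :
  measurable_fun D (f : T -> borel K) -> measurable_fun D (g : T -> borel K) ->
  measurable_fun D (fun x => f x + g x : borel K).
Proof.
move=> mf mg; apply: measurable_to_borel => mD c r.
have mg' : measurable_fun D (fun x => c - g x : borel K).
  apply: (@measurable_continuous_comp _ _ _ K K (fun y => c - y)) => // y.
  by apply: cvgB; [exact: cvg_cst|exact: cvg_id].
have := measurable_fun_ltr (measurable_dist_borel mf mg') (measurable_cst r).
move=> /(_ mD [set true]); rewrite (_ : _ @^-1` _ =
  [set x | `|f x + g x - c| < r]); first by apply.
by apply/seteqP; split => x /=; rewrite opprB addrA.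
Qed.

Lemma measurable_oppv d (T : measurableType d) (D : set T) (f : T -> K) :
  measurable_fun D (f : T -> borel K) ->
  measurable_fun D (fun x => - f x : borel K).
Proof.
move=> mf; apply: (@measurable_continuous_comp _ _ _ K K (fun y => - y)) => // y.
by apply: cvgN; exact: cvg_id.
Qed.

Lemma measurable_subv d (T : measurableType d) (D : set T) (f g : T -> K) :
  measurable_fun D (f : T -> borel K) -> measurable_fun D (g : T -> borel K) ->
  measurable_fun D (fun x => f x - g x : borel K).
Proof. by move=> mf mg; apply: measurable_addv => //; exact: measurable_oppv. Qed.

Lemma measurable_sumv d (T : measurableType d) (D : set T) (I : Type) (r : seq I)
    (f : I -> T -> K) :
  (forall i, measurable_fun D (f i : T -> borel K)) ->
  measurable_fun D (fun x => \sum_(i <- r) f i x : borel K).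
Proof.
move=> mf; elim: r => [|i r IH].
  by under eq_fun do rewrite big_nil; exact: measurable_cst.
by under eq_fun do rewrite big_cons; exact: measurable_addv.
Qed.

End Separable.
End BorelMeasurability.

(** * Gaussian moments and independence *)

Section NormalMoment.
Variable R : realType.
Local Open Scope ereal_scope.

(** The Radon-Nikodym derivative of the normal law and [normal_pdf] have the same integral over
    every measurable set, hence agree almost everywhere. *)
Lemma ge0_integral_normal_prob (m s : R) (f : R -> \bar R) :
  measurable_fun setT f -> (forall x, 0 <= f x) ->
  \int[normal_prob m s]_x f x =
  \int[lebesgue_measure]_x (f x * (normal_pdf m s x)%:E).
Proof.
move=> mf f0.
rewrite -(Radon_Nikodym_SigmaFinite.change_of_variables
  (normal_prob_dominates m s))//.
apply: ae_eq_integral => //.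
- apply: emeasurable_funM => //; apply: measurable_int.
  exact: Radon_Nikodym_SigmaFinite.f_integrable (normal_prob_dominates m s).
- apply: emeasurable_funM => //; apply/measurable_EFinP.
  exact: measurable_normal_pdf.
apply: ae_eqe_mul2l; apply: integral_ae_eq => //.
- exact: Radon_Nikodym_SigmaFinite.f_integrable (normal_prob_dominates m s).
- apply/measurable_EFinP; exact: measurable_normal_pdf.
move=> A _ mA.
by rewrite -(Radon_Nikodym_SigmaFinite.f_integral (normal_prob_dominates m s)).
Qed.

(** By [x ^+ 2 <= 4 * exp (x ^+ 2 / 4)] the integrand is dominated by a multiple of the normal
    density of variance 2, whose integral is 1. *)
Lemma normal_sqmoment_lty :
  \int[normal_prob (0 : R) 1]_x ((x ^+ 2)%R)%:E < +oo.
Proof.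
rewrite ge0_integral_normal_prob//; last 2 first.
- by apply/measurable_EFinP; exact: measurable_funX.
- by move=> x; rewrite lee_fin sqr_ge0.
(* The 4 comes from that inequality; the quotient exchanges the normalizing constants of the two
   densities. *)
pose k := (4 * normal_peak (1 : R) / normal_peak (Num.sqrt 2 : R))%R.
have s2 : (Num.sqrt 2 : R) != 0%R by rewrite sqrtr_eq0 -ltNge.
apply: (@le_lt_trans _ _
    (\int[lebesgue_measure]_x (k%:E * (normal_pdf (0 : R) (Num.sqrt 2) x)%:E))); last first.
  rewrite integralZl//; last exact: integrable_normal_pdf.
  by rewrite integral_normal_pdf mule1 ltry.
apply: ge0_le_integral => //.
- by move=> x _; rewrite -EFinM lee_fin mulr_ge0 ?sqr_ge0 ?normal_pdf_ge0.
- apply: emeasurable_funM; apply/measurable_EFinP; first exact: measurable_funX.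
  exact: measurable_normal_pdf.
- apply: emeasurable_funM; apply/measurable_EFinP => //.
  exact: measurable_normal_pdf.
move=> x _; rewrite -!EFinM lee_fin !normal_pdfE// /normal_fun subr0.
rewrite sqr_sqrtr// expr1n /k.
have pk0 : (normal_peak (Num.sqrt 2 : R) != 0)%R by rewrite gt_eqF// normal_peak_gt0.
rewrite [leLHS]mulrCA [leRHS](_ : _ =
  normal_peak 1 * (4 * expR (- x ^+ 2 / (2 *+ 2))))%R; last by field.
rewrite ler_wpM2l ?normal_peak_ge0//.
rewrite (_ : (- x ^+ 2 / (1 *+ 2) = - (x ^+ 2 / 4) + - x ^+ 2 / (2 *+ 2))%R); last first.
  by field.
rewrite expRD mulrA ler_wpM2r ?expR_ge0//.
rewrite expRN ler_pdivrMr ?expR_gt0//.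
by have := @expR_ge1Dx R (x ^+ 2 / 4); lra.
Qed.

End NormalMoment.

Section Independence.
Context d (Omega : measurableType d) (R : realType) (P : probability Omega R).
Local Open Scope ereal_scope.

(** By uniqueness on rectangles the joint law of [Y] and [Z] is the product of their laws. Tonelli
    then gives integrability of the product and Fubini its integral. *)
Lemma indep_integralM (Y Z : Omega -> R) :
  (forall A B, measurable A -> measurable B ->
    P (Y @^-1` A `&` Z @^-1` B) = P (Y @^-1` A) * P (Z @^-1` B)) ->
  P.-integrable setT (EFin \o Y) -> P.-integrable setT (EFin \o Z) ->
  P.-integrable setT (fun w => (Y w * Z w)%:E) /\
  \int[P]_w (Y w * Z w)%:E = \int[P]_w (Y w)%:E * \int[P]_w (Z w)%:E.
Proof.
move=> indep iY iZ.
have mY : measurable_fun setT Y by apply/measurable_EFinP/(measurable_int _ iY).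
have mZ : measurable_fun setT Z by apply/measurable_EFinP/(measurable_int _ iZ).
pose Y' : {RV P >-> R} := mfun_Sub (mem_set mY).
pose Z' : {RV P >-> R} := mfun_Sub (mem_set mZ).
pose muY := distribution P Y'; pose muZ := distribution P Z'.
pose YZ w := (Y w, Z w).
have mYZ : measurable_fun setT YZ by exact: measurable_fun_pair.
pose YZ' : {mfun Omega >-> (R * R)%type} := mfun_Sub (mem_set mYZ).
pose law := pushforward P YZ'.
have lawE (A : set (R * R)) : measurable A -> (muY \x muZ) A = law A.
  by apply: product_measure_unique => B C mB mC; exact: indep.
pose f (z : R * R) := (z.1 * z.2)%R.
have mf : measurable_fun setT f by exact: measurable_funM.
have prod_int g : measurable_fun setT g -> (forall z, 0 <= g z) ->
    \int[P]_w g (YZ w) = \int[muY]_y \int[muZ]_z g (y, z).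
  move=> mg g0.
  rewrite -[RHS](@fubini_tonelli1 _ _ _ _ _ muY muZ g)//.
  rewrite (eq_measure_integral law); last by move=> A mA _; exact: lawE.
  by rewrite ge0_integral_pushforward.
have mabs : measurable_fun setT (fun y : R => `|y|%:E).
  by apply/measurable_EFinP; exact: normr_measurable.
have iYabs : \int[muY]_y `|y|%:E < +oo.
  rewrite /muY ge0_integral_distribution//.
  by have /integrableP[_] := iY.
have iZabs : \int[muZ]_y `|y|%:E < +oo.
  rewrite /muZ ge0_integral_distribution//.
  by have /integrableP[_] := iZ.
have iprod : P.-integrable setT (fun w => (f (YZ w))%:E).
  apply/integrableP; split.
    by apply/measurable_EFinP; exact: (measurableT_comp mf mYZ).
  rewrite (prod_int (fun z => `|(f z)%:E|))//=; last first.
    exact: (measurableT_comp mabs mf).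
  have inner y : \int[muZ]_z `|f (y, z)|%:E = `|y|%:E * \int[muZ]_z `|z|%:E.
    rewrite -ge0_integralZl//.
    by apply: eq_integral => z _; rewrite -EFinM -normrM.
  under eq_integral do rewrite inner.
  rewrite /= ge0_integralZr//; last first.
    by apply: integral_ge0 => y _; rewrite lee_fin.
  by rewrite lte_mul_pinfty// ?integral_ge0// ge0_fin_numE// integral_ge0.
split => //.
have ilaw : (muY \x muZ).-integrable setT (EFin \o f).
  apply/integrable12ltyP; first exact/measurable_EFinP.
  rewrite -(prod_int (fun z => `|(EFin \o f) z|))//=; last first.
    exact: (measurableT_comp mabs mf).
  by have /integrableP[_] := iprod.
transitivity (\int[law]_z (f z)%:E).
  by rewrite integral_pushforward//; exact/measurable_EFinP.
rewrite -(eq_measure_integral law (m1 := muY \x muZ)); last first.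
  by move=> A mA _; exact: lawE.
rewrite -integral12_prod_meas1//= /fubini_F /f /=.
have iZ' : muZ.-integrable setT EFin.
  by apply/integrableP; split => //; exact/measurable_EFinP.
have iY' : muY.-integrable setT EFin.
  by apply/integrableP; split => //; exact/measurable_EFinP.
under eq_integral => y _ do (under eq_integral do rewrite EFinM; rewrite integralZl//).
have fZ := integrable_fin_num measurableT iZ'.
rewrite -(fineK fZ) integralZr// fineK//.
by rewrite !integral_distribution.
Qed.

End Independence.

(** * Increments of the cylindrical Wiener process *)

Definition gauss_sqmoment (R : realType) : R :=
  fine (\int[normal_prob (0 : R) 1]_x (x ^+ 2)%:E).

Section Increments.
Variables (R : realType) (Xi : completeNormedModType R).
Variables (dotXi : {dot Xi for idfun}) (normXi : norm_from_dot dotXi).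
Context (d : measure_display) (Omega : measurableType d).
Variables (P : probability Omega R) (W : R -> Xi -> Omega -> R) (t T : R).
Hypothesis rs : reference_space P W t T.

Local Notation F r := (filtration_gen P W t r).
Local Notation Om r := (g_sigma_algebraType (F r)).
Local Notation inc := (increment W).

(** The negligible sets among the generators are measurable because [P] is complete; the others are
    preimages under [W tau xi] with [tau <= T]. *)
Lemma filtration_sub r A : r <= T -> <<s F r >> A -> measurable A.
Proof.
move=> rT; apply: smallest_sub; first exact: sigma_algebra_measurable.
move=> B [[tau [xi [C [/andP[ttau taur] mC ->]]]]|nB].
  rewrite -[X in measurable X]setTI; apply: (rs_measurable rs) => //.
  by rewrite ttau (le_trans taur).
exact: (rs_complete rs).
Qed.

Lemma filtration_mono r s A : r <= s -> <<s F r >> A -> <<s F s >> A.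
Proof.
move=> rls; move: A; apply: sub_sigma_algebra2 => B [[tau [xi [C [/andP[ttau taur] mC ->]]]]|nB].
  by left; exists tau, xi, C; split => //; rewrite ttau (le_trans taur).
by right.
Qed.

Lemma filtration_measurable d' (U : measurableType d') r (Y : Omega -> U) :
  r <= T -> measurable_fun setT (Y : Om r -> U) -> measurable_fun setT Y.
Proof.
move=> rT mY _ B mB; apply: (filtration_sub rT).
exact: (mY measurableT).
Qed.

Lemma W_adapted tau r xi : t <= tau <= r -> measurable_fun setT (W tau xi : Om r -> R).
Proof.
move=> taur _ B mB; rewrite setTI; apply: sub_sigma_algebra.
by left; exists tau, xi, B.
Qed.

Lemma increment_adapted q r s xi : t <= q -> q <= r -> r <= s ->
  measurable_fun setT (inc q r xi : Om s -> R).
Proof.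
move=> tq qr rls.
apply: (@measurable_funB _ (Om s) R setT (W r xi) (W q xi)); apply: W_adapted.
  by rewrite (le_trans tq).
by rewrite tq (le_trans qr).
Qed.

Lemma measurable_increment r s xi : t <= r -> r <= s -> s <= T ->
  measurable_fun setT (inc r s xi).
Proof.
move=> tr rls sT; apply: (filtration_measurable sT).
exact: increment_adapted.
Qed.

Lemma increment_linear r s (c : R) xi eta : t <= r -> r <= s -> s <= T ->
  {ae P, forall w, inc r s (c *: xi + eta) w = c * inc r s xi w + inc r s eta w}.
Proof.
move=> tr rls sT.
have tsT : t <= s <= T by rewrite sT (le_trans tr).
have trT : t <= r <= T by rewrite tr (le_trans rls).
apply: filterS2 (rs_linear rs c xi eta tsT) (rs_linear rs c xi eta trT) => w h1 h2.
by rewrite /increment h1 h2; ring.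
Qed.

Lemma increment0 r s : t <= r -> r <= s -> s <= T ->
  {ae P, forall w, inc r s 0 w = 0}.
Proof.
move=> tr rls sT.
apply: filterS (increment_linear 1 0 0 tr rls sT) => w.
by rewrite scaler0 addr0 => h; lra.
Qed.

Lemma increment_scale r s (c : R) xi : t <= r -> r <= s -> s <= T ->
  {ae P, forall w, inc r s (c *: xi) w = c * inc r s xi w}.
Proof.
move=> tr rls sT.
apply: filterS2 (increment_linear c xi 0 tr rls sT) (increment0 tr rls sT) => w.
by rewrite addr0 => -> ->; rewrite addr0.
Qed.

Local Notation sigma r s xi := (Num.sqrt (s - r) * `|xi : Xi|).

Let law r s xi (mfun_inc : measurable_fun setT (inc r s xi)) :
  {RV P >-> R} := mfun_Sub (mem_set mfun_inc).

Lemma ge0_integral_increment r s xi (f : R -> \bar R) :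
  t <= r -> r < s -> s <= T -> xi != 0 ->
  measurable_fun setT f -> (forall x, 0 <= f x)%E ->
  (\int[P]_w f (inc r s xi w) = \int[normal_prob 0 (sigma r s xi)]_x f x)%E.
Proof.
move=> tr rls sT xi0 mf f0.
have mi := measurable_increment xi tr (ltW rls) sT.
pose X : {mfun Omega >-> measurableTypeR R} :=
  @mfun_Sub _ _ Omega (measurableTypeR R) (inc r s xi) (mem_set mi).
transitivity (\int[distribution P X]_x f x)%E.
  by rewrite ge0_integral_distribution.
by apply: eq_measure_integral => A mA _; exact: (rs_gaussian rs).
Qed.

Let sq_increment_scale r s (c : R) xi : t <= r -> r <= s -> s <= T ->
  (\int[P]_w ((inc r s (c *: xi) w) ^+ 2)%:E =
   (c ^+ 2)%:E * \int[P]_w ((inc r s xi w) ^+ 2)%:E)%E.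
Proof.
move=> tr rls sT.
have m2 eta : measurable_fun setT (fun w => ((inc r s eta w) ^+ 2)%:E).
  by apply/measurable_EFinP/measurable_funX; exact: measurable_increment.
rewrite -ge0_integralZl//; last 2 first.
- by move=> w _; rewrite lee_fin sqr_ge0.
- by rewrite lee_fin sqr_ge0.
apply: ae_eq_integral => //; first exact: emeasurable_funM.
apply: filterS (increment_scale c xi tr rls sT) => w -> _.
by rewrite exprMn EFinM.
Qed.

(** Linearity in the direction reduces every nonzero [xi] to one whose increment is standard normal;
    the factor [(s - r) * |xi| ^+ 2] is the inverse square of the scaling. *)
Lemma increment_sqmoment r s xi : t <= r -> r <= s -> s <= T ->
  (\int[P]_w ((inc r s xi w) ^+ 2)%:E =
   (gauss_sqmoment R * (s - r) * `|xi| ^+ 2)%:E)%E.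
Proof.
move=> tr; rewrite le_eqVlt => /orP[/eqP <- _|rls sT].
  rewrite subrr mulr0 mul0r.
  under eq_integral do rewrite /increment subrr expr0n /=.
  by rewrite integral0.
have [->|xi0] := eqVneq xi 0.
  rewrite normr0 expr0n mulr0 -(scale0r 0) sq_increment_scale//; last exact: ltW.
  by rewrite expr0n mul0e.
have sr0 : 0 < s - r by rewrite subr_gt0.
have sg0 : 0 < sigma r s xi by rewrite mulr_gt0 ?sqrtr_gt0 ?normr_gt0.
pose k := (sigma r s xi)^-1.
have k0 : 0 < k by rewrite invr_gt0.
have : (\int[P]_w ((inc r s (k *: xi) w) ^+ 2)%:E = (gauss_sqmoment R)%:E)%E.
  rewrite (@ge0_integral_increment r s (k *: xi) (fun x => (x ^+ 2)%:E))//.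
  - rewrite normrZ gtr0_norm// mulrCA mulVf ?gt_eqF//.
    rewrite /gauss_sqmoment fineK// ge0_fin_numE ?normal_sqmoment_lty//.
    by apply: integral_ge0 => x _; rewrite lee_fin sqr_ge0.
  - by rewrite scaler_eq0 negb_or gt_eqF.
  - by apply/measurable_EFinP; exact: measurable_funX.
  - by move=> x; rewrite lee_fin sqr_ge0.
rewrite sq_increment_scale// ?(ltW rls)//.
(* An infinite moment would remain infinite after scaling, against the finite standard one. *)
have [r0|r0] := eqVneq (\int[P]_w ((inc r s xi w) ^+ 2)%:E)%E +oo%E.
  by rewrite r0 gt0_muley ?lte_fin ?exprn_gt0.
have : (\int[P]_w ((inc r s xi w) ^+ 2)%:E)%E \is a fin_num.
  rewrite ge0_fin_numE ?ltey//.
  by apply: integral_ge0 => x _; rewrite lee_fin sqr_ge0.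
move=> /fineK <-; rewrite -EFinM => -[km]; congr (_%:E).
rewrite -km /k exprVn exprMn sqr_sqrtr; last exact: ltW.
by field; rewrite normr_eq0 xi0 subr_eq0 gt_eqF.
Qed.

Lemma integrable_sq_increment r s xi : t <= r -> r <= s -> s <= T ->
  P.-integrable setT (fun w => ((inc r s xi w) ^+ 2)%:E).
Proof.
move=> tr rls sT; apply/integrableP; split.
  by apply/measurable_EFinP/measurable_funX; exact: measurable_increment.
under eq_integral do rewrite gee0_abs ?lee_fin ?sqr_ge0//.
by rewrite increment_sqmoment// ltry.
Qed.

Lemma integrable_increment r s xi : t <= r -> r <= s -> s <= T ->
  P.-integrable setT (EFin \o inc r s xi).
Proof.
move=> tr rls sT.
apply: (@le_integrable _ _ _ _ _ measurableT _
  (fun w => (1 + (inc r s xi w) ^+ 2)%:E)).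
- by apply/measurable_EFinP; exact: measurable_increment.
- move=> w _ /=; rewrite lee_fin [leRHS]ger0_norm; last first.
    by rewrite addr_ge0// sqr_ge0.
  rewrite -[X in _ <= 1 + X]real_normK ?num_real//.
  by have := sqr_ge0 (`|inc r s xi w| - 1); nra.
- apply: (@integrableD _ _ _ P _ measurableT (cst 1%:E) (fun w => ((inc r s xi w) ^+ 2)%:E)) => //.
    exact: finite_measure_integrable_cst.
  exact: integrable_sq_increment.
Qed.

Lemma increment_mean r s xi : t <= r -> r <= s -> s <= T ->
  (\int[P]_w (inc r s xi w)%:E = 0)%E.
Proof.
move=> tr; rewrite le_eqVlt => /orP[/eqP <- _|rls sT].
  by under eq_integral do rewrite /increment subrr; rewrite integral0.
have mi eta := measurable_increment eta tr (ltW rls) sT.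
have [->|xi0] := eqVneq xi 0.
  rewrite (ae_eq_integral (cst 0%E)) ?integral0//.
    by apply/measurable_EFinP.
  by apply: filterS (increment0 tr (ltW rls) sT) => w -> _.
have ii eta := integrable_increment eta tr (ltW rls) sT.
(* The law is symmetric because - xi has the same norm as xi. *)
have same : (\int[P]_w (inc r s xi w)%:E = \int[P]_w (inc r s ((-1) *: xi) w)%:E)%E.
  rewrite -[LHS](@integral_distribution _ _ _ _ _ _ (law (mi xi)) EFin)//; last exact: ii.
  rewrite -[RHS](@integral_distribution _ _ _ _ _ _ (law (mi ((-1) *: xi))) EFin)//; last exact: ii.
  apply: eq_measure_integral => A mA _.
  rewrite [LHS](rs_gaussian rs)// [RHS](rs_gaussian rs)//.
    by rewrite normrZ normrN1 mul1r.
  by rewrite scaler_eq0 oppr_eq0 oner_eq0.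
have opp : (\int[P]_w (inc r s ((-1) *: xi) w)%:E = (-1)%:E * \int[P]_w (inc r s xi w)%:E)%E.
  rewrite -integralZl//; last exact: ii.
  apply: ae_eq_integral => //.
  - by apply/measurable_EFinP.
  - by apply/measurable_EFinP; exact: measurable_funM.
  - by apply: filterS (increment_scale (-1) xi tr (ltW rls) sT) => w -> _.
have := integrable_fin_num measurableT (ii xi).
move: opp; rewrite -same.
case: (\int[P]_w (inc r s xi w)%:E)%E => //= x.
by rewrite -EFinM => -[] xx _; congr (_%:E); lra.
Qed.

Lemma integrable_indic_increment A r s xi : measurable A ->
  t <= r -> r <= s -> s <= T ->
  P.-integrable setT (fun w => (\1_A w * inc r s xi w)%:E).
Proof.
move=> mA tr rls sT.
apply: le_integrable (integrable_increment xi tr rls sT) => //.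
  apply/measurable_EFinP/measurable_funM; first exact: measurable_indic.
  exact: measurable_increment.
move=> w _ /=; rewrite lee_fin normrM ler_piMl//.
by rewrite indicE; case: (w \in A); rewrite ?normr1 ?normr0.
Qed.

(** [Y] is independent of the increment over [[u, v]], whose mean is zero. All contributions of
    disjoint time intervals to the isometry vanish for this reason. *)
Lemma adapted_increment_integral u v xi (Y : Omega -> R) :
  t <= u -> u <= v -> v <= T -> measurable_fun setT (Y : Om u -> R) ->
  P.-integrable setT (EFin \o Y) ->
  P.-integrable setT (fun w => (Y w * inc u v xi w)%:E) /\
  (\int[P]_w (Y w * inc u v xi w)%:E = 0)%E.
Proof.
move=> tu uv vT mY iY.
have [] := indep_integralM _ iY (integrable_increment xi tu uv vT).
  move=> A B mA mB; apply: (rs_independent rs) => //.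
  by rewrite -[X in <<s _ >> X]setTI; exact: mY.
by move=> ? ->; rewrite increment_mean// mule0.
Qed.

(** [A] belongs to the sigma-algebra at time [u], so its indicator is independent of the squared
    increment. *)
Lemma indic_sq_increment u v xi A : t <= u -> u <= v -> v <= T -> <<s F u >> A ->
  P.-integrable setT (fun w => (\1_A w * (inc u v xi w) ^+ 2)%:E) /\
  (\int[P]_w (\1_A w * (inc u v xi w) ^+ 2)%:E =
    P A * (gauss_sqmoment R * (v - u) * `|xi| ^+ 2)%:E)%E.
Proof.
move=> tu uv vT FA.
have mA := filtration_sub (le_trans uv vT) FA.
have iA : P.-integrable setT (EFin \o (\1_A : Omega -> R)).
  exact: integrable_indic.
have [] := @indep_integralM _ _ _ P _ (fun w => (inc u v xi w) ^+ 2) _ iA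
  (integrable_sq_increment xi tu uv vT).
  move=> B C mB mC.
  have -> : (fun w => inc u v xi w ^+ 2) @^-1` C =
    inc u v xi @^-1` ((fun x => x ^+ 2) @^-1` C) by [].
  apply: (rs_independent rs) => //.
    have : measurable_fun setT (\1_A : Om u -> R) by exact: measurable_indic.
    by move=> /(_ measurableT _ mB); rewrite setTI.
  by rewrite -[X in measurable X]setTI; exact: (measurable_funX 2 (@measurable_id _ _ setT)).
move=> ? ->; split => //.
by rewrite integral_indic// setIT increment_sqmoment.
Qed.

(** Polarization: almost surely, four times the product of the increments is the difference of the
    squared increments in the directions [xi + eta] and [xi - eta]. *)
Lemma indic_increment_cov u v xi eta A :
  t <= u -> u <= v -> v <= T -> <<s F u >> A ->
  P.-integrable setT (fun w => (\1_A w * inc u v xi w * inc u v eta w)%:E) /\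
  (\int[P]_w (\1_A w * inc u v xi w * inc u v eta w)%:E =
    P A * (gauss_sqmoment R * (v - u) * dotXi xi eta)%:E)%E.
Proof.
move=> tu uv vT FA.
have mA := filtration_sub (le_trans uv vT) FA.
pose q zeta w := \1_A w * (inc u v zeta w) ^+ 2.
(* The scalars 1 and -1 give the two directions the shape [c *: xi + eta] in which [W] is linear. *)
have [ip vp] := indic_sq_increment (1 *: xi + eta) tu uv vT FA.
have [im vm] := indic_sq_increment ((-1) *: eta + xi) tu uv vT FA.
have ae : ae_eq P setT
    (fun w => (\1_A w * inc u v xi w * inc u v eta w)%:E)
    (fun w => (4^-1)%:E * ((q (1 *: xi + eta) w)%:E - (q ((-1) *: eta + xi) w)%:E))%E.
  apply: filterS2 (increment_linear 1 xi eta tu uv vT)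
    (increment_linear (-1) eta xi tu uv vT) => w h1 h2 _.
  by rewrite /q h1 h2 -EFinB -EFinM; congr (_%:E); field.
have iq := integrableZl measurableT (4^-1) (integrableB measurableT ip im).
have mf : measurable_fun setT (fun w => (\1_A w * inc u v xi w * inc u v eta w)%:E).
  apply/measurable_EFinP; apply: measurable_funM; last exact: measurable_increment.
  by apply: measurable_funM; [exact: measurable_indic|exact: measurable_increment].
split.
  apply/integrableP; split => //.
  rewrite (ae_eq_integral (abse \o (fun w => (4^-1)%:E * ((q (1 *: xi + eta) w)%:E -
    (q ((-1) *: eta + xi) w)%:E))))%E//.
  - by have /integrableP[] := iq.
  - exact: measurableT_comp.
  - by apply: measurableT_comp => //; exact: measurable_int iq.
  - by apply: filterS ae => w h Tw; exact: (congr1 abse (h Tw)).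
rewrite (ae_eq_integral _ _ measurableT mf (measurable_int _ iq) ae).
rewrite integralZl//; last exact: integrableB.
rewrite integralB// vp vm.
have /fineK <- := fin_num_measure P _ mA.
rewrite scale1r scaleN1r (addrC (- eta)) (sqnormB normXi) (sqnormD normXi).
have lift (a x y z : R) : 4^-1 * (a * x - a * y) = a * z ->
  ((4^-1)%:E * (a%:E * x%:E - a%:E * y%:E) = a%:E * z%:E)%E.
  by move=> h; exact: (congr1 EFin h).
by apply: lift; field.
Qed.

End Increments.

(** * The isometry for elementary integrands *)

Lemma integral_sum2 d (T : measurableType d) (R : realType)
    (mu : {measure set T -> \bar R}) (D : set T) (mD : measurable D) n
    (g : 'I_n -> 'I_n -> T -> R) :
  (forall i j, mu.-integrable D (EFin \o g i j)) ->
  mu.-integrable D (fun x => (\sum_i \sum_j g i j x)%:E) /\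
  (\int[mu]_(x in D) (\sum_i \sum_j g i j x)%:E =
   \sum_i \sum_j \int[mu]_(x in D) (g i j x)%:E)%E.
Proof.
move=> ig.
have ig1 i : mu.-integrable D (fun x => \sum_j (g i j x)%:E)%E.
  by apply: integrable_sum => // j _; exact: ig.
rewrite (_ : (fun x => (\sum_i \sum_j g i j x)%:E) =
    (fun x => \sum_i \sum_j (g i j x)%:E)%E); last first.
  by apply/funext => x; rewrite -sumEFin; apply: eq_bigr => i _; rewrite -sumEFin.
split; first by apply: integrable_sum => // i _; exact: ig1.
rewrite integral_sum//; first apply: eq_bigr => i _.
by rewrite integral_sum//; move=> j; exact: ig.
Qed.

Lemma integrable_indic_lty d (T : measurableType d) (R : realType)
    (mu : {measure set T -> \bar R}) (D A : set T) :
  measurable D -> measurable A -> (mu (A `&` D) < +oo)%E ->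
  mu.-integrable D (fun x => (\1_A x)%:E).
Proof.
move=> mD mA fA; apply/integrableP; split.
  by apply/measurable_EFinP; exact: measurable_indic.
under eq_integral do rewrite gee0_abs ?lee_fin//.
by rewrite integral_indic.
Qed.

Lemma cvgn_sum (R : realType) n (f : 'I_n -> nat -> R) (l : 'I_n -> R) :
  (forall i, f i m @[m --> \oo] --> l i) ->
  \sum_i f i m @[m --> \oo] --> \sum_i l i.
Proof.
elim: n f l => [|n IH] f l fl.
  under eq_cvg do rewrite big_ord0.
  by rewrite big_ord0; exact: cvg_cst.
under eq_cvg do rewrite big_ord_recr.
rewrite big_ord_recr /=; apply: cvgD; last exact: fl.
by apply: IH => i; exact: fl.
Qed.

Section HilbertSchmidtFinite.
Variables (R : realType) (H Xi : completeNormedModType R).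
Variables (dotH : {dot H for idfun}) (dotXi : {dot Xi for idfun}).
Hypotheses (normH : norm_from_dot dotH) (normXi : norm_from_dot dotXi).
Variables (E : set Xi) (e : nat -> Xi) (he : onb_seq dotXi E e).

(** The squared norm at each basis vector expands into a double sum; after an exchange of sums
    Parseval evaluates the sum over the basis to [dotXi (xi i) (xi j)]. *)
Lemma hs_sqnorm_finite_rank n (a : 'I_n -> R) (xi : 'I_n -> Xi) (h : 'I_n -> H) :
  hs_sqnorm E (fun eta => \sum_i (a i * dotXi (xi i) eta) *: h i) =
  (\sum_i \sum_j a i * a j * (dotXi (xi i) (xi j) * dotH (h i) (h j)))%:E.
Proof.
rewrite (hs_sqnorm_seq he); last first.
  by rewrite big1// => i _; rewrite dot0r mulr0 scale0r.
apply/cvg_lim => //.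
under eq_cvg do rewrite sumEFin.
apply: cvg_EFin; first by near=> m.
rewrite /comp /=.
rewrite (_ : (fun m => _) = (fun m => \sum_i \sum_j a i * a j *
    ((\sum_(k < m) dotXi (e k) (xi i) * dotXi (e k) (xi j)) *
     dotH (h i) (h j)))); last first.
  apply/funext => m; rewrite big_mkord.
  under eq_bigr => k _ do rewrite (sqnorm_sumZ normH).
  rewrite exchange_big; apply: eq_bigr => i _.
  rewrite exchange_big; apply: eq_bigr => j _.
  rewrite mulr_suml mulr_sumr; apply: eq_bigr => k _.
  by rewrite (dotC dotXi (xi i)) (dotC dotXi (xi j)); ring.
apply: cvgn_sum => i; apply: cvgn_sum => j.
apply: cvgMr; apply: cvgMl; exact: (parseval normXi he).
Unshelve. all: by end_near. Qed.

End HilbertSchmidtFinite.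

Section ElementaryIsometry.
Variables (R : realType) (H Xi : completeNormedModType R).
Variables (dotH : {dot H for idfun}) (dotXi : {dot Xi for idfun}).
Hypotheses (normH : norm_from_dot dotH) (normXi : norm_from_dot dotXi).
Variables (E : set Xi) (e : nat -> Xi) (he : onb_seq dotXi E e).
Context (d : measure_display) (Omega : measurableType d).
Variables (P : probability Omega R) (W : R -> Xi -> Omega -> R) (t T : R).
Hypothesis rs : reference_space P W t T.

Local Notation F r := (filtration_gen P W t r).
Local Notation Om r := (g_sigma_algebraType (F r)).
Local Notation inc := (increment W).
Local Notation leb := (@lebesgue_measure R).
Local Notation gs := (gauss_sqmoment R).

(** The longer increment is cut at [v1]: its second part is centred and independent of the past, and
    its first part gives the covariance over [[u, v1]]. *)
Let cov_same_start u v1 v2 xi eta B :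
  t <= u -> u <= v1 -> v1 <= v2 -> v2 <= T -> <<s F u >> B ->
  P.-integrable setT (fun w => (\1_B w * inc u v1 xi w * inc u v2 eta w)%:E) /\
  (\int[P]_w (\1_B w * inc u v1 xi w * inc u v2 eta w)%:E =
   P B * (gs * (v1 - u) * dotXi xi eta)%:E)%E.
Proof.
move=> tu uv1 v12 v2T FB.
have v1T := le_trans v12 v2T.
have mB := filtration_sub rs (le_trans uv1 v1T) FB.
have [i1 e1] := indic_increment_cov normXi rs xi eta tu uv1 v1T FB.
have mY : measurable_fun setT ((fun w => \1_B w * inc u v1 xi w) : Om v1 -> R).
  apply: (@measurable_funM _ (Om v1)); last exact: increment_adapted.
  by apply: measurable_indic; exact: filtration_mono FB.
have [i2 e2] := adapted_increment_integral rs eta (le_trans tu uv1) v12 v2T mY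
  (integrable_indic_increment rs xi mB tu uv1 v1T).
rewrite (_ : (fun w => _) = (fun w => (\1_B w * inc u v1 xi w * inc u v1 eta w)%:E +
    (\1_B w * inc u v1 xi w * inc v1 v2 eta w)%:E)%E); last first.
  by apply/funext => w; rewrite -EFinD -mulrDr /increment; congr (_ * _)%:E; ring.
split; first exact: integrableD.
by rewrite integralD// e1 e2 adde0.
Qed.

Local Notation itv c := (`]el_lo c, el_hi c]%classic : set R).
Local Notation coef c w :=
  (\1_(el_event c) w * inc (el_lo c) (el_hi c) (el_dir c) w).

(** The increment that starts first is cut at the starting time [u] of the other. What precedes [u]
    is known at time [u] and contributes nothing; what follows has the same start as the other
    increment. *)
Lemma elementary_cov s (c1 c2 : elementary H Xi Omega) : s <= T ->
  elementary_adapted P W t s c1 -> elementary_adapted P W t s c2 ->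
  P.-integrable setT (fun w => (coef c1 w * coef c2 w)%:E) /\
  (\int[P]_w (coef c1 w * coef c2 w)%:E =
   P (el_event c1 `&` el_event c2) *
   (gs * fine (leb (itv c1 `&` itv c2)) * dotXi (el_dir c1) (el_dir c2))%:E)%E.
Proof.
move=> sT.
wlog lo12 : c1 c2 / el_lo c1 <= el_lo c2.
  move=> hw a1 a2; have [/hw|/ltW/hw] := leP (el_lo c1) (el_lo c2); first exact.
  move=> /(_ a2 a1) [h1 h2].
  rewrite [X in P.-integrable _ X](_ : _ = (fun w => (coef c2 w * coef c1 w)%:E)); last first.
    by apply/funext => w; rewrite mulrC.
  split=> //.
  under eq_integral do rewrite mulrC.
  by rewrite h2 setIC (setIC (itv c2)) (dotC dotXi).
move=> [tlo1 lohi1 hi1s A1] [tlo2 lohi2 hi2s A2].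
set B := el_event c1 `&` el_event c2.
set u := el_lo c2 in lo12 tlo2 lohi2 A2 *.
have hi1T := le_trans hi1s sT; have hi2T := le_trans hi2s sT.
have uT : u <= T by exact: le_trans hi2T.
have FB : <<s F u >> B.
  by apply: (@measurableI _ (Om u)) => //; exact: filtration_mono A1.
have mB := filtration_sub rs uT FB.
(* Without overlap, the whole first coefficient is known at time [u]. *)
have [hi1u|uhi1] := leP (el_hi c1) u.
  rewrite (_ : itv c1 `&` itv c2 = set0); last first.
    apply/seteqP; split => // x [] /=; rewrite !in_itv /= => /andP[_ h1] /andP[h2 _].
    by have := lt_le_trans h2 (le_trans h1 hi1u); rewrite ltxx.
  rewrite measure0 /= mulr0 mul0r mule0.
  have mY : measurable_fun setT
      ((fun w => \1_B w * inc (el_lo c1) (el_hi c1) (el_dir c1) w) : Om u -> R).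
    by apply: (@measurable_funM _ (Om u)); [exact: measurable_indic|exact: increment_adapted].
  have [i0 e0] := adapted_increment_integral rs (el_dir c2) tlo2 lohi2 hi2T mY
    (integrable_indic_increment rs (el_dir c1) mB tlo1 lohi1 hi1T).
  rewrite (_ : (fun w => (coef c1 w * coef c2 w)%:E) = (fun w =>
    (\1_B w * inc (el_lo c1) (el_hi c1) (el_dir c1) w * inc u (el_hi c2) (el_dir c2) w)%:E)) //.
  by apply/funext => w; rewrite /B indicI /=; congr (_%:E); ring.
have mY : measurable_fun setT
    ((fun w => \1_B w * inc (el_lo c1) u (el_dir c1) w) : Om u -> R).
  by apply: (@measurable_funM _ (Om u)); [exact: measurable_indic|exact: increment_adapted].
have [i0 e0] := adapted_increment_integral rs (el_dir c2) tlo2 lohi2 hi2T mY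
    (integrable_indic_increment rs (el_dir c1) mB tlo1 lo12 uT).
have key : P.-integrable setT (fun w => (\1_B w * inc u (el_hi c1) (el_dir c1) w *
      inc u (el_hi c2) (el_dir c2) w)%:E) /\
    (\int[P]_w (\1_B w * inc u (el_hi c1) (el_dir c1) w *
      inc u (el_hi c2) (el_dir c2) w)%:E =
     P B * (gs * fine (leb (itv c1 `&` itv c2)) * dotXi (el_dir c1) (el_dir c2))%:E)%E.
  have [hi12|/ltW hi21] := leP (el_hi c1) (el_hi c2).
    rewrite (_ : itv c1 `&` itv c2 = `]u, el_hi c1]%classic); last first.
      apply/seteqP; split => x /=; rewrite !in_itv /=.
        by move=> [/andP[_ ->] /andP[-> _]].
      move=> /andP[ux xh]; rewrite xh ux (le_trans xh hi12) andbT.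
      by rewrite (le_lt_trans lo12 ux).
    rewrite lebesgue_measure_itv /= lte_fin uhi1 /=.
    by apply: cov_same_start => //; exact: ltW.
  rewrite (_ : itv c1 `&` itv c2 = `]u, el_hi c2]%classic); last first.
    apply/seteqP; split => x /=; rewrite !in_itv /=.
      by move=> [_].
    move=> /andP[ux xh]; rewrite xh ux (le_trans xh hi21) andbT.
    by rewrite (le_lt_trans lo12 ux).
  rewrite lebesgue_measure_itv /= lte_fin.
  (* An empty interval, [el_hi c2 = u], is allowed; its measure 0 agrees with the length formula. *)
  rewrite (_ : fine (if u < el_hi c2 then _ else _) = el_hi c2 - u); last first.
    case: ltP => //= h; apply/esym/eqP; rewrite subr_eq0 eq_le h; exact: lohi2.
  have [h1 h2] := cov_same_start (el_dir c2) (el_dir c1) tlo2 lohi2 hi21 hi1T FB.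
  rewrite (dotC dotXi (el_dir c1)) -h2.
  rewrite (_ : (fun w => _) = (fun w => (\1_B w * inc u (el_hi c2) (el_dir c2) w *
    inc u (el_hi c1) (el_dir c1) w)%:E)) //.
  by apply/funext => w; rewrite mulrAC.
have [i1 e1] := key.
rewrite (_ : (fun w => (coef c1 w * coef c2 w)%:E) = (fun w =>
  (\1_B w * inc (el_lo c1) u (el_dir c1) w * inc u (el_hi c2) (el_dir c2) w)%:E +
  (\1_B w * inc u (el_hi c1) (el_dir c1) w * inc u (el_hi c2) (el_dir c2) w)%:E)%E); last first.
  apply/funext => w; rewrite -EFinD /B indicI /=; congr (_%:E).
  by rewrite /increment -/u; ring.
split; first exact: integrableD.
by rewrite integralD// e0 e1 add0e.
Qed.

(* The second moment gs of the standard Gaussian law is not computed: its value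
   is irrelevant here. *)
Lemma elementary_isometry s n (c : nat -> elementary H Xi Omega) : t <= s -> s <= T ->
  (forall i, (i < n)%N -> elementary_adapted P W t s (c i)) ->
  (\int[P]_w (`|\sum_(i < n) elementary_int W (c i) w| ^+ 2)%:E =
   gs%:E * \int[P]_w \int[leb]_(r in `[t, s])
     hs_sqnorm E (fun eta => \sum_(i < n) elementary_op dotXi (c i) r w eta)%R)%E.
Proof.
move=> ts sT ad.
pose k (i j : 'I_n) := dotXi (el_dir (c i)) (el_dir (c j)) *
  dotH (el_val (c i)) (el_val (c j)).
have mA (i : 'I_n) : measurable (el_event (c i)).
  have [h1 h2 h3 h4] := ad i (ltn_ord i).
  by apply: (filtration_sub rs _ h4); rewrite (le_trans h2)// (le_trans h3).
have indicM (U : Type) (A B : set U) x : \1_A x * \1_B x = \1_(A `&` B) x :> R.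
  by rewrite indicI.
have lebfin (i j : 'I_n) : (leb (itv (c i) `&` itv (c j)) < +oo)%E.
  apply: (@le_lt_trans _ _ (leb (itv (c i)))).
    by apply: le_measure; rewrite ?inE//; exact: measurableI.
  by rewrite lebesgue_measure_itv /=; case: ifP; rewrite ltry.
have covij (i j : 'I_n) := elementary_cov sT (ad i (ltn_ord i)) (ad j (ltn_ord j)).
(* Both sides are computed to be this double sum. *)
transitivity (\sum_(i < n) \sum_(j < n) (P (el_event (c i) `&` el_event (c j)) *
    (gs * fine (leb (itv (c i) `&` itv (c j))) * k i j)%:E))%E.
  under eq_integral do rewrite (sqnorm_sumZ normH).
  have [|_ ->] := @integral_sum2 _ _ _ P setT measurableT n (fun i j w =>
    coef (c i) w * coef (c j) w * dotH (el_val (c i)) (el_val (c j))).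
    move=> i j; have [h _] := covij i j.
    rewrite (_ : EFin \o _ = (fun w => (coef (c i) w * coef (c j) w)%:E *
      (dotH (el_val (c i)) (el_val (c j)))%:E)%E); last by apply/funext => w; rewrite -EFinM.
    exact: integrableZr.
  apply: eq_bigr => i _; apply: eq_bigr => j _.
  have [h eq] := covij i j.
  under eq_integral do rewrite EFinM.
  rewrite integralZr// eq -muleA -EFinM; congr (_ * _%:E)%E.
  by rewrite /k; ring.
have inner w : (\int[leb]_(r in `[t, s])
    hs_sqnorm E (fun eta => \sum_(i < n) elementary_op dotXi (c i) r w eta)%R =
    (\sum_(i < n) \sum_(j < n) \1_(el_event (c i) `&` el_event (c j)) w *
      (fine (leb (itv (c i) `&` itv (c j))) * k i j))%:E)%E.
  (* At fixed [r] and [w] the integrand is a finite-rank operator whose coefficients are products of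
     two indicators. *)
  under eq_integral => r _.
    rewrite (hs_sqnorm_finite_rank normH normXi he
      (fun i => \1_(itv (c i)) r * \1_(el_event (c i)) w)).
    over.
  have int1 (i j : 'I_n) : leb.-integrable `[t, s] (fun r : R =>
      (\1_(itv (c i) `&` itv (c j)) r)%:E).
    apply: integrable_indic_lty => //; first exact: measurableI.
    rewrite (le_lt_trans _ (lebfin i j))//; apply: le_measure; rewrite ?inE//.
    - by apply: measurableI => //; exact: measurableI.
    - exact: measurableI.
  have [|_] := @integral_sum2 _ _ _ leb `[t, s] (measurable_itv _) n (fun i j r =>
    \1_(itv (c i)) r * \1_(el_event (c i)) w * (\1_(itv (c j)) r * \1_(el_event (c j)) w)
     * k i j).
    move=> i j; rewrite (_ : EFin \o _ = (fun r => (\1_(itv (c i) `&` itv (c j)) r)%:E *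
      (\1_(el_event (c i) `&` el_event (c j)) w * k i j)%:E)%E); last first.
      by apply/funext => r; rewrite -EFinM /= -!indicM; congr (_%:E); ring.
    exact: integrableZr.
  move=> ->; rewrite -sumEFin; apply: eq_bigr => i _.
  rewrite -sumEFin; apply: eq_bigr => j _.
  transitivity (\int[leb]_(r in `[t, s]) ((\1_(itv (c i) `&` itv (c j)) r)%:E *
      (\1_(el_event (c i) `&` el_event (c j)) w * k i j)%:E))%E.
    apply: eq_integral => r _; rewrite -EFinM -!indicM; congr (_%:E); ring.
  rewrite integralZr// integral_indic//; last exact: measurableI.
  (* By adaptedness the intervals lie in [[t, s]], so restricting to it loses nothing. *)
  rewrite setIidl; last first.
    have [h1 h2 h3 h4] := ad i (ltn_ord i).
    move=> x [] /=; rewrite !in_itv /= => /andP[h5 h6] _.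
    by rewrite (le_trans h6 h3) (le_trans h1 (ltW h5)).
  rewrite -[X in (X * _)%E]fineK; last by rewrite ge0_fin_numE// lebfin.
  by rewrite -EFinM; congr (_%:E); ring.
under [in RHS]eq_integral do rewrite inner.
have [|_ ->] := @integral_sum2 _ _ _ P setT measurableT n (fun i j w =>
  \1_(el_event (c i) `&` el_event (c j)) w *
      (fine (leb (itv (c i) `&` itv (c j))) * k i j)).
  move=> i j; rewrite (_ : EFin \o _ = (fun w => (\1_(el_event (c i) `&` el_event (c j)) w)%:E *
      (fine (leb (itv (c i) `&` itv (c j))) * k i j)%:E)%E); last first.
    by apply/funext => w; rewrite -EFinM.
  by apply: integrableZr => //; apply: integrable_indic => //; exact: measurableI.
rewrite -[RHS]muleC.
have eqij (i j : 'I_n) : (\int[P]_w (\1_(el_event (c i) `&` el_event (c j)) w *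
      (fine (leb (itv (c i) `&` itv (c j))) * k i j))%:E =
   (fine (P (el_event (c i) `&` el_event (c j))) *
      (fine (leb (itv (c i) `&` itv (c j))) * k i j))%:E)%E.
  under eq_integral do rewrite EFinM.
  have mAB : measurable (el_event (c i) `&` el_event (c j)) by exact: measurableI.
  rewrite integralZr//; last exact: integrable_indic.
  by rewrite integral_indic// setIT [RHS]EFinM (fineK (fin_num_measure P _ mAB)).
under [in RHS]eq_bigr do under eq_bigr do rewrite eqij.
under [in RHS]eq_bigr do rewrite sumEFin.
rewrite sumEFin -EFinM mulr_suml -sumEFin; apply: eq_bigr => i _.
rewrite mulr_suml -sumEFin; apply: eq_bigr => j _.
rewrite -[X in (X * _)%E]fineK; last by apply: fin_num_measure; exact: measurableI.
by rewrite -EFinM; congr (_%:E); ring.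
Qed.

End ElementaryIsometry.

(** * Sections, Tonelli, and the Hilbert-Schmidt norm *)

Section TonelliOn.
Context d1 d2 (T1 : measurableType d1) (T2 : measurableType d2) (R : realType).
Variables (m1 : {sigma_finite_measure set T1 -> \bar R}).
Variables (m2 : {sigma_finite_measure set T2 -> \bar R}).
Variables (D : set T1) (f : T1 -> T2 -> \bar R).
Hypotheses (mD : measurable D) (f0 : forall x y, D x -> (0 <= f x y)%E).
Hypothesis mf : measurable_fun (D `*` setT) (fun z => f z.1 z.2).

(** Extension by zero off [D], which brings Tonelli over [D] back to Tonelli over the whole
    product. *)
Let g := (fun z => f z.1 z.2) \_ (D `*` setT).

Let mDT : measurable (D `*` [set: T2]).
Proof. exact: measurableX. Qed.

Let mg : measurable_fun setT g.
Proof. by apply/(measurable_restrictT _ mDT). Qed.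

Let g0 z : (0 <= g z)%E.
Proof.
rewrite /g patchE; case: ifPn => // /set_mem [Dz _].
exact: f0.
Qed.

Let gE x y : g (x, y) = if x \in D then f x y else 0%E.
Proof. by rewrite /g patchE in_setX /= in_setT andbT. Qed.

Let innerE y : (\int[m1]_x g (x, y) = \int[m1]_(x in D) f x y)%E.
Proof.
rewrite [RHS]integral_mkcond; apply: eq_integral => x _.
by rewrite gE patchE.
Qed.

Let outerE x : D x -> (\int[m2]_y g (x, y) = \int[m2]_y f x y)%E.
Proof. by move=> Dx; apply: eq_integral => y _; rewrite gE mem_set. Qed.

Lemma measurable_tonelli_G : measurable_fun setT (fun y => \int[m1]_(x in D) f x y)%E.
Proof.
have := measurable_fun_fubini_tonelli_G (m1 := m1) g mg g0.
by apply: eq_measurable_fun => y _; exact: innerE.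
Qed.

Lemma measurable_tonelli_F : measurable_fun D (fun x => \int[m2]_y f x y)%E.
Proof.
have := measurable_funTS (D := D) (measurable_fun_fubini_tonelli_F (m2 := m2) g mg g0).
by apply: eq_measurable_fun => x /set_mem Dx; exact: outerE.
Qed.

Lemma tonelli_on : (\int[m2]_y \int[m1]_(x in D) f x y =
  \int[m1]_(x in D) \int[m2]_y f x y)%E.
Proof.
transitivity (\int[m2]_y \int[m1]_x g (x, y))%E.
  by apply: eq_integral => y _; rewrite innerE.
rewrite -fubini_tonelli// [RHS]integral_mkcond; apply: eq_integral => x _.
rewrite patchE; case: ifPn => [/set_mem Dx|xD]; first exact: outerE.
by rewrite integral0_eq// => y _; rewrite gE (negbTE xD).
Qed.

Lemma measurable_section1 y : measurable_fun D (fun x => f x y).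
Proof.
have /(measurable_funTS (D := D)) := measurableT_comp mg (pair2_measurable y).
by apply: eq_measurable_fun => x xD; rewrite /= gE xD.
Qed.

End TonelliOn.

Lemma measurable_section2 d1 d2 d3 (T1 : measurableType d1) (T2 : measurableType d2)
    (T3 : measurableType d3) (D : set T1) (f : T1 -> T2 -> T3) x :
  measurable D -> D x ->
  measurable_fun (D `*` setT) (fun z => f z.1 z.2) -> measurable_fun setT (f x).
Proof.
move=> mD Dx mf.
apply: (measurable_comp (F := D `*` setT) _ _ mf (pair1_measurable x)) => //.
  exact: measurableX.
by move=> _ [y _ <-].
Qed.

(** Integrated form of the three-term estimates used throughout; the pointwise inequality is
    required almost everywhere only. *)
Lemma ge0_le_integral3 d (T : measurableType d) (R : realType)
    (mu : {measure set T -> \bar R}) (D : set T) (k : R)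
    (f f1 f2 f3 : T -> \bar R) : measurable D -> 0 <= k ->
  measurable_fun D f -> (forall x, D x -> 0 <= f x)%E ->
  measurable_fun D f1 -> (forall x, D x -> 0 <= f1 x)%E ->
  measurable_fun D f2 -> (forall x, D x -> 0 <= f2 x)%E ->
  measurable_fun D f3 -> (forall x, D x -> 0 <= f3 x)%E ->
  {ae mu, forall x, D x -> f x <= k%:E * (f1 x + f2 x + f3 x)}%E ->
  (\int[mu]_(x in D) f x <= k%:E * (\int[mu]_(x in D) f1 x +
    \int[mu]_(x in D) f2 x + \int[mu]_(x in D) f3 x))%E.
Proof.
move=> mD k0 mf f0 mf1 f10 mf2 f20 mf3 f30 le.
have m12 : measurable_fun D (fun x => f1 x + f2 x)%E by exact: emeasurable_funD.
have m123 : measurable_fun D (fun x => f1 x + f2 x + f3 x)%E by exact: emeasurable_funD.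
have p12 x : D x -> (0 <= f1 x + f2 x)%E by move=> Dx; rewrite adde_ge0 ?f10 ?f20.
have p123 x : D x -> (0 <= f1 x + f2 x + f3 x)%E by move=> Dx; rewrite adde_ge0 ?p12 ?f30.
rewrite -ge0_integralD// -ge0_integralD// -ge0_integralZl_EFin//.
apply: ae_ge0_le_integral => //.
  by move=> x Dx; rewrite mule_ge0 ?lee_fin ?p123.
by apply: emeasurable_funM.
Qed.

Lemma sqnorm3_le (R : realType) (H : completeNormedModType R) (x y z : H) :
  `|x + y + z| ^+ 2 <= 3 * (`|x| ^+ 2 + `|y| ^+ 2 + `|z| ^+ 2).
Proof.
have h : `|x + y + z| <= `|x| + `|y| + `|z|.
  by rewrite (le_trans (ler_normD _ _))// lerD2r ler_normD.
apply: (@le_trans _ _ ((`|x| + `|y| + `|z|) ^+ 2)).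
  by rewrite ler_sqr ?nnegrE ?addr_ge0.
have := sqr_ge0 (`|x| - `|y|); have := sqr_ge0 (`|x| - `|z|).
by have := sqr_ge0 (`|y| - `|z|); nra.
Qed.

Section HilbertSchmidtNorm.
Variables (R : realType) (H Xi : completeNormedModType R).
Hypothesis sepH : separable H.
Variables (dotXi : {dot Xi for idfun}).
Variables (E : set Xi) (e : nat -> Xi) (he : onb_seq dotXi E e).

Lemma hs_sqnorm_ge0 (f : Xi -> H) : (0 <= hs_sqnorm E f)%E.
Proof. by apply: esum_ge0 => x _; rewrite lee_fin sqr_ge0. Qed.

(** Along the listed basis the squared norm is a countable sum, so measurability at each fixed [xi]
    is enough. *)
Lemma measurable_hs_sqnorm d (T : measurableType d) (D : set T)
    (Phi : T -> Xi -> H) :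
  (forall x, D x -> Phi x 0 = 0) ->
  (forall xi, measurable_fun D (fun x => Phi x xi : borel H)) ->
  measurable_fun D (fun x => hs_sqnorm E (Phi x)).
Proof.
move=> Phi0 mPhi.
apply: (eq_measurable_fun (fun x => \sum_(0 <= i <oo) (`|Phi x (e i)| ^+ 2)%:E)%E).
  by move=> x /set_mem Dx; rewrite (hs_sqnorm_seq he)// Phi0.
apply: (ge0_emeasurable_sum (P := xpredT)) => [k x _ _|k _].
  by rewrite lee_fin sqr_ge0.
by apply/measurable_EFinP/measurable_funX; exact: measurable_norm_borel.
Qed.

Lemma hs_sqnorm3_le (f g h : Xi -> H) : f 0 = 0 -> g 0 = 0 -> h 0 = 0 ->
  (hs_sqnorm E (fun xi => (f xi + g xi + h xi)%R) <=
   3%:E * (hs_sqnorm E f + hs_sqnorm E g + hs_sqnorm E h))%E.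
Proof.
move=> f0 g0 h0.
have p (u : Xi -> H) i : (0 <= (`|u (e i)| ^+ 2)%:E)%E by rewrite lee_fin sqr_ge0.
rewrite !(hs_sqnorm_seq he) ?f0 ?g0 ?h0 ?addr0//.
rewrite -nneseriesD// -nneseriesD//; last by move=> i _ _; rewrite adde_ge0.
rewrite -nneseriesZl; last by move=> i _; rewrite !adde_ge0.
apply: lee_nneseries => // i _.
by rewrite -!EFinD -EFinM lee_fin sqnorm3_le.
Qed.

Lemma hs_sqnormN (f : Xi -> H) : hs_sqnorm E (fun xi => - f xi) = hs_sqnorm E f.
Proof. by apply: eq_esum => xi _; rewrite normrN. Qed.

End HilbertSchmidtNorm.

(** * Distances between Ito integrals *)

Section ItoDistance.
Variables (R : realType) (H Xi : completeNormedModType R).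
Hypothesis sepH : separable H.
Variables (dotH : {dot H for idfun}) (dotXi : {dot Xi for idfun}).
Hypotheses (normH : norm_from_dot dotH) (normXi : norm_from_dot dotXi).
Variables (E : set Xi) (e : nat -> Xi) (he : onb_seq dotXi E e).
Context (d : measure_display) (Omega : measurableType d).
Variables (P : probability Omega R) (W : R -> Xi -> Omega -> R) (t T : R).
Hypothesis rs : reference_space P W t T.

Local Notation leb := (@lebesgue_measure R).
Local Notation gs := (gauss_sqmoment R).

(** The identity from [Omega] to [Omega] with the sigma-algebra at time [s] is measurable, the
    latter being smaller; progressive measurability at the horizon [s] itself is composed with
    it. *)
Lemma progressive_measurable (K : completeNormedModType R) (f : R -> Omega -> K) s :
  t <= s -> s <= T -> progressive P W t s f ->
  measurable_fun (`[t, s] `*` setT) (fun z : R * Omega => f z.1 z.2 : borel K).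
Proof.
move=> ts sT pf.
pose Om := g_sigma_algebraType (filtration_gen P W t s).
have mf : measurable_fun (`[t, s] `*` setT) (fun z : R * Om => f z.1 z.2 : borel K).
  by apply: pf; rewrite ts lexx.
have mid : measurable_fun setT (fun z : R * Omega => (z.1, z.2) : R * Om).
  apply: (measurable_fun_pair (T1 := R) (T2 := Om)); first exact: measurable_fst.
  move=> _ B mB; rewrite setTI; rewrite -[X in measurable X]setTI.
  apply: measurable_snd => //; exact: (filtration_sub rs sT).
have := measurable_comp (F := `[t, s] `*` [set: Om]) _ _ mf (measurable_funTS mid).
apply.
- by apply: measurableX => //; exact: measurable_itv.
- by move=> _ [z zD <-].
Qed.

Lemma measurable_elementary_int s (c : elementary H Xi Omega) : s <= T ->
  elementary_adapted P W t s c ->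
  measurable_fun setT (elementary_int W c : Omega -> borel H).
Proof.
move=> sT [tlo lohi his A]; apply: measurable_scale_borel.
have hiT := le_trans his sT.
apply: measurable_funM; last exact: (measurable_increment rs).
by apply: measurable_indic; exact: (filtration_sub rs (le_trans lohi hiT)).
Qed.

Lemma measurable_elementary_op s (c : elementary H Xi Omega) (D : set (R * Omega)) eta :
  s <= T -> elementary_adapted P W t s c ->
  measurable_fun D (fun z : R * Omega => elementary_op dotXi c z.1 z.2 eta : borel H).
Proof.
move=> sT [tlo lohi his A]; apply: measurable_scale_borel.
have mA : measurable (el_event c).
  exact: (filtration_sub rs (le_trans lohi (le_trans his sT))).
apply: measurable_funM; last exact: measurable_cst.
apply: measurable_funM; apply: measurable_funTS.
  exact: (measurableT_comp (measurable_indic (measurable_itv _)) measurable_fst).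
exact: (measurableT_comp (measurable_indic mA) measurable_snd).
Qed.

Let negate (c : elementary H Xi Omega) : elementary H Xi Omega :=
  Elementary (el_lo c) (el_hi c) (el_event c) (el_dir c) (- el_val c).

(** A difference of two elementary sums is one elementary sum: the second family is appended, with
    the sign carried by its values in [H]. *)
Lemma elementary_isometry_sub s m n (c1 c2 : nat -> elementary H Xi Omega) :
  t <= s -> s <= T ->
  (forall i, (i < m)%N -> elementary_adapted P W t s (c1 i)) ->
  (forall i, (i < n)%N -> elementary_adapted P W t s (c2 i)) ->
  (\int[P]_w (`|\sum_(i < m) elementary_int W (c1 i) w -
               \sum_(i < n) elementary_int W (c2 i) w| ^+ 2)%:E =
   gs%:E * \int[P]_w \int[leb]_(r in `[t, s])
     hs_sqnorm E (fun eta => \sum_(i < m) elementary_op dotXi (c1 i) r w eta -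
                             \sum_(i < n) elementary_op dotXi (c2 i) r w eta)%R)%E.
Proof.
move=> ts sT ad1 ad2.
pose c i := if (i < m)%N then c1 i else negate (c2 (i - m)%N).
have split (V : nmodType) (f : elementary H Xi Omega -> V) :
    \sum_(i < m + n) f (c i) = \sum_(i < m) f (c1 i) + \sum_(i < n) f (negate (c2 i)).
  rewrite big_split_ord /=; congr (_ + _); apply: eq_bigr => i _.
    by rewrite /c ltn_ord.
  by rewrite /c ltnNge leq_addr /= addKn.
have adc i : (i < m + n)%N -> elementary_adapted P W t s (c i).
  move=> imn; rewrite /c; case: ltnP => im; first exact: ad1.
  have [] := ad2 (i - m)%N; first by rewrite ltn_subLR.
  by split.
have := elementary_isometry normH normXi he rs ts sT adc.
under eq_integral do rewrite (split _ (fun c => elementary_int W c _)).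
under [X in (_ = _ * X)%E -> _]eq_integral do under eq_integral do
  under [X in hs_sqnorm _ X]eq_fun do rewrite (split _ (fun c => elementary_op dotXi c _ _ _)).
have negi w : \sum_(i < n) elementary_int W (negate (c2 i)) w =
    - \sum_(i < n) elementary_int W (c2 i) w.
  by rewrite -sumrN; apply: eq_bigr => i _; rewrite /elementary_int /= scalerN.
have nego r w eta : \sum_(i < n) elementary_op dotXi (negate (c2 i)) r w eta =
    - \sum_(i < n) elementary_op dotXi (c2 i) r w eta.
  by rewrite -sumrN; apply: eq_bigr => i _; rewrite /elementary_op /= scalerN.
under eq_integral do rewrite negi.
by under [X in (_ = _ * X)%E -> _]eq_integral do under eq_integral do
  under [X in hs_sqnorm _ X]eq_fun do rewrite nego.
Qed.

(** The approximation errors tend to zero, so that the limit retains only [3 * gs * 3] times the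
    distance of the integrands, one factor 3 for each use of the three-term inequality. *)
Lemma ito_dist s (Phi1 Phi2 : R -> Omega -> Xi -> H) (I1 I2 : Omega -> H) :
  t <= s -> s <= T ->
  is_ito dotXi E P W t s Phi1 I1 -> is_ito dotXi E P W t s Phi2 I2 ->
  (\int[P]_w (`|I1 w - I2 w| ^+ 2)%:E <=
   (9 * gs)%:E * \int[P]_w \int[leb]_(r in `[t, s])
     hs_sqnorm E (fun eta => Phi1 r w eta - Phi2 r w eta)%R)%E.
Proof.
move=> ts sT [hs1 prog1 mI1 [k1 [c1 [ad1 cv1 cvI1]]]] [hs2 prog2 mI2 [k2 [c2 [ad2 cv2 cvI2]]]].
have gs0 : 0 <= gs.
  by apply: fine_ge0; apply: integral_ge0 => x _; rewrite lee_fin sqr_ge0.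
set K := (\int[P]_w \int[leb]_(r in `[t, s])
     hs_sqnorm E (fun eta => Phi1 r w eta - Phi2 r w eta)%R)%E.
set A1 := (fun n => \int[P]_w _)%E in cv1; set A2 := (fun n => \int[P]_w _)%E in cv2.
set B1 := (fun n => \int[P]_w _)%E in cvI1; set B2 := (fun n => \int[P]_w _)%E in cvI2.
pose S1 n r w eta := \sum_(i < k1 n) elementary_op dotXi (c1 n i) r w eta.
pose S2 n r w eta := \sum_(i < k2 n) elementary_op dotXi (c2 n i) r w eta.
pose J1 n w := \sum_(i < k1 n) elementary_int W (c1 n i) w.
pose J2 n w := \sum_(i < k2 n) elementary_int W (c2 n i) w.
have mJ1 n : measurable_fun setT (J1 n : Omega -> borel H).
  by apply: measurable_sumv => // i; exact: (measurable_elementary_int sT (ad1 n i (ltn_ord i))).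
have mJ2 n : measurable_fun setT (J2 n : Omega -> borel H).
  by apply: measurable_sumv => // i; exact: (measurable_elementary_int sT (ad2 n i (ltn_ord i))).
pose D : set (R * Omega) := `[t, s] `*` setT.
have mS1 n eta : measurable_fun D (fun z : R * Omega => S1 n z.1 z.2 eta : borel H).
  apply: measurable_sumv => // i.
  exact: (@measurable_elementary_op s (c1 n i) D eta sT (ad1 n i (ltn_ord i))).
have mS2 n eta : measurable_fun D (fun z : R * Omega => S2 n z.1 z.2 eta : borel H).
  apply: measurable_sumv => // i.
  exact: (@measurable_elementary_op s (c2 n i) D eta sT (ad2 n i (ltn_ord i))).
have mP1 eta : measurable_fun D (fun z : R * Omega => Phi1 z.1 z.2 eta : borel H).
  exact: (progressive_measurable (f := fun r w => Phi1 r w eta)).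
have mP2 eta : measurable_fun D (fun z : R * Omega => Phi2 z.1 z.2 eta : borel H).
  exact: (progressive_measurable (f := fun r w => Phi2 r w eta)).
have S10 n r w : S1 n r w 0 = 0.
  by rewrite /S1 big1// => i _; rewrite /elementary_op dot0r mulr0 scale0r.
have S20 n r w : S2 n r w 0 = 0.
  by rewrite /S2 big1// => i _; rewrite /elementary_op dot0r mulr0 scale0r.
have lin0 (f : Xi -> H) : linear f -> f 0 = 0.
  by move=> lf; have := lf (-1) 0 0; rewrite scaler0 addr0 scaleN1r addNr.
have P10 r w : `[t, s]%classic r -> Phi1 r w 0 = 0.
  by rewrite /= in_itv /= => /(hs1 r w)[/lin0].
have P20 r w : `[t, s]%classic r -> Phi2 r w 0 = 0.
  by rewrite /= in_itv /= => /(hs2 r w)[/lin0].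
have mhs (F1 F2 : R -> Omega -> Xi -> H) :
    (forall eta, measurable_fun D (fun z : R * Omega => F1 z.1 z.2 eta : borel H)) ->
    (forall eta, measurable_fun D (fun z : R * Omega => F2 z.1 z.2 eta : borel H)) ->
    (forall r w, `[t, s]%classic r -> F1 r w 0 = 0) ->
    (forall r w, `[t, s]%classic r -> F2 r w 0 = 0) ->
    measurable_fun D (fun z : R * Omega =>
      hs_sqnorm E (fun eta => F1 z.1 z.2 eta - F2 z.1 z.2 eta)).
  move=> m1 m2 z1 z2.
  apply: (measurable_hs_sqnorm he (Phi := fun z eta => F1 z.1 z.2 eta - F2 z.1 z.2 eta)).
    by move=> [r w] [/= rts _]; rewrite z1// z2// subrr.
  by move=> eta; apply: measurable_subv.
have bound n : (\int[P]_w (`|I1 w - I2 w| ^+ 2)%:E <=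
    3%:E * (B1 n + gs%:E * (3%:E * (A1 n + K + A2 n)) + B2 n))%E.
  have mid : (\int[P]_w (`|J1 n w - J2 n w| ^+ 2)%:E <=
      gs%:E * (3%:E * (A1 n + K + A2 n)))%E.
    rewrite /J1 /J2 (elementary_isometry_sub ts sT (ad1 n) (ad2 n)).
    apply: lee_wpmul2l; first by rewrite lee_fin.
    have m12 := mhs _ _ (mS1 n) (mS2 n) (fun r w _ => S10 n r w) (fun r w _ => S20 n r w).
    have m1P := mhs _ _ mP1 (mS1 n) P10 (fun r w _ => S10 n r w).
    have mPP := mhs _ _ mP1 mP2 P10 P20.
    have mP2' := mhs _ _ mP2 (mS2 n) P20 (fun r w _ => S20 n r w).
    have hp f : (0 <= hs_sqnorm E (f : Xi -> H))%E by exact: hs_sqnorm_ge0.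
    apply: ge0_le_integral3 => //.
    - by apply: measurable_tonelli_G => //; exact: m12.
    - by move=> w _; exact: integral_ge0.
    - by apply: measurable_tonelli_G => //; exact: m1P.
    - by move=> w _; exact: integral_ge0.
    - by apply: measurable_tonelli_G => //; exact: mPP.
    - by move=> w _; exact: integral_ge0.
    - by apply: measurable_tonelli_G => //; exact: mP2'.
    - by move=> w _; exact: integral_ge0.
    apply: aeW => w _; apply: ge0_le_integral3 => //.
    - by apply: (measurable_section1 (f := fun r w =>
        hs_sqnorm E (fun eta => S1 n r w eta - S2 n r w eta))) => //; exact: m12.
    - by apply: (measurable_section1 (f := fun r w =>
        hs_sqnorm E (fun eta => Phi1 r w eta - S1 n r w eta))) => //; exact: m1P.
    - by apply: (measurable_section1 (f := fun r w =>
        hs_sqnorm E (fun eta => Phi1 r w eta - Phi2 r w eta))) => //; exact: mPP.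
    - by apply: (measurable_section1 (f := fun r w =>
        hs_sqnorm E (fun eta => Phi2 r w eta - S2 n r w eta))) => //; exact: mP2'.
    apply: aeW => r rts.
    (* The first difference is reversed in sign so that the three of them telescope to [S1 - S2]. *)
    rewrite -(hs_sqnormN E (fun eta => Phi1 r w eta - S1 n r w eta)).
    have := @hs_sqnorm3_le _ H _ _ _ _ he (fun eta => - (Phi1 r w eta - S1 n r w eta))
      (fun eta => Phi1 r w eta - Phi2 r w eta) (fun eta => Phi2 r w eta - S2 n r w eta).
    rewrite P10// P20// S10 S20 subrr oppr0 => /(_ erefl erefl erefl).
    apply: le_trans; rewrite le_eqVlt; apply/orP; left; apply/eqP; congr hs_sqnorm.
    apply/funext => eta.
    by rewrite opprB (addrA (_ - _)) subrK addrA subrK.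
  apply: (@le_trans _ _ (3%:E * (B1 n + \int[P]_w (`|J1 n w - J2 n w| ^+ 2)%:E + B2 n)))%E.
    have msq (f : Omega -> H) : measurable_fun setT (f : Omega -> borel H) ->
        measurable_fun setT (fun w => (`|f w| ^+ 2)%:E).
      by move=> mf; apply/measurable_EFinP/measurable_funX; exact: measurable_norm_borel.
    have sq0 (f : Omega -> H) w : setT w -> (0 <= (`|f w| ^+ 2)%:E)%E.
      by rewrite lee_fin sqr_ge0.
    apply: ge0_le_integral3 => //.
    - by apply: (msq (fun w => I1 w - I2 w)); exact: measurable_subv.
    - by apply: (msq (fun w => I1 w - J1 n w)); exact: measurable_subv.
    - by apply: (msq (fun w => J1 n w - J2 n w)); exact: measurable_subv.
    - by apply: (msq (fun w => I2 w - J2 n w)); exact: measurable_subv.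
    apply: aeW => w _; rewrite -!EFinD -EFinM lee_fin (distrC (I2 w)).
    rewrite (_ : I1 w - I2 w = (I1 w - J1 n w) + (J1 n w - J2 n w) + (J2 n w - I2 w)).
      exact: sqnorm3_le.
    by rewrite !addrA !subrK.
  by apply: lee_wpmul2l => //; apply: leeD => //; apply: leeD.
apply: (@cvge_to_ge _ \oo _ _ (fun n => 3%:E * (B1 n + gs%:E * (3%:E * (A1 n + K + A2 n)) + B2 n))%E); last first.
  by apply: nearW => n; exact: bound.
(* The right-hand side is put in the form of the limit of the bounds, all errors being replaced by
   0. *)
have -> : ((9 * gs)%:E * K = 3%:E * (0 + gs%:E * (3%:E * (0 + K + 0)) + 0))%E.
  rewrite !adde0 !add0e [in RHS](muleCA gs%:E) !muleA -!EFinM; congr (_%:E * _)%E; ring.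
have K0 : (0 <= K)%E.
  by apply: integral_ge0 => w _; apply: integral_ge0 => r _; exact: hs_sqnorm_ge0.
(* [K] may be infinite; the sums of limits are still defined, since the other terms tend to zero. *)
have dK : ((0 + K)%E +? 0%E)%E by rewrite add0e; case: (K) K0.
have dL : forall x : \bar R, (0 +? x)%E by case.
have dR : forall x : \bar R, (x +? 0)%E by case.
have cA : (A1 n + K + A2 n)%E @[n --> \oo] --> (0 + K + 0)%E.
  apply: (cvgeD dK _ cv2); apply: (cvgeD (dL _) cv1); exact: cvg_cst.
have cgA : (gs%:E * (3%:E * (A1 n + K + A2 n)))%E @[n --> \oo] -->
    (gs%:E * (3%:E * (0 + K + 0)))%E.
  by apply: cvgeZl => //; apply: cvgeZl => //; exact: cA.
apply: cvgeZl => //; apply: (cvgeD (dR _) _ cvI2).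
exact: (cvgeD (dL _) cvI1 cgA).
Qed.

End ItoDistance.

(** * Distances between Bochner integrals *)

Section BochnerDistance.
Variables (R : realType) (H : completeNormedModType R).
Hypothesis sepH : separable H.
Variables (dotH : {dot H for idfun}) (normH : norm_from_dot dotH).
Variables (D : set R) (mD : measurable D).

Local Notation leb := (@lebesgue_measure R).

Let measurable_simple (I : finType) (A : I -> set R) (h : I -> H) :
  (forall i, measurable (A i)) ->
  measurable_fun D (fun r => \sum_i \1_(A i) r *: h i : borel H).
Proof.
move=> mA; apply: (@measurable_sumv _ _ sepH _ _ _ _ _ (fun i r => \1_(A i) r *: h i)) => i.
by apply: measurable_scale_borel; exact: measurable_indic.
Qed.

(* Pairing with the value v of the integral reduces the claim to real integrals. *)
Lemma norm_simple_integral_le (I : finType) (A : I -> set R) (h : I -> H) :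
  (forall i, measurable (A i) /\ (leb (A i) < +oo)%E) ->
  ((`|\sum_i fine (leb (D `&` A i)) *: h i|)%:E <=
   \int[leb]_(r in D) (`|\sum_i \1_(A i) r *: h i|)%:E)%E.
Proof.
move=> hA; set v := \sum_i _.
have mA i : measurable (A i) by have [] := hA i.
have fA i : (leb (A i `&` D) < +oo)%E.
  by apply: le_lt_trans (hA i).2; apply: le_measure; rewrite ?inE;
    [exact: (measurableI _ _ (mA i) mD)|exact: mA|by move=> x []].
have ms := measurable_simple h mA.
have mns : measurable_fun D (fun r => (`|\sum_i \1_(A i) r *: h i|)%:E).
  by apply/measurable_EFinP; exact: measurable_norm_borel.
have [v0|v0] := eqVneq v 0.
  by rewrite v0 normr0; apply: integral_ge0 => r _; rewrite lee_fin.
have nv0 : 0 < `|v| by rewrite normr_gt0.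
have ind i : leb.-integrable D (fun r => (\1_(A i) r)%:E).
  by apply: integrable_indic_lty; [exact: mD|exact: mA|exact: fA].
have ii i : leb.-integrable D (fun r => (\1_(A i) r)%:E * (dotH v (h i))%:E)%E.
  exact: integrableZr.
have dE r : (dotH v (\sum_i \1_(A i) r *: h i))%:E =
    (\sum_i ((\1_(A i) r)%:E * (dotH v (h i))%:E))%E.
  by rewrite dot_sumr -sumEFin; apply: eq_bigr => i _; rewrite dotZr.
have vE : (`|v| ^+ 2)%:E = (\int[leb]_(r in D) (dotH v (\sum_i \1_(A i) r *: h i))%:E)%E.
  under eq_integral do rewrite dE.
  rewrite integral_sum// normH {2}/v dot_sumr -sumEFin; apply: eq_bigr => i _.
  rewrite integralZr//.
  rewrite integral_indic; [|exact: mD|exact: mA].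
  rewrite dotZr EFinM setIC fineK//.
  by rewrite ge0_fin_numE.
rewrite -(lee_pmul2l (x := (`|v|)%:E))// ?lte_fin// -EFinM -expr2 vE.
rewrite -ge0_integralZl//.
have md : measurable_fun D (fun r => (dotH v (\sum_i \1_(A i) r *: h i))%:E).
  apply/measurable_EFinP.
  apply: (@measurable_continuous_compR _ _ _ _ H (dotH v)
    (fun r => \sum_i \1_(A i) r *: h i)); last exact: ms.
  exact: (dot_continuous normH).
apply: (@le_trans _ _ (\int[leb]_(r in D) `|(dotH v (\sum_i \1_(A i) r *: h i))%:E|)%E).
  apply: (le_trans (lee_abs _)); apply: le_abse_integral; [exact: mD|exact: md].
apply: ge0_le_integral => //.
- exact: measurableT_comp.
- exact: emeasurable_funM.
by move=> r _; rewrite -EFinM lee_fin; exact: (dot_le normH).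
Qed.

(** True for simple functions. Both approximations converge in L^1 and their integrals converge to
    [y1] and [y2], so the inequality passes to the limit, even if its right-hand side is
    infinite. *)
Lemma bochner_dist (f1 f2 : R -> H) (y1 y2 : H) :
  is_bochner D f1 y1 -> is_bochner D f2 y2 ->
  ((`|y1 - y2|)%:E <= \int[leb]_(r in D) (`|f1 r - f2 r|)%:E)%E.
Proof.
move=> [mf1 [k1 [A1 [h1 [hA1 cv1 cvy1]]]]] [mf2 [k2 [A2 [h2 [hA2 cv2 cvy2]]]]].
pose s1 n r := \sum_(i < k1 n) \1_(A1 n i) r *: h1 n i.
pose s2 n r := \sum_(i < k2 n) \1_(A2 n i) r *: h2 n i.
set v1 := (fun n => \sum_(i < k1 n) _) in cvy1.
set v2 := (fun n => \sum_(i < k2 n) _) in cvy2.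
pose e1 n := (\int[leb]_(r in D) (`|f1 r - s1 n r|)%:E)%E.
have {}cv1 : e1 n @[n --> \oo] --> 0%E by exact: cv1.
pose e2 n := (\int[leb]_(r in D) (`|f2 r - s2 n r|)%:E)%E.
have {}cv2 : e2 n @[n --> \oo] --> 0%E by exact: cv2.
have ms1 n : measurable_fun D (s1 n : R -> borel H).
  by apply: (measurable_simple (fun i : 'I_(k1 n) => h1 n i)) => i; have [] := hA1 n i (ltn_ord i).
have ms2 n : measurable_fun D (s2 n : R -> borel H).
  by apply: (measurable_simple (fun i : 'I_(k2 n) => h2 n i)) => i; have [] := hA2 n i (ltn_ord i).
have simple n : ((`|v1 n - v2 n|)%:E <= \int[leb]_(r in D) (`|s1 n r - s2 n r|)%:E)%E.
  (* The two families are indexed by a disjoint union, the second with opposite sign. *)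
  pose A (i : 'I_(k1 n) + 'I_(k2 n)) := match i with inl j => A1 n j | inr j => A2 n j end.
  pose h (i : 'I_(k1 n) + 'I_(k2 n)) := match i with inl j => h1 n j | inr j => - h2 n j end.
  have E1 : \sum_i fine (leb (D `&` A i)) *: h i = v1 n - v2 n.
    rewrite big_sumType /= -sumrN; congr (_ + _); apply: eq_bigr => j _.
    by rewrite scalerN.
  have E2 r : \sum_i \1_(A i) r *: h i = s1 n r - s2 n r.
    rewrite big_sumType /= -sumrN; congr (_ + _); apply: eq_bigr => j _.
    by rewrite scalerN.
  have := @norm_simple_integral_le _ A h; rewrite E1.
  under eq_integral do rewrite E2.
  by apply=> -[] i; [exact: hA1|exact: hA2].
have mdist (f g : R -> H) : measurable_fun D (f : R -> borel H) ->
    measurable_fun D (g : R -> borel H) -> measurable_fun D (fun r => (`|f r - g r|)%:E).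
  by move=> mf mg; apply/measurable_EFinP; exact: (measurable_dist_borel sepH).
have bound n : ((`|v1 n - v2 n|)%:E <=
    1%:E * (e1 n + \int[leb]_(r in D) (`|f1 r - f2 r|)%:E + e2 n))%E.
  apply: (le_trans (simple n)); apply: ge0_le_integral3 => //.
  - exact: mdist.
  - exact: (mdist _ _ mf1 (ms1 n)).
  - exact: mdist.
  - exact: (mdist _ _ mf2 (ms2 n)).
  apply: aeW => r _; rewrite -!EFinD -EFinM lee_fin mul1r.
  rewrite (distrC (f1 r) (\sum_(i < _) _)).
  rewrite (_ : s1 n r - s2 n r = (s1 n r - f1 r) + (f1 r - f2 r) + (f2 r - s2 n r)); last first.
    by rewrite !addrA !subrK.
  by rewrite (le_trans (ler_normD _ _))// lerD2r ler_normD.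
set J := (\int[leb]_(r in D) (`|f1 r - f2 r|)%:E)%E in bound *.
have J0 : (0 <= J)%E by apply: integral_ge0 => r _; rewrite lee_fin.
apply: (@lee_cvg_to _ \oo _ _ (fun n => (`|v1 n - v2 n|)%:E)
  (fun n => 1%:E * (e1 n + J + e2 n))%E); last exact: nearW.
  apply: cvg_EFin; first exact: nearW.
  by apply: cvg_norm; apply: cvgB.
have dK : ((0 + J)%E +? 0%E)%E by rewrite add0e; case: (J) J0.
have dL : forall x : \bar R, (0 +? x)%E by case.
have : (1%:E * (e1 n + J + e2 n))%E @[n --> \oo] --> (1%:E * (0 + J + 0))%E.
  apply: cvgeZl => //; apply: cvgeD => //; apply: cvgeD => //.
  exact: cvg_cst.
by rewrite mul1e adde0 add0e.
Qed.

Lemma is_bochner0 : is_bochner D (fun=> 0 : H) 0.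
Proof.
split; first exact: measurable_cst.
exists (fun=> 0), (fun _ _ => set0), (fun _ _ => 0); split => //.
- rewrite (_ : (fun n => _) = cst 0%E); first exact: cvg_cst.
  apply/funext => n; rewrite integral0_eq// => r _.
  by rewrite big_ord0 subrr normr0.
- rewrite (_ : (fun n => _) = cst 0); first exact: cvg_cst.
  by apply/funext => n; rewrite big_ord0.
Qed.

End BochnerDistance.

(** * Exponential weights and Gronwall's inequality *)

Section Gronwall.
Variable R : realType.
Local Notation leb := (@lebesgue_measure R).

(** The primitive gives [(1 - exp(-lam (s - t))) / lam]; only the bound [1 / lam], uniform in the
    length of the interval, is kept. *)
Lemma integral_expR_le (lam t s : R) : 0 < lam -> t <= s ->
  (\int[leb]_(r in `[t, s]) (expR (- lam * (s - r)))%:E <= (lam^-1)%:E)%E.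
Proof.
move=> lam0; rewrite le_eqVlt => /orP[/eqP <-|ts].
  by rewrite set_itv1 integral_set1 lee_fin invr_ge0 ltW.
pose F r := lam^-1 * expR (- lam * (s - r)).
have dF r : is_derive (r : R^o) 1 (F : R^o -> R^o) (expR (- lam * (s - r))).
  apply: is_derive_eq; rewrite /GRing.scale /=; field.
  by rewrite gt_eqF.
rewrite (@continuous_FTC2 _ (fun r => expR (- lam * (s - r))) F)//.
- rewrite /F subrr mulr0 expR0 mulr1 lee_fin gerBl mulr_ge0 ?expR_ge0//.
  by rewrite invr_ge0 ltW.
- apply: continuous_subspaceT => r.
  apply: continuous_comp; last exact: continuous_expR.
  apply: cvgM; first exact: cvg_cst.
  by apply: cvgB; [exact: cvg_cst|exact: cvg_id].
- split.
  + by move=> r _; have [] := dF r.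
  + apply: cvg_at_right_filter; apply: differentiable_continuous.
    by apply/derivable1_diffP; have [] := dF t.
  + apply: cvg_at_left_filter; apply: differentiable_continuous.
    by apply/derivable1_diffP; have [] := dF s.
- move=> r _; rewrite derive1E; exact: derive_val.
Qed.

(* Weighted Cauchy-Schwarz, through 2 a <= theta / w + w a^2 / theta with
   w = exp (lam (s - r)) and theta = lam x. *)
Lemma sqr_le_weighted_integral (lam t s x : R) (a : R -> R) :
  0 < lam -> t <= s -> 0 <= x -> measurable_fun `[t, s] a ->
  (x%:E <= \int[leb]_(r in `[t, s]) (a r)%:E)%E -> (forall r, 0 <= a r) ->
  ((x ^+ 2)%:E <= (lam^-1)%:E *
    \int[leb]_(r in `[t, s]) (expR (lam * (s - r)) * a r ^+ 2)%:E)%E.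
Proof.
(* The case [x = 0] is set apart because [lam * x] has to be positive. *)
move=> lam0 ts; rewrite le_eqVlt => /orP[/eqP <- _ _ _|x0 ma xa a0].
  rewrite expr0n /=; apply: mule_ge0; first by rewrite lee_fin invr_ge0 ltW.
  by apply: integral_ge0 => r _; rewrite lee_fin mulr_ge0 ?expR_ge0 ?sqr_ge0.
set B := (\int[leb]_(r in _) _)%E.
have mexp (k : R) : measurable_fun `[t, s] (fun r => expR (k * (s - r))).
  apply: measurable_funTS; apply: measurableT_comp => //.
  by apply: measurable_funM => //; exact: measurable_funB.
have mB : measurable_fun `[t, s] (fun r => (expR (lam * (s - r)) * a r ^+ 2)%:E).
  by apply/measurable_EFinP; apply: measurable_funM => //; exact: measurable_funX.
have B0 : (0 <= B)%E.
  by apply: integral_ge0 => r _; rewrite lee_fin mulr_ge0 ?expR_ge0 ?sqr_ge0.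
pose th := lam * x.
have th0 : 0 < th by rewrite mulr_gt0.
have : (2%:E * x%:E <= th%:E * (lam^-1)%:E + (th^-1)%:E * B)%E.
  apply: (@le_trans _ _ (\int[leb]_(r in `[t, s]) (2%:E * (a r)%:E)))%E.
    rewrite ge0_integralZl//; do ?[exact/measurable_EFinP | by rewrite lee_fin | by rewrite lee_pmul2l | by move=> r _; rewrite lee_fin a0].
  apply: (@le_trans _ _ (\int[leb]_(r in `[t, s])
    (th%:E * (expR (- lam * (s - r)))%:E +
     (th^-1)%:E * (expR (lam * (s - r)) * a r ^+ 2)%:E)))%E.
    apply: ge0_le_integral => //.
    - by move=> r _; rewrite mule_ge0 ?lee_fin ?a0.
    - by apply: emeasurable_funM => //; apply/measurable_EFinP.
    - apply: emeasurable_funD; apply: emeasurable_funM => //.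
      by apply/measurable_EFinP; exact: mexp.
    move=> r _; rewrite -!EFinM -EFinD lee_fin mulNr expRN.
    set w := expR _; have w0 : 0 < w by exact: expR_gt0.
    have -> : th / w + th^-1 * (w * a r ^+ 2) =
        2 * a r + (th - w * a r) ^+ 2 / (th * w).
      by field; rewrite !gt_eqF.
    by rewrite lerDl divr_ge0 ?sqr_ge0// ltW// mulr_gt0.
  rewrite ge0_integralD//; last 4 first.
  - by move=> r _; rewrite mule_ge0 ?lee_fin ?expR_ge0 ?ltW.
  - by apply: emeasurable_funM => //; apply/measurable_EFinP; exact: mexp.
  - move=> r _; apply: mule_ge0; rewrite lee_fin; first by rewrite invr_ge0 ltW.
    by rewrite mulr_ge0 ?expR_ge0 ?sqr_ge0.
  - exact: emeasurable_funM.
  rewrite ge0_integralZl//; last 2 first.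
  - by apply/measurable_EFinP; exact: mexp.
  - by [rewrite lee_fin ltW | move=> r _; rewrite lee_fin expR_ge0].
  rewrite ge0_integralZl//; last 2 first.
  - by move=> r _; rewrite lee_fin mulr_ge0 ?expR_ge0 ?sqr_ge0.
  - by rewrite lee_fin invr_ge0 ltW.
  apply: leeD => //; apply: lee_wpmul2l; first by rewrite lee_fin ltW.
  exact: integral_expR_le.
case: B B0 mB => [b||] b0 _ //; last first.
  by move=> _; rewrite gt0_muley ?leey// lte_fin invr_gt0.
(* With [th = lam * x] the first term on the right equals [x] and absorbs one half of [2 * x]. *)
rewrite -!EFinM -EFinD !lee_fin /th => h.
rewrite -(ler_pM2l x0); move: h.
have -> : lam * x / lam = x by field; rewrite gt_eqF.
move=> h; have h' : x <= (lam * x)^-1 * b by lra.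
rewrite -(ler_pM2l (mulr_gt0 x0 x0)) in h'.
apply: le_trans (_ : x * x * ((lam * x)^-1 * b) <= _).
  by rewrite expr2 mulrA.
rewrite le_eqVlt; apply/orP; left; apply/eqP; field.
by rewrite !gt_eqF.
Qed.

(** Since exp(lam (s - r)) exp(2 lam (r - t)) = exp(2 lam (s - t)) exp(-lam (s - r)), a bound [M]
    exp(2 lam (s - t)) on [phi] improves to the same with [z + (k + M) / 2] in place of [M]. The
    fixed point of this map is [2 * z + k]. *)
Lemma gronwall (K z k t T : R) (phi : R -> \bar R) :
  0 <= K -> 0 <= z -> 0 <= k ->
  measurable_fun `[t, T] phi -> (forall s, 0 <= phi s)%E ->
  (\int[leb]_(r in `[t, T]) phi r < +oo)%E ->
  (forall s, t <= s <= T -> (phi s <= z%:E + K%:E *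
    \int[leb]_(r in `[t, s]) ((expR ((2 * K + 1) * (s - r)))%:E * (k%:E + phi r)))%E) ->
  forall s, t <= s <= T ->
    (phi s <= ((2 * z + k) * expR (2 * (2 * K + 1) * (s - t)))%:E)%E.
Proof.
move=> K0 z0 k0 mphi phi0 iphi step.
set lam := 2 * K + 1 in step *.
have lam0 : 0 < lam by rewrite /lam; lra.
have msub s : t <= s <= T -> measurable_fun `[t, s] phi.
  move=> /andP[ts sT]; apply: measurable_funS mphi => //.
  by apply: subset_itvl; rewrite bnd_simp.
have mexp (c u : R) (D : set R) : measurable_fun D (fun r => (expR (c * (u - r)))%:E).
  apply/measurable_EFinP; apply: measurable_funTS; apply: measurableT_comp => //.
  by apply: measurable_funM => //; exact: measurable_funB.
pose L := 2 * z + k.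
have iterate (M : R) : 0 <= M ->
    (forall s, t <= s <= T -> (phi s <= (M * expR (2 * lam * (s - t)))%:E)%E) ->
    forall s, t <= s <= T ->
      (phi s <= ((z + (k + M) / 2) * expR (2 * lam * (s - t)))%:E)%E.
  move=> M0 hM s /[dup] sin /andP[ts sT]; apply: (le_trans (step s sin)).
  pose ee := expR (2 * lam * (s - t)).
  have ee1 : 1 <= ee.
    by rewrite /ee -[leLHS]expR0 ler_expR !mulr_ge0 ?subr_ge0// ltW.
  apply: (@le_trans _ _ (z%:E + K%:E * (((k + M) * ee)%:E * (lam^-1)%:E)))%E.
    apply: leeD => //; apply: lee_wpmul2l => //.
    apply: (@le_trans _ _ (((k + M) * ee)%:E *
      \int[leb]_(r in `[t, s]) (expR (- lam * (s - r)))%:E)%E); last first.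
      apply: lee_wpmul2l; last exact: integral_expR_le.
      by rewrite lee_fin mulr_ge0 ?addr_ge0// expR_ge0.
    rewrite -ge0_integralZl//; last 2 first.
    - exact: mexp.
    - by [move=> r _; rewrite lee_fin expR_ge0 | rewrite lee_fin mulr_ge0 ?addr_ge0// expR_ge0].
    apply: ge0_le_integral => //.
    - by move=> r _; rewrite mule_ge0 ?lee_fin ?expR_ge0// adde_ge0.
    - by apply: emeasurable_funM; [exact: mexp|apply: emeasurable_funD => //; exact: msub].
    - by apply: emeasurable_funM => //; exact: mexp.
    move=> r; rewrite /= in_itv /= => /andP[tr rs].
    have rin : t <= r <= T by rewrite tr (le_trans rs).
    apply: (@le_trans _ _ ((expR (lam * (s - r)))%:E *
      (k%:E + (M * expR (2 * lam * (r - t)))%:E))%E).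
      apply: lee_wpmul2l; first by rewrite lee_fin expR_ge0.
      by apply: leeD => //; exact: hM.
    rewrite -EFinD -!EFinM lee_fin.
    have er1 : 1 <= expR (2 * lam * (r - t)).
      by rewrite -[leLHS]expR0 ler_expR !mulr_ge0 ?subr_ge0// ltW.
    apply: (@le_trans _ _ (expR (lam * (s - r)) * ((k + M) * expR (2 * lam * (r - t))))).
      apply: ler_wpM2l; first exact: expR_ge0.
      by rewrite [leRHS]mulrDl; apply: lerD => //; rewrite ler_peMr.
    rewrite mulrCA -[leRHS]mulrA; apply: ler_wpM2l; first exact: addr_ge0.
    rewrite /ee -!expRD ler_expR.
    by rewrite le_eqVlt; apply/orP; left; apply/eqP; ring.
  rewrite -!EFinM -EFinD lee_fin -/ee [leRHS]mulrDl; apply: lerD.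
    by rewrite ler_peMr.
  (* The choice [lam = 2 * K + 1] serves here: the integral term contracts by one half. *)
  have Klam : K / lam <= 2^-1.
    by rewrite ler_pdivrMr// /lam; lra.
  rewrite mulrCA -mulrA (mulrC K) -mulrA (mulrC _ K).
  rewrite [leRHS](_ : _ = (k + M) * (ee * 2^-1)); last by ring.
  rewrite ler_wpM2l ?addr_ge0// ler_wpM2l//.
  by rewrite (le_trans _ ee1).
(* A first finite bound, however crude: one use of the inequality, with the weight bounded on the
   whole interval and [phi] integrable. *)
have [M0 M00 hM0] : exists2 M : R, 0 <= M &
    forall s, t <= s <= T -> (phi s <= (M * expR (2 * lam * (s - t)))%:E)%E.
  pose I := fine (\int[leb]_(r in `[t, T]) phi r)%E.
  have I0 : 0 <= I by apply: fine_ge0; exact: integral_ge0.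
  have [tT|Tt] := leP t T; last first.
    exists 0 => // s /andP[ts sT].
    by have := lt_le_trans Tt (le_trans ts sT); rewrite ltxx.
  pose B := expR (lam * (T - t)).
  have B0 : 0 <= B by exact: expR_ge0.
  exists (z + K * (B * (k * (T - t) + I))).
    by rewrite addr_ge0// mulr_ge0// mulr_ge0// addr_ge0// mulr_ge0// subr_ge0.
  move=> s /[dup] sin /andP[ts sT].
  apply: (@le_trans _ _ (z + K * (B * (k * (T - t) + I)))%:E); last first.
    rewrite lee_fin ler_peMr//.
      by rewrite addr_ge0// mulr_ge0// mulr_ge0// addr_ge0// mulr_ge0// subr_ge0.
    by rewrite -[leLHS]expR0 ler_expR !mulr_ge0 ?subr_ge0// ltW.
  apply: (le_trans (step s sin)).
  rewrite EFinD EFinM; apply: leeD => //; apply: lee_wpmul2l => //.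
  apply: (@le_trans _ _ (\int[leb]_(r in `[t, T]) (B%:E * (k%:E + phi r)))%E).
    apply: (@le_trans _ _ (\int[leb]_(r in `[t, s]) (B%:E * (k%:E + phi r)))%E).
      apply: ge0_le_integral => //.
      - by move=> r _; rewrite mule_ge0 ?lee_fin ?expR_ge0// adde_ge0.
      - by apply: emeasurable_funM; [exact: mexp|apply: emeasurable_funD => //; exact: msub].
      - apply: emeasurable_funM => //; apply: emeasurable_funD => //; exact: msub.
      move=> r; rewrite /= in_itv /= => /andP[tr rs].
      apply: lee_wpmul2r; first by rewrite adde_ge0.
      by rewrite lee_fin ler_expR ler_wpM2l// ?(ltW lam0)// lerB.
    apply: ge0_subset_integral => //.
    - by apply: emeasurable_funM => //; exact: emeasurable_funD.
    - by move=> r _; rewrite mule_ge0 ?lee_fin// adde_ge0.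
    - by apply: subset_itvl; rewrite bnd_simp.
  rewrite ge0_integralZl//; last 2 first.
  - exact: emeasurable_funD.
  - by move=> r _; rewrite adde_ge0.
  rewrite EFinM; apply: lee_wpmul2l => //.
  rewrite ge0_integralD// integral_cst//= lebesgue_measure_itv/= lte_fin.
  rewrite /I EFinD fineK ?ge0_fin_numE ?integral_ge0//.
  apply: leeD => //; case: ltP => _; first by rewrite -EFinM.
  by rewrite mule0 lee_fin mulr_ge0// subr_ge0.
(* Each iteration halves the excess over the fixed point [L]. *)
have iter n : forall s, t <= s <= T ->
    (phi s <= ((L + M0 * (2^-1) ^+ n) * expR (2 * lam * (s - t)))%:E)%E.
  elim: n => [|n IH] s sin.
    apply: (le_trans (hM0 s sin)); rewrite lee_fin ler_wpM2r ?expR_ge0//.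
    by rewrite expr0 mulr1 lerDr /L; lra.
  have := iterate _ _ IH s sin; rewrite -/L => h.
  rewrite (_ : L + M0 * 2^-1 ^+ n.+1 = z + (k + (L + M0 * 2^-1 ^+ n)) / 2); last first.
    by rewrite /L exprS; field.
  apply: h; rewrite addr_ge0//; first by rewrite /L; lra.
  by rewrite mulr_ge0// exprn_ge0// invr_ge0.
move=> s sin.
apply: (@cvge_to_ge _ \oo _ _ (fun n => ((L + M0 * (2^-1) ^+ n) * expR (2 * lam * (s - t)))%:E)).
  apply: cvg_EFin; first exact: nearW.
  have : (L + M0 * 2^-1 ^+ n) * expR (2 * lam * (s - t)) @[n --> \oo] -->
      (L + M0 * 0) * expR (2 * lam * (s - t)).
    apply: cvgMl; apply: cvgD; first exact: cvg_cst.
    apply: cvgMr; apply: cvg_expr.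
    by rewrite ger0_norm ?invr_ge0// invf_lt1// ltr1n.
  by rewrite mulr0 addr0.
by apply: nearW => n; exact: iter.
Qed.

End Gronwall.

(** * Mean-square comparison of stochastic convolution equations *)

Section ItoProcess.
Variables (R : realType) (H Xi : completeNormedModType R).
Hypothesis sepH : separable H.
Variables (dotH : {dot H for idfun}) (dotXi : {dot Xi for idfun}).
Hypotheses (normH : norm_from_dot dotH) (normXi : norm_from_dot dotXi).
Variables (E : set Xi) (e : nat -> Xi) (he : onb_seq dotXi E e).
Context (d : measure_display) (Omega : measurableType d).
Variables (P : probability Omega R) (W : R -> Xi -> Omega -> R) (t T : R).
Hypothesis rs : reference_space P W t T.

Local Notation leb := (@lebesgue_measure R).
Local Notation gs := (gauss_sqmoment R).

(* The integrands f s and Phi s may depend on the final time s, as those of the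
   stochastic convolutions in a mild solution do. *)
Definition ito_process (U : R -> Omega -> H) (u : R -> H)
    (f : R -> R -> Omega -> H) (Phi : R -> R -> Omega -> Xi -> H) : Prop :=
  [/\ progressive P W t T U,
      (\int[P]_w \int[leb]_(r in `[t, T]) (`|U r w| ^+ 2)%:E < +oo)%E &
      forall s, t <= s <= T -> exists drift noise : Omega -> H,
      [/\ {ae P, forall w, is_bochner `[t, s] (fun r => f s r w) (drift w)},
          is_ito dotXi E P W t s (Phi s) noise &
          {ae P, forall w, U s w = u s + drift w + noise w}]].

(** The comparison process for moment bounds: distances to it are norms. *)
Lemma ito_process0 :
  ito_process (fun _ _ => 0) (fun=> 0) (fun _ _ _ => 0) (fun _ _ _ _ => 0).
Proof.
split.
- by move=> s _; exact: measurable_cst.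
- rewrite integral0_eq// => w _; rewrite integral0_eq// => r _.
  by rewrite normr0 expr0n.
move=> s _; exists (fun=> 0), (fun=> 0); split.
- by apply: aeW => w; exact: is_bochner0.
- split.
  + move=> r w _; split.
    * by move=> a u v; rewrite scaler0 addr0.
    * by move=> x; exact: cvg_cst.
    * by rewrite /hs_sqnorm esum1// => x _; rewrite normr0 expr0n.
  + by move=> xi s' _; exact: measurable_cst.
  + exact: measurable_cst.
  (* Empty sums approximate the zero integrand; the elementary integrand given here is a dummy. *)
  + exists (fun=> 0%N), (fun _ _ => Elementary 0 0 set0 0 0); split => //.
      rewrite (_ : (fun n => _) = cst 0%E); first exact: cvg_cst.
      apply/funext => n; rewrite integral0_eq// => w _.
      rewrite integral0_eq// => r _; rewrite /hs_sqnorm esum1// => x _.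
      by rewrite big_ord0 subr0 normr0 expr0n.
    rewrite (_ : (fun n => _) = cst 0%E); first exact: cvg_cst.
    apply/funext => n; rewrite integral0_eq// => w _.
    by rewrite big_ord0 subr0 normr0 expr0n.
- by apply: aeW => w; rewrite !addr0.
Qed.

Lemma measurable_hs_ito s (Phi1 Phi2 : R -> Omega -> Xi -> H) (I1 I2 : Omega -> H) :
  t <= s -> s <= T ->
  is_ito dotXi E P W t s Phi1 I1 -> is_ito dotXi E P W t s Phi2 I2 ->
  measurable_fun (`[t, s] `*` setT) (fun z : R * Omega =>
    hs_sqnorm E (fun eta => Phi1 z.1 z.2 eta - Phi2 z.1 z.2 eta)).
Proof.
move=> ts sT [hs1 prog1 _ _] [hs2 prog2 _ _].
have lin0 (f : Xi -> H) : linear f -> f 0 = 0.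
  by move=> lf; have := lf (-1) 0 0; rewrite scaler0 addr0 scaleN1r addNr.
apply: (measurable_hs_sqnorm he (Phi := fun z eta => Phi1 z.1 z.2 eta - Phi2 z.1 z.2 eta)).
  move=> [r w] [/= rts _]; rewrite in_itv /= in rts.
  have [/lin0 -> _ _] := hs1 r w rts; have [/lin0 -> _ _] := hs2 r w rts.
  by rewrite subrr.
move=> eta; apply: measurable_subv => //.
  exact: (progressive_measurable rs (f := fun r w => Phi1 r w eta)).
exact: (progressive_measurable rs (f := fun r w => Phi2 r w eta)).
Qed.

Variables (U1 U2 : R -> Omega -> H) (u1 u2 : R -> H).
Variables (f1 f2 : R -> R -> Omega -> H) (Phi1 Phi2 : R -> R -> Omega -> Xi -> H).
Hypotheses (hU1 : ito_process U1 u1 f1 Phi1) (hU2 : ito_process U2 u2 f2 Phi2).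
Variables (C k z : R).
Hypotheses (C0 : 0 <= C) (k0 : 0 <= k) (z0 : 0 <= z).
Hypothesis u_le : forall s, t <= s <= T -> `|u1 s - u2 s| <= z.
Hypothesis f_le : forall s r w, t <= r -> r <= s -> s <= T ->
  `|f1 s r w - f2 s r w| <= C * (k + `|U1 r w - U2 r w|).
Hypothesis Phi_le : forall s r w, t <= r -> r <= s -> s <= T ->
  (hs_sqnorm E (fun xi => (Phi1 s r w xi - Phi2 s r w xi)%R) <=
   ((C * (k + `|U1 r w - U2 r w|)) ^+ 2)%:E)%E.

(** With the factor 3 of the three-term inequality and [(k + x) ^+ 2 <= 2 * (k ^+ 2 + x ^+ 2)], the
    drift contributes [3 * 2], where [lam^-1 <= 1] is used, and the noise [3 * 9 * gs * 2]. *)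
Let K := (6 + 54 * gs) * C ^+ 2.
Let lam := 2 * K + 1.
Let Z r w := U1 r w - U2 r w.

Let gs0 : 0 <= gs.
Proof. by apply: fine_ge0; apply: integral_ge0 => x _; rewrite lee_fin sqr_ge0. Qed.

Let K0 : 0 <= K.
Proof. by rewrite mulr_ge0 ?sqr_ge0// addr_ge0// mulr_ge0. Qed.

Let lam1 : 1 <= lam.
Proof. by rewrite /lam; have := K0; lra. Qed.

Lemma progressive_sub (V : R -> Omega -> H) s : s <= T ->
  progressive P W t T V -> progressive P W t s V.
Proof. by move=> sT pV r /andP[tr rls]; apply: pV; rewrite tr (le_trans rls). Qed.

Lemma measurable_process_sub s : t <= s -> s <= T ->
  measurable_fun (`[t, s] `*` setT) (fun x : R * Omega => Z x.1 x.2 : borel H).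
Proof.
move=> ts sT; have [p1 _ _] := hU1; have [p2 _ _] := hU2.
apply: measurable_subv => //.
  exact: (progressive_measurable rs ts sT (progressive_sub sT p1)).
exact: (progressive_measurable rs ts sT (progressive_sub sT p2)).
Qed.

Let measurable_Z s : t <= s -> s <= T -> measurable_fun setT (Z s : Omega -> borel H).
Proof.
move=> ts sT; have := measurable_process_sub ts sT.
by apply: measurable_section2 => //; rewrite /= in_itv /= ts lexx.
Qed.

Let phi s := (\int[P]_w (`|Z s w| ^+ 2)%:E)%E.

Lemma measurable_sqmoment s : t <= s -> s <= T -> measurable_fun `[t, s] phi.
Proof.
move=> ts sT; apply: (measurable_tonelli_F P (f := fun r w => (`|Z r w| ^+ 2)%:E)) => //.
by apply/measurable_EFinP/measurable_funX/measurable_norm_borel; exact: measurable_process_sub.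
Qed.

Let integral_phi_lty : t <= T -> (\int[leb]_(r in `[t, T]) phi r < +oo)%E.
Proof.
move=> tT; have [p1 i1 _] := hU1; have [p2 i2 _] := hU2.
have m1 := progressive_measurable rs tT (lexx T) p1.
have m2 := progressive_measurable rs tT (lexx T) p2.
have msq (V : R -> Omega -> H) :
    measurable_fun (`[t, T] `*` setT) (fun x : R * Omega => V x.1 x.2 : borel H) ->
    measurable_fun (`[t, T] `*` setT) (fun x : R * Omega => (`|V x.1 x.2| ^+ 2)%:E).
  by move=> mV; apply/measurable_EFinP/measurable_funX; exact: measurable_norm_borel.
have mZ := msq _ (measurable_process_sub tT (lexx T)).
have m1' := msq _ m1; have m2' := msq _ m2.
have p (V : R -> Omega -> H) r w : (0 <= (`|V r w| ^+ 2)%:E)%E by rewrite lee_fin sqr_ge0.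
have := tonelli_on leb P (measurable_itv `[t, T]) (fun r w _ => p Z r w) mZ.
move=> /esym ->.
(* The three-term inequality is used with a zero third term. *)
apply: (@le_lt_trans _ _ (3%:E * (\int[P]_w \int[leb]_(r in `[t, T]) (`|U1 r w| ^+ 2)%:E +
  \int[P]_w \int[leb]_(r in `[t, T]) (`|U2 r w| ^+ 2)%:E +
  \int[P]_w \int[leb]_(r in `[t, T]) 0))%E); last first.
  rewrite [X in (_ + _ + X)%E]integral0_eq; last by move=> w _; rewrite integral0.
  by rewrite adde0; apply: lte_mul_pinfty => //; exact: lte_add_pinfty.
apply: ge0_le_integral3 => //.
- exact: (measurable_tonelli_G leb (f := fun r w => (`|Z r w| ^+ 2)%:E)).
- by move=> w _; exact: integral_ge0.
- exact: (measurable_tonelli_G leb (f := fun r w => (`|U1 r w| ^+ 2)%:E)).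
- by move=> w _; exact: integral_ge0.
- exact: (measurable_tonelli_G leb (f := fun r w => (`|U2 r w| ^+ 2)%:E)).
- by move=> w _; exact: integral_ge0.
- by move=> w _; rewrite integral0.
apply: aeW => w _; apply: ge0_le_integral3 => //.
- exact: (measurable_section1 (f := fun r w => (`|Z r w| ^+ 2)%:E)).
- exact: (measurable_section1 (f := fun r w => (`|U1 r w| ^+ 2)%:E)).
- exact: (measurable_section1 (f := fun r w => (`|U2 r w| ^+ 2)%:E)).
apply: aeW => r _; rewrite adde0 -EFinD -EFinM lee_fin.
have := sqnorm3_le (U1 r w) (- U2 r w) 0.
by rewrite addr0 normrN normr0 expr0n addr0.
Qed.

(** Common majorant, up to constants, for drift and noise. The weight comes from the drift estimate;
    being at least 1 for [r <= s], it may be inserted in the noise estimate as well. *)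
Let g s r w : \bar R := (expR (lam * (s - r)) * (k ^+ 2 + `|Z r w| ^+ 2))%:E.

Let g0 s r w : (0 <= g s r w)%E.
Proof. by rewrite lee_fin mulr_ge0 ?expR_ge0// addr_ge0 ?sqr_ge0. Qed.

Let measurable_expR_lam s (D : set R) : measurable_fun D (fun r => expR (lam * (s - r))).
Proof.
apply: measurable_funTS; apply: measurableT_comp => //.
by apply: measurable_funM => //; exact: measurable_funB.
Qed.

Let measurable_g s : t <= s -> s <= T ->
  measurable_fun (`[t, s] `*` setT) (fun x : R * Omega => g s x.1 x.2).
Proof.
move=> ts sT; apply/measurable_EFinP; apply: measurable_funM.
  apply: measurable_funTS.
  apply: measurableT_comp => //; apply: measurable_funM => //.
  by apply: measurable_funB => //; exact: measurable_fst.
apply: measurable_funD => //; apply/measurable_funX/measurable_norm_borel.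
exact: measurable_process_sub.
Qed.

Let sqr_bound x : 0 <= x -> (C * (k + x)) ^+ 2 <= 2 * C ^+ 2 * (k ^+ 2 + x ^+ 2).
Proof.
move=> x0; rewrite exprMn [leRHS](_ : _ = C ^+ 2 * (2 * (k ^+ 2 + x ^+ 2))); last by ring.
by apply: ler_wpM2l; [exact: sqr_ge0|have := sqr_ge0 (k - x); nra].
Qed.

Let exp_ge1 s r : r <= s -> 1 <= expR (lam * (s - r)).
Proof.
move=> rls; rewrite -[leLHS]expR0 ler_expR mulr_ge0 ?subr_ge0//.
by rewrite (le_trans _ lam1).
Qed.

Let sqmoment_step s : t <= s <= T ->
  (phi s <= (3 * z ^+ 2)%:E + K%:E *
    \int[leb]_(r in `[t, s]) ((expR (lam * (s - r)))%:E * ((k ^+ 2)%:E + phi r)))%E.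
Proof.
move=> /[dup] sin /andP[ts sT].
have [_ _ /(_ s sin)[dr1 [no1 [bo1 ito1 eq1]]]] := hU1.
have [_ _ /(_ s sin)[dr2 [no2 [bo2 ito2 eq2]]]] := hU2.
have [_ _ mno1 _] := ito1; have [_ _ mno2 _] := ito2.
have lam0 : 0 < lam by rewrite (lt_le_trans _ lam1).
have mg := measurable_g ts sT.
pose G w := (\int[leb]_(r in `[t, s]) g s r w)%E.
have G0 w : (0 <= G w)%E by apply: integral_ge0 => r _; exact: g0.
have mG : measurable_fun setT G by exact: (measurable_tonelli_G leb (f := g s)).
(* The integral of the statement is the expectation of [G], by Tonelli and because [P] has total
   mass 1. *)
have -> : (\int[leb]_(r in `[t, s]) ((expR (lam * (s - r)))%:E * ((k ^+ 2)%:E + phi r)) =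
    \int[P]_w G w)%E.
  rewrite /G (tonelli_on leb P (f := g s))//; apply: eq_integral => r /set_mem.
  rewrite /= in_itv /= => /andP[tr rs'].
  have mZr : measurable_fun setT (fun w => (`|Z r w| ^+ 2)%:E).
    apply/measurable_EFinP/measurable_funX/measurable_norm_borel.
    exact: (measurable_Z tr (le_trans rs' sT)).
  under [RHS]eq_integral do rewrite /g EFinM EFinD.
  rewrite ge0_integralZl//; do ?[exact: emeasurable_funD|
    by rewrite lee_fin expR_ge0|by move=> w _; rewrite adde_ge0 ?lee_fin ?sqr_ge0].
  rewrite ge0_integralD//; do ?[by move=> w _; rewrite lee_fin sqr_ge0].
  by rewrite integral_cst//= probability_setT mule1.
set IG := (\int[P]_w G w)%E.
have IG0 : (0 <= IG)%E by exact: integral_ge0.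
(* The constant is 9 from the comparison of Ito integrals times 2 from [sqr_bound]. *)
have noise_le : (\int[P]_w (`|no1 w - no2 w| ^+ 2)%:E <=
    (18 * gs * C ^+ 2)%:E * IG)%E.
  apply: (le_trans (ito_dist sepH normH normXi he rs ts sT ito1 ito2)).
  rewrite [X in (X%:E * IG)%E](_ : _ = (9 * gs) * (2 * C ^+ 2)); last by ring.
  rewrite [(9 * gs * (2 * C ^+ 2))%:E]EFinM -muleA.
  apply: lee_wpmul2l; first by rewrite lee_fin mulr_ge0.
  rewrite -ge0_integralZl_EFin//; last by rewrite mulr_ge0 ?sqr_ge0.
  have mhs := measurable_hs_ito ts sT ito1 ito2.
  apply: ge0_le_integral => //.
  - by move=> w _; apply: integral_ge0 => r _; exact: hs_sqnorm_ge0.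
  - apply: (measurable_tonelli_G leb (f := fun r w =>
      hs_sqnorm E (fun eta => Phi1 s r w eta - Phi2 s r w eta))) => //.
    by move=> r w _; exact: hs_sqnorm_ge0.
  - exact: emeasurable_funM.
  move=> w _; rewrite -ge0_integralZl_EFin//; last 2 first.
  - exact: (measurable_section1 (f := g s)).
  - by rewrite mulr_ge0 ?sqr_ge0.
  apply: ge0_le_integral => //.
  - by move=> r _; exact: hs_sqnorm_ge0.
  - exact: (measurable_section1 (f := fun r w =>
      hs_sqnorm E (fun eta => Phi1 s r w eta - Phi2 s r w eta))).
  - apply: emeasurable_funM => //; exact: (measurable_section1 (f := g s)).
  move=> r; rewrite /= in_itv /= => /andP[tr rs'].
  apply: (le_trans (Phi_le w tr rs' sT)).
  rewrite /g -EFinM lee_fin; apply: (le_trans (sqr_bound (normr_ge0 _))).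
  apply: ler_wpM2l; first by rewrite mulr_ge0 ?sqr_ge0.
  by apply: ler_peMl; [rewrite addr_ge0 ?sqr_ge0|exact: exp_ge1].
(* Along almost every path, the weighted Cauchy-Schwarz inequality trades the length of the interval
   for [1 / lam]. *)
have drift_le : {ae P, forall w,
    ((`|dr1 w - dr2 w| ^+ 2)%:E <= (lam^-1 * (2 * C ^+ 2))%:E * G w)%E}.
  apply: filterS2 bo1 bo2 => w b1 b2.
  have := bochner_dist sepH normH (measurable_itv _) b1 b2 => hb.
  have mZw : measurable_fun `[t, s] (fun r => `|Z r w|).
    apply/measurable_EFinP.
    apply: (measurable_section1 (f := fun r w => (`|Z r w|)%:E)) => //.
    by apply/measurable_EFinP;  apply: measurable_norm_borel; exact: measurable_process_sub.
  have ma : measurable_fun `[t, s] (fun r => C * (k + `|Z r w|)).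
    by apply: measurable_funM => //; exact: measurable_funD.
  have := @sqr_le_weighted_integral _ lam t s (`|dr1 w - dr2 w|)
    (fun r => C * (k + `|Z r w|)) lam0 ts (normr_ge0 _) ma => hw.
  apply: (le_trans (hw _ _)).
  - apply: (le_trans hb); apply: ge0_le_integral => //.
    + have [mf1 _] := b1; have [mf2 _] := b2.
      by apply/measurable_EFinP; exact: (measurable_dist_borel sepH).
    + exact/measurable_EFinP.
    move=> r; rewrite /= in_itv /= => /andP[tr rs'].
    by rewrite lee_fin; exact: f_le.
  - by move=> r; rewrite mulr_ge0// addr_ge0.
  rewrite [(lam^-1 * (2 * C ^+ 2))%:E]EFinM -muleA.
  apply: lee_wpmul2l; first by rewrite lee_fin invr_ge0 ltW.
  rewrite -ge0_integralZl_EFin//; last 2 first.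
  - exact: (measurable_section1 (f := g s)).
  - by rewrite mulr_ge0 ?sqr_ge0.
  apply: ge0_le_integral => //.
  - by move=> r _; rewrite lee_fin mulr_ge0 ?expR_ge0 ?sqr_ge0.
  - apply/measurable_EFinP; apply: measurable_funM.
      exact: measurable_expR_lam.
    exact: measurable_funX.
  - apply: emeasurable_funM => //; exact: (measurable_section1 (f := g s)).
  move=> r _; rewrite /g -EFinM lee_fin [leRHS]mulrCA.
  by apply: ler_wpM2l; [exact: expR_ge0|exact: sqr_bound].
apply: (@le_trans _ _ (3%:E * (\int[P]_w (z ^+ 2)%:E +
   \int[P]_w ((lam^-1 * (2 * C ^+ 2))%:E * G w) +
   \int[P]_w (`|no1 w - no2 w| ^+ 2)%:E))%E).
  apply: ge0_le_integral3 => //.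
  - by apply/measurable_EFinP/measurable_funX/measurable_norm_borel; exact: measurable_Z.
  - by move=> w _; rewrite lee_fin sqr_ge0.
  - exact: emeasurable_funM.
  - move=> w _; apply: mule_ge0 => //; rewrite lee_fin mulr_ge0 ?invr_ge0 ?(ltW lam0)//.
    by rewrite mulr_ge0 ?sqr_ge0.
  - by apply/measurable_EFinP/measurable_funX/measurable_norm_borel; exact: measurable_subv.
  move: drift_le; apply: filterS3 eq1 eq2 => w e1 e2 dle _.
  apply: (@le_trans _ _ (3%:E * ((z ^+ 2)%:E + (`|dr1 w - dr2 w| ^+ 2)%:E +
    (`|no1 w - no2 w| ^+ 2)%:E))%E); last first.
    by apply: lee_wpmul2l => //; apply: leeD => //; apply: leeD.
  rewrite -!EFinD -EFinM lee_fin.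
  rewrite (_ : Z s w = (u1 s - u2 s) + (dr1 w - dr2 w) + (no1 w - no2 w)); last first.
    by rewrite /Z e1 e2 !opprD addrACA (addrACA (u1 s)).
  apply: (le_trans (sqnorm3_le _ _ _)); rewrite ler_pM2l// !lerD2r.
  by rewrite ler_sqr ?nnegrE//; exact: u_le.
rewrite integral_cst//= probability_setT mule1.
rewrite ge0_integralZl_EFin//; last first.
  by rewrite mulr_ge0 ?invr_ge0 ?(ltW lam0)// mulr_ge0 ?sqr_ge0.
rewrite -/IG.
apply: (@le_trans _ _ (3%:E * ((z ^+ 2)%:E + (lam^-1 * (2 * C ^+ 2))%:E * IG +
  (18 * gs * C ^+ 2)%:E * IG))%E).
  by apply: lee_wpmul2l => //; apply: leeD.
rewrite -addeA -ge0_muleDl ?lee_fin//; last 2 first.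
- by rewrite mulr_ge0 ?invr_ge0 ?(ltW lam0)// mulr_ge0 ?sqr_ge0.
- by rewrite !mulr_ge0 ?sqr_ge0.
rewrite muleDr//.
rewrite -EFinM; apply: leeD => //.
rewrite muleA -EFinD -EFinM; apply: lee_wpmul2r => //; rewrite lee_fin /K.
have : lam^-1 * (2 * C ^+ 2) <= 2 * C ^+ 2.
  by rewrite ler_piMl ?mulr_ge0 ?sqr_ge0// invf_le1.
by lra.
Qed.

(** Gronwall's inequality with [3 * z ^+ 2] and [k ^+ 2] as data, whence the coefficients 6 and
    1. *)
Lemma sqmoment_le s : t <= s <= T ->
  (\int[P]_w (`|U1 s w - U2 s w| ^+ 2)%:E <=
   ((6 * z ^+ 2 + k ^+ 2) * expR (2 * lam * (s - t)))%:E)%E.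
Proof.
move=> /[dup] sin /andP[ts sT].
have tT := le_trans ts sT.
have := @gronwall _ K (3 * z ^+ 2) (k ^+ 2) t T phi K0 _ (sqr_ge0 _)
  (measurable_sqmoment tT (lexx T)) _ (integral_phi_lty tT) sqmoment_step s sin.
rewrite (_ : 2 * (3 * z ^+ 2) = 6 * z ^+ 2); last by ring.
apply.
- by rewrite mulr_ge0 ?sqr_ge0.
- by move=> r; apply: integral_ge0 => w _; rewrite lee_fin sqr_ge0.
Qed.

End ItoProcess.

(* The integrals may be infinite, or undefined in the sense that both parts
   are, hence the detour through positive and negative parts. *)
Lemma integral_le_add d (T : measurableType d) (R : realType)
    (mu : {measure set T -> \bar R}) (D : set T) (f h k : T -> \bar R) :
  measurable D -> measurable_fun D f -> measurable_fun D h ->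
  measurable_fun D k -> (forall x, D x -> (0 <= k x)%E) ->
  (forall x, D x -> (k x < +oo)%E -> (f x <= h x + k x)%E) ->
  (\int[mu]_(x in D) k x < +oo)%E ->
  (\int[mu]_(x in D) f x <= \int[mu]_(x in D) h x + \int[mu]_(x in D) k x)%E.
Proof.
move=> mD mf mh mk k0 fh; rewrite (integralE _ D f) (integralE _ D h).
have mfp := measurable_funepos mf; have mfn := measurable_funeneg mf.
have mhp := measurable_funepos mh; have mhn := measurable_funeneg mh.
have ny (z : \bar R) : (0 <= z)%E -> z != -oo%E by case: z.
have ny1 (z : \bar R) : (0 <= z)%E -> (+oo + z = +oo)%E by case: z.
have ny2 (z : \bar R) : (0 <= z)%E -> (z + +oo = +oo)%E by case: z.
have mx (z : \bar R) : (0 <= maxe z 0)%E by rewrite le_max lexx orbT.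
(* The inequality [f <= h + k] written without subtraction, so that both sides have a defined
   integral. *)
have p1 x : D x -> (f^\+ x + h^\- x <= h^\+ x + f^\- x + k x)%E.
  move=> Dx; have := fh x Dx; have := k0 x Dx.
  rewrite !funeposE !funenegE.
  case: (k x) => [u||] //; last first.
    by move=> _ _; rewrite addey ?leey// ny// adde_ge0// le_max lexx orbT.
  rewrite lee_fin => u0 /(_ (ltry _)).
  case: (f x) => [a||]; case: (h x) => [c||] //=; rewrite ?maxye ?maxey ?maxNye ?maxeNy ?add0e
    ?(ny1 _ (mx _)) ?(ny2 _ (mx _)) ?leey//=.
  rewrite !lee_fin -!EFin_max -!EFinD !lee_fin.
  by case: (ltP a 0); case: (ltP c 0); case: (ltP (- a) 0); case: (ltP (- c) 0); lra.
(* Needed when the negative part of [h] has infinite integral: that of [f] is then infinite too, and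
   both sides are [-oo], as [+oo - +oo] equals [-oo]. *)
have p2 x : D x -> (h^\- x <= f^\- x + k x)%E.
  move=> Dx; have := fh x Dx; have := k0 x Dx.
  rewrite !funenegE.
  case: (k x) => [u||] //; last first.
    by move=> _ _; rewrite addey ?leey// ny// le_max lexx orbT.
  rewrite lee_fin => u0 /(_ (ltry _)).
  case: (f x) => [a||]; case: (h x) => [c||] //=; rewrite ?maxye ?maxey ?maxNye ?maxeNy ?add0e
    ?(ny1 _ (mx _)) ?(ny2 _ (mx _)) ?leey//=; last by move=> _; rewrite adde_ge0.
  rewrite !lee_fin -!EFin_max -!EFinD !lee_fin.
  by case: (ltP (- a) 0); case: (ltP (- c) 0); lra.
have : (\int[mu]_(x in D) f^\+ x + \int[mu]_(x in D) h^\- x <=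
    \int[mu]_(x in D) h^\+ x + \int[mu]_(x in D) f^\- x + \int[mu]_(x in D) k x)%E.
  rewrite -!ge0_integralD//.
  - apply: ge0_le_integral => //.
    + by move=> x _; rewrite adde_ge0.
    + exact: emeasurable_funD.
    + by apply: emeasurable_funD => //; exact: emeasurable_funD.
  - by move=> x _; rewrite adde_ge0.
  - exact: emeasurable_funD.
have : (\int[mu]_(x in D) h^\- x <= \int[mu]_(x in D) f^\- x + \int[mu]_(x in D) k x)%E.
  rewrite -!ge0_integralD//; apply: ge0_le_integral => //; exact: emeasurable_funD.
have fp0 : (0 <= \int[mu]_(x in D) f^\+ x)%E by exact: integral_ge0.
have fn0 : (0 <= \int[mu]_(x in D) f^\- x)%E by exact: integral_ge0.
have hp0 : (0 <= \int[mu]_(x in D) h^\+ x)%E by exact: integral_ge0.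
have hn0 : (0 <= \int[mu]_(x in D) h^\- x)%E by exact: integral_ge0.
have ik0 : (0 <= \int[mu]_(x in D) k x)%E by exact: integral_ge0.
move: fp0 fn0 hp0 hn0 ik0.
move: (\int[mu]_(x in D) f^\+ x)%E (\int[mu]_(x in D) f^\- x)%E
  (\int[mu]_(x in D) h^\+ x)%E (\int[mu]_(x in D) h^\- x)%E (\int[mu]_(x in D) k x)%E.
move=> [a||] [b||] [c||] [e||] [v||] //=; rewrite ?leey ?leNye// !lee_fin.
by move=> *; lra.
Qed.

Lemma measurable_within_continuous d (T : measurableType d) (R : realType)
    (K L : completeNormedModType R) (L0 : set L) (f : K * L -> R) (D : set T)
    (u : T -> K) (v : T -> L) : separable K -> separable L ->
  {within setT `*` L0, continuous f} ->
  measurable_fun D (u : T -> borel K) -> measurable_fun D (v : T -> borel L) ->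
  (forall x, D x -> L0 (v x)) ->
  measurable_fun D (fun x => f (u x, v x)).
Proof.
move=> /separable_seq[q hq] /separable_seq[q' hq'] /subspace_continuousP cf mu mv vL0.
apply: measurable_of_lt => mD c.
pose rad n : R := n.+1%:R^-1.
pose good i j n := forall y : K * L, L0 y.2 -> `|y.1 - q i| < rad n ->
  `|y.2 - q' j| < rad n -> f y < c.
pose box i j n := D `&` [set x | `|u x - q i| < rad n] `&` [set x | `|v x - q' j| < rad n].
have mbox i j n : measurable (box i j n).
  have mlt (K' : completeNormedModType R) (w : T -> K') z r :
      measurable_fun D (w : T -> borel K') -> measurable (D `&` [set x | `|w x - z| < r]).
    move=> mw; have mn : measurable_fun D (fun x => `|w x - z|).
      apply: (measurable_continuous_compR (phi := fun y => `|y - z|)) => // y.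
      by apply: cvg_norm; apply: cvgB; [exact: cvg_id|exact: cvg_cst].
    by rewrite -preimage_itvNyo; apply: mn.
  by rewrite /box -setIA setIIr; apply: measurableI; exact: mlt.
rewrite (_ : _ `&` _ = \bigcup_i \bigcup_j \bigcup_n
    (if `[< good i j n >] then box i j n else set0)); last first.
  apply/seteqP; split => [x [Dx /= fx]|x [i _ [j _ [n _]]]]; last first.
    case: asboolP => // gd [[Dx ux] vx]; split => //=.
    by apply: (gd (u x, v x)) => //; exact: vL0.
  have := cf (u x, v x) (conj I (vL0 _ Dx)).
  move=> /cvgrPdist_lt /(_ (c - f (u x, v x))); rewrite subr_gt0 => /(_ fx).
  move=> /nbhs_ballP[r /= r0 hr].
  have [n hn] : exists n, rad n < r / 2.
    have [n _ hn] := near_infty_natSinv_lt (PosNum (divr_gt0 r0 (ltr0n _ 2))).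
    by exists n; exact: (hn n (leqnn n)).
  have rad0 : 0 < rad n by rewrite invr_gt0.
  have [i hi] := hq (u x) _ rad0; have [j hj] := hq' (v x) _ rad0.
  exists i => //; exists j => //; exists n => //.
  case: asboolP => [_|]; first by split.
  case=> y y0 y1 y2.
  have : ball (u x, v x) r y.
    split; rewrite -ball_normE /ball_ /=.
      rewrite -(subrKA (q i)) (le_lt_trans (ler_normD _ _))// (distrC (q i)).
      by rewrite (splitr r) ltrD// (lt_trans _ hn).
    rewrite -(subrKA (q' j)) (le_lt_trans (ler_normD _ _))// (distrC (q' j)).
    by rewrite (splitr r) ltrD// (lt_trans _ hn).
  by move=> /hr /(_ (conj I y0)); rewrite distrC => /(le_lt_trans (ler_norm _)); rewrite ltrD2r.
apply: bigcupT_measurable => i; apply: bigcupT_measurable => j.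
by apply: bigcupT_measurable => n; case: ifP.
Qed.

(** * Expected costs *)

Section ExpectedCost.
Context (d : measure_display) (Omega : measurableType d) (R : realType).
Variables (P : probability Omega R) (t T : R).

Local Notation leb := (@lebesgue_measure R).

(** [F] may change sign, so Tonelli is applied to its positive and negative parts. *)
Lemma measurable_integral_section (F : R -> Omega -> R) :
  measurable_fun (`[t, T] `*` setT) (fun z : R * Omega => F z.1 z.2) ->
  measurable_fun setT (fun w => \int[leb]_(s in `[t, T]) (F s w)%:E)%E.
Proof.
move=> mF.
have mFE : measurable_fun (`[t, T] `*` setT) (fun z : R * Omega => (F z.1 z.2)%:E).
  exact/measurable_EFinP.
pose Fp s w := (fun z : R * Omega => (F z.1 z.2)%:E)^\+%E (s, w).
pose Fn s w := (fun z : R * Omega => (F z.1 z.2)%:E)^\-%E (s, w).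
have mp : measurable_fun setT (fun w => \int[leb]_(s in `[t, T]) Fp s w)%E.
  apply: (measurable_tonelli_G leb (f := Fp)) => //.
  - by move=> s w _; exact: funepos_ge0.
  - by apply: eq_measurable_fun (measurable_funepos mFE) => -[].
have mn : measurable_fun setT (fun w => \int[leb]_(s in `[t, T]) Fn s w)%E.
  apply: (measurable_tonelli_G leb (f := Fn)) => //.
  - by move=> s w _; exact: funeneg_ge0.
  - by apply: eq_measurable_fun (measurable_funeneg mFE) => -[].
rewrite (_ : (fun w => _) = (fun w =>
  \int[leb]_(s in `[t, T]) Fp s w - \int[leb]_(s in `[t, T]) Fn s w)%E).
  exact: emeasurable_funB.
apply/funext => w; rewrite integralE; congr (_ - _)%E; apply: eq_integral => s _.
  by rewrite /Fp !funeposE.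
by rewrite /Fn !funenegE.
Qed.

(** [integral_le_add] is used twice: in time, along each path on which [k] has finite integral, and
    in expectation. Its restriction to points where the added term is finite is made for the second
    use. *)
Lemma expected_cost_le (F1 F2 k : R -> Omega -> R) (G1 G2 kT : Omega -> R) :
  measurable_fun (`[t, T] `*` setT) (fun z : R * Omega => F1 z.1 z.2) ->
  measurable_fun (`[t, T] `*` setT) (fun z : R * Omega => F2 z.1 z.2) ->
  measurable_fun (`[t, T] `*` setT) (fun z : R * Omega => k z.1 z.2) ->
  measurable_fun setT G1 -> measurable_fun setT G2 -> measurable_fun setT kT ->
  (forall s w, t <= s <= T -> 0 <= k s w) -> (forall w, 0 <= kT w) ->
  (forall s w, t <= s <= T -> F1 s w <= F2 s w + k s w) ->
  (forall w, G1 w <= G2 w + kT w) ->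
  (\int[leb]_(s in `[t, T]) \int[P]_w (k s w)%:E + \int[P]_w (kT w)%:E < +oo)%E ->
  (\int[P]_w (\int[leb]_(s in `[t, T]) (F1 s w)%:E + (G1 w)%:E) <=
   \int[P]_w (\int[leb]_(s in `[t, T]) (F2 s w)%:E + (G2 w)%:E) +
   (\int[leb]_(s in `[t, T]) \int[P]_w (k s w)%:E + \int[P]_w (kT w)%:E))%E.
Proof.
move=> mF1 mF2 mk mG1 mG2 mkT k0 kT0 F12 G12.
have mkE : measurable_fun (`[t, T] `*` setT) (fun z : R * Omega => (k z.1 z.2)%:E).
  exact/measurable_EFinP.
have k0' s w : `[t, T]%classic s -> (0 <= (k s w)%:E)%E.
  by rewrite /= in_itv /= lee_fin; exact: k0.
have mIk := measurable_integral_section mk.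
have Ik0 w : (0 <= \int[leb]_(s in `[t, T]) (k s w)%:E)%E.
  by apply: integral_ge0 => s st; exact: k0'.
have mkTE : measurable_fun setT (fun w => (kT w)%:E) by exact/measurable_EFinP.
rewrite -(tonelli_on leb P (measurable_itv `[t, T]) k0' mkE).
rewrite -ge0_integralD//; last by move=> w _; rewrite lee_fin.
apply: integral_le_add => //.
- by apply: emeasurable_funD; [exact: measurable_integral_section|exact/measurable_EFinP].
- by apply: emeasurable_funD; [exact: measurable_integral_section|exact/measurable_EFinP].
- exact: emeasurable_funD.
- by move=> w _; rewrite adde_ge0// lee_fin.
move=> w _ fin; rewrite addeACA -EFinD; apply: leeD; last by rewrite lee_fin.
have sec (F : R -> Omega -> R) :
    measurable_fun (`[t, T] `*` setT) (fun z : R * Omega => F z.1 z.2) ->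
    measurable_fun `[t, T] (fun s => (F s w)%:E).
  move=> mF; apply: (measurable_section1 (f := fun s w => (F s w)%:E)) => //.
  exact/measurable_EFinP.
apply: integral_le_add.
- exact: measurable_itv.
- exact: sec.
- exact: sec.
- exact: sec.
- by move=> s st; exact: k0'.
- by move=> s; rewrite /= in_itv /= => st _; rewrite -EFinD lee_fin F12.
- by apply: le_lt_trans fin; rewrite leeDl// lee_fin.
Qed.

End ExpectedCost.

(** * Mild solutions *)

Section HilbertSchmidtBounds.
Variables (R : realType) (H Xi : completeNormedModType R).
Variables (dotXi : {dot Xi for idfun}).
Variables (E : set Xi) (e : nat -> Xi) (he : onb_seq dotXi E e).

Lemma le_hs_sqnorm (f g : Xi -> H) :
  (forall xi, `|f xi| <= `|g xi|) -> (hs_sqnorm E f <= hs_sqnorm E g)%E.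
Proof.
by move=> fg; apply: le_esum => xi _; rewrite lee_fin ler_sqr ?nnegrE.
Qed.

(** [hs_norm] goes through [fine], which sends [+oo] to 0; a bound on it is informative only once
    the sum is known to be finite. *)
Lemma hs_sqnorm_le (f : Xi -> H) (c : R) :
  (hs_sqnorm E f < +oo)%E -> hs_norm E f <= c -> (hs_sqnorm E f <= (c ^+ 2)%:E)%E.
Proof.
rewrite /hs_norm; have := hs_sqnorm_ge0 E f.
case: (hs_sqnorm E f) => [v||] //=; rewrite !lee_fin => v0 _ h.
by rewrite -(sqr_sqrtr v0) ler_sqr ?nnegrE ?sqrtr_ge0// (le_trans (sqrtr_ge0 v)).
Qed.

Lemma hs_sqnorm_sub_lty (f g : Xi -> H) :
  hilbert_schmidt E f -> hilbert_schmidt E g ->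
  (hs_sqnorm E (fun xi => (f xi - g xi)%R) < +oo)%E.
Proof.
have lin0 (u : Xi -> H) : linear u -> u 0 = 0.
  by move=> lu; have := lu (-1) 0 0; rewrite scaler0 addr0 scaleN1r addNr.
move=> [/lin0 f0 _ ff] [/lin0 g0 _ gf].
have zero : hs_sqnorm E (fun=> 0 : H) = 0%E.
  by rewrite /hs_sqnorm esum1// => x _; rewrite normr0 expr0n.
have := hs_sqnorm3_le he (f := f) (g := fun xi => - g xi) (h := fun=> 0) f0 _ erefl.
rewrite g0 oppr0 hs_sqnormN zero adde0 => /(_ erefl).
under eq_fun do rewrite addr0.
by move=> /le_lt_trans; apply; rewrite lte_mul_pinfty// lte_add_pinfty.
Qed.

End HilbertSchmidtBounds.

(** Integration of [Y <= (delta + Y ^+ 2 / delta) / 2]. The free [delta] replaces the square root of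
    Jensen's inequality. *)
Lemma integral_norm_le d (Omega : measurableType d) (R : realType)
    (P : probability Omega R) (Y : Omega -> R) (delta A : R) :
  measurable_fun setT Y -> (forall w, 0 <= Y w) -> 0 < delta ->
  (\int[P]_w (Y w ^+ 2)%:E <= A%:E)%E ->
  (\int[P]_w (Y w)%:E <= (2^-1 * (delta + delta^-1 * A))%:E)%E.
Proof.
move=> mY Y0 d0 hA.
have mY2 : measurable_fun setT (fun w => (Y w ^+ 2)%:E).
  exact/measurable_EFinP/measurable_funX.
apply: (@le_trans _ _ (\int[P]_w ((2^-1 * delta)%:E + (2^-1 * delta^-1)%:E * (Y w ^+ 2)%:E))%E).
  apply: ge0_le_integral => //.
  - by move=> w _; rewrite lee_fin.
  - exact/measurable_EFinP.
  - by apply: emeasurable_funD => //; exact: emeasurable_funM.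
  move=> w _; rewrite -EFinM -EFinD lee_fin.
  have := sqr_ge0 (delta - Y w); rewrite -(ler_pM2l d0).
  have -> : delta * (2^-1 * delta + 2^-1 / delta * Y w ^+ 2) =
      2^-1 * (delta ^+ 2 + Y w ^+ 2) by field; rewrite gt_eqF.
  nra.
rewrite ge0_integralD//; do ?[by move=> w _; rewrite -?EFinM lee_fin
    ?mulr_ge0 ?invr_ge0 ?sqr_ge0 ?(ltW d0)|exact: emeasurable_funM].
rewrite integral_cst//= probability_setT mule1.
rewrite ge0_integralZl_EFin//; do ?[by rewrite mulr_ge0 ?invr_ge0 ?(ltW d0)|
  by move=> w _; rewrite lee_fin sqr_ge0].
rewrite mulrDr EFinD; apply: leeD => //.
rewrite mulrA [leRHS]EFinM; apply: lee_wpmul2l => //.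
by rewrite lee_fin mulr_ge0 ?invr_ge0 ?(ltW d0).
Qed.

Section MildSolutions.
Variables (R : realType) (H Xi Lambda : completeNormedModType R).
Hypothesis sepH : separable H.
Variables (dotH : {dot H for idfun}) (dotXi : {dot Xi for idfun}).
Hypotheses (normH : norm_from_dot dotH) (normXi : norm_from_dot dotXi).
Variables (E : set Xi) (e : nat -> Xi) (he : onb_seq dotXi E e).
Variables (Lambda0 : set Lambda) (S : R -> H -> H).
Hypothesis S_semigroup : C0_contraction_semigroup S.
Variables (b : H * Lambda -> H) (sigma : H * Lambda -> Xi -> H).
Hypothesis sigma_HS : forall z, hilbert_schmidt E (sigma z).
Variables (C : R) (C_gt0 : 0 < C).
Hypothesis b_sigma_bounds : forall (x x' : H) (a : Lambda), Lambda0 a ->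
  [/\ `|b (x, a) - b (x', a)| <= C * `|x - x'|,
      hs_norm E (fun xi => sigma (x, a) xi - sigma (x', a) xi) <= C * `|x - x'|,
      `|b (x, a)| <= C * (1 + `|x| + `|a|) &
      hs_norm E (sigma (x, a)) <= C * (1 + `|x| + `|a|)].
Context (d : measure_display) (Omega : measurableType d).
Variables (P : probability Omega R) (W : R -> Xi -> Omega -> R) (t T : R).
Hypothesis rs : reference_space P W t T.

Let lam := 2 * ((6 + 54 * gauss_sqmoment R) * C ^+ 2) + 1.

Lemma semigroupB s u v : 0 <= s -> S s u - S s v = S s (u - v).
Proof.
move=> s0; have := sg_linear S_semigroup s0 (-1) v u.
by rewrite !scaleN1r addrC => <-; rewrite addrC.
Qed.

Lemma ito_process_mild x a (X : R -> Omega -> H) :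
  mild_solution dotXi E S b sigma P W t T x a X ->
  ito_process dotXi E P W t T X (fun s => S (s - t) x)
    (fun s r w => S (s - r) (b (X r w, a r w)))
    (fun s r w xi => S (s - r) (sigma (X r w, a r w) xi)).
Proof. by case. Qed.

Variables (a : R -> Omega -> Lambda).
Hypothesis aL0 : forall s w, t <= s <= T -> Lambda0 (a s w).

(** Both trajectories use the same control, so the Lipschitz bounds apply with [k = 0];
    contractivity removes the semigroup from all three differences. *)
Lemma mild_dist_sqmoment x y (X Y : R -> Omega -> H) s :
  mild_solution dotXi E S b sigma P W t T x a X ->
  mild_solution dotXi E S b sigma P W t T y a Y -> t <= s <= T ->
  (\int[P]_w (`|X s w - Y s w| ^+ 2)%:E <=
   (6 * `|x - y| ^+ 2 * expR (2 * lam * (s - t)))%:E)%E.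
Proof.
move=> /ito_process_mild hX /ito_process_mild hY st.
have := @sqmoment_le _ _ _ sepH _ _ normH normXi _ _ he _ _ _ _ _ _ rs _ _ _ _ _ _ _ _
  hX hY C 0 `|x - y| (ltW C_gt0) (lexx 0) (normr_ge0 _) _ _ _ s st.
rewrite expr0n addr0; apply.
- move=> r /andP[tr _]; rewrite semigroupB ?subr_ge0//.
  by apply: (sg_contraction S_semigroup); rewrite subr_ge0.
- move=> u r w tr ru uT; rewrite semigroupB ?subr_ge0// add0r.
  apply: (le_trans (sg_contraction S_semigroup _ _)); first by rewrite subr_ge0.
  have ar : Lambda0 (a r w) by apply: aL0; rewrite tr (le_trans ru).
  by have [] := b_sigma_bounds (X r w) (Y r w) ar.
move=> u r w tr ru uT; rewrite add0r.
have ar : Lambda0 (a r w) by apply: aL0; rewrite tr (le_trans ru).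
apply: (@le_trans _ _ (hs_sqnorm E (fun xi =>
    (sigma (X r w, a r w) xi - sigma (Y r w, a r w) xi)%R))).
  apply: le_hs_sqnorm => xi; rewrite semigroupB ?subr_ge0//.
  by apply: (sg_contraction S_semigroup); rewrite subr_ge0.
apply: hs_sqnorm_le; first exact: (hs_sqnorm_sub_lty he).
by have [] := b_sigma_bounds (X r w) (Y r w) ar.
Qed.

(** Comparison with the zero process: for a control bounded by [rho], linear growth reads
    [C * (1 + rho + |X|)], hence [k = 1 + rho]. *)
Lemma mild_sqmoment x (X : R -> Omega -> H) (rho : R) s : 0 <= rho ->
  (forall s w, t <= s <= T -> `|a s w| <= rho) ->
  mild_solution dotXi E S b sigma P W t T x a X -> t <= s <= T ->
  (\int[P]_w (`|X s w| ^+ 2)%:E <=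
   ((6 * `|x| ^+ 2 + (1 + rho) ^+ 2) * expR (2 * lam * (s - t)))%:E)%E.
Proof.
move=> rho0 arho /ito_process_mild hX st.
have := @sqmoment_le _ _ _ sepH _ _ normH normXi _ _ he _ _ _ _ _ _ rs _ _ _ _ _ _ _ _
  hX (ito_process0 H dotXi E P W t T) C (1 + rho) `|x| (ltW C_gt0) (addr_ge0 ler01 rho0)
  (normr_ge0 _) _ _ _ s st.
under eq_integral do rewrite subr0.
apply.
- move=> r /andP[tr _]; rewrite subr0.
  by apply: (sg_contraction S_semigroup); rewrite subr_ge0.
- move=> u r w tr ru uT; rewrite !subr0.
  apply: (le_trans (sg_contraction S_semigroup _ _)); first by rewrite subr_ge0.
  have rT : t <= r <= T by rewrite tr (le_trans ru).
  have [_ _ hb _] := b_sigma_bounds (X r w) (X r w) (aL0 w rT).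
  apply: (le_trans hb); rewrite ler_pM2l// -addrA (addrC `|X r w|) addrA.
  by rewrite lerD2r lerD2l arho.
move=> u r w tr ru uT.
have rT : t <= r <= T by rewrite tr (le_trans ru).
apply: (@le_trans _ _ (hs_sqnorm E (sigma (X r w, a r w)))).
  apply: le_hs_sqnorm => xi; rewrite subr0.
  by apply: (sg_contraction S_semigroup); rewrite subr_ge0.
apply: hs_sqnorm_le; first by have [] := sigma_HS (X r w, a r w).
have [_ _ _ hb] := b_sigma_bounds (X r w) (X r w) (aL0 w rT).
rewrite subr0; apply: (le_trans hb); rewrite ler_pM2l// -addrA (addrC `|X r w|) addrA.
by rewrite lerD2r lerD2l arho.
Qed.

End MildSolutions.

(** * The control problem *)

Section ControlProblem.
Variables (R : realType) (H Xi Lambda : completeNormedModType R).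
Hypotheses (sepH : separable H) (sepLambda : separable Lambda).
Variables (dotH : {dot H for idfun}) (dotXi : {dot Xi for idfun}).
Hypotheses (normH : norm_from_dot dotH) (normXi : norm_from_dot dotXi).
Variables (E : set Xi) (e : nat -> Xi) (he : onb_seq dotXi E e).
Variables (Lambda0 : set Lambda) (Lambda0_ne : Lambda0 !=set0) (p : R).
Variables (S : R -> H -> H) (S_semigroup : C0_contraction_semigroup S).
Variables (b : H * Lambda -> H) (sigma : H * Lambda -> Xi -> H).
Variables (l : H * Lambda -> R) (g : H -> R).
Hypothesis sigma_HS : forall z, hilbert_schmidt E (sigma z).
Variables (C : R) (C_gt0 : 0 < C).
Hypothesis b_sigma_bounds : forall (x x' : H) (a : Lambda), Lambda0 a ->
  [/\ `|b (x, a) - b (x', a)| <= C * `|x - x'|,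
      hs_norm E (fun xi => sigma (x, a) xi - sigma (x', a) xi) <= C * `|x - x'|,
      `|b (x, a)| <= C * (1 + `|x| + `|a|) &
      hs_norm E (sigma (x, a)) <= C * (1 + `|x| + `|a|)].
Hypothesis l_continuous : {within setT `*` Lambda0, continuous l}.
Variables (Cl : R) (Cl_gt0 : 0 < Cl).
Hypothesis l_g_bounds : forall (x x' : H) (a : Lambda), Lambda0 a ->
  [/\ `|l (x, a) - l (x', a)| <= Cl * `|x - x'|,
      `|l (x, a)| <= Cl * (1 + `|x| + `|a| ^+ 2) &
      `|g x - g x'| <= Cl * `|x - x'|].
Hypothesis l_g_lower : ~ bounded_set Lambda0 ->
  (exists m : R, forall (x : H) (a : Lambda), Lambda0 a -> m <= l (x, a)) /\
  (exists m : R, forall x : H, m <= g x).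
Context (d : measure_display) (Omega : measurableType d).
Variables (P : probability Omega R) (W : R -> Xi -> Omega -> R) (t T : R).
Hypotheses (rs : reference_space P W t T) (tT : t <= T).
Variable X : H -> (R -> Omega -> Lambda) -> R -> Omega -> H.
Hypothesis X_mild : forall x a, admissible Lambda0 p P W t T a ->
  mild_solution dotXi E S b sigma P W t T x a (X x a).

Local Notation leb := (@lebesgue_measure R).
Local Notation cost := (cost l g P t T X).
Local Notation value := (value Lambda0 p l g P W t T X).

Let lam := 2 * ((6 + 54 * gauss_sqmoment R) * C ^+ 2) + 1.

Let lam1 : 1 <= lam.
Proof.
rewrite /lam lerDr; apply: mulr_ge0 => //; apply: mulr_ge0; last exact: sqr_ge0.
apply: addr_ge0 => //; apply: mulr_ge0 => //.
by apply: fine_ge0; apply: integral_ge0 => x _; rewrite lee_fin sqr_ge0.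
Qed.

(** The bound on [g] is stated along with a control value in [Lambda0]; nonemptiness supplies
    one. *)
Let lipschitz_g x y : `|g x - g y| <= Cl * `|x - y|.
Proof. by have [a0 La0] := Lambda0_ne; have [] := l_g_bounds x y La0. Qed.

Let continuous_g : continuous g.
Proof.
move=> x; apply/cvgrPdist_lt => eps eps0.
near=> y; apply: (le_lt_trans (lipschitz_g x y)).
rewrite mulrC -ltr_pdivlMr//; near: y.
by apply: cvgr_dist_lt; [exact: cvg_id|rewrite divr_gt0].
Unshelve. all: by end_near. Qed.

Section Trajectories.
Variables (a : R -> Omega -> Lambda) (adm : admissible Lambda0 p P W t T a).

Let aL0 s w : t <= s <= T -> Lambda0 (a s w).
Proof. by have [aL _ _] := adm; exact: aL. Qed.

Let measurable_X x :
  measurable_fun (`[t, T] `*` setT) (fun z : R * Omega => X x a z.1 z.2 : borel H).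
Proof. by have [pX _ _ _] := X_mild x adm; exact: (progressive_measurable rs tT (lexx T) pX). Qed.

Let measurable_XT x : measurable_fun setT (X x a T : Omega -> borel H).
Proof.
have := measurable_X x.
by apply: measurable_section2 => //; rewrite /= in_itv /= tT lexx.
Qed.

Let measurable_l x :
  measurable_fun (`[t, T] `*` setT) (fun z : R * Omega => l (X x a z.1 z.2, a z.1 z.2)).
Proof.
apply: (measurable_within_continuous (L0 := Lambda0) (u := fun z : R * Omega => X x a z.1 z.2)
  (v := fun z : R * Omega => a z.1 z.2)) => //.
  by have [_ pa _] := adm; exact: (progressive_measurable rs tT (lexx T) pa).
by move=> [s w] [/= + _]; rewrite in_itv /=; exact: aL0.
Qed.

Let measurable_gT x : measurable_fun setT (fun w => g (X x a T w)).
Proof. exact: (measurable_continuous_compR (phi := g)). Qed.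

Let measurable_dist x y :
  measurable_fun (`[t, T] `*` setT) (fun z : R * Omega => `|X x a z.1 z.2 - X y a z.1 z.2|).
Proof. by apply: measurable_norm_borel; exact: measurable_subv. Qed.

Lemma dist_mean_le x y s : x != y -> t <= s <= T ->
  (\int[P]_w (`|X x a s w - X y a s w|)%:E <=
   (4 * expR (lam * (s - t)) * `|x - y|)%:E)%E.
Proof.
move=> xy st; have xy0 : 0 < `|x - y| by rewrite normr_gt0 subr_eq0.
(* Up to a constant, [delta] is the expected answer: the second moment is at most [6 * delta ^+ 2],
   so the mean is at most [(1 + 6) / 2 * delta], rounded up to [4 * delta]. *)
pose delta := expR (lam * (s - t)) * `|x - y|.
have d0 : 0 < delta by rewrite mulr_gt0// expR_gt0.
have h := mild_dist_sqmoment sepH normH normXi he S_semigroup sigma_HS C_gt0 b_sigma_bounds rs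
  aL0 (X_mild x adm) (X_mild y adm) st.
have mY : measurable_fun setT (fun w => `|X x a s w - X y a s w|).
  by apply: (measurable_section2 (x := s)
    (f := fun s w => `|X x a s w - X y a s w|) _ _ (measurable_dist x y)).
apply: (le_trans (integral_norm_le mY (fun=> normr_ge0 _) d0 h)).
rewrite lee_fin -/lam.
have -> : 6 * `|x - y| ^+ 2 * expR (2 * lam * (s - t)) = 6 * delta ^+ 2.
  by rewrite /delta exprMn -expRM_natl mulrA -mulrA (mulrC (`|x - y| ^+ 2)).
have -> : delta^-1 * (6 * delta ^+ 2) = 6 * delta by field; rewrite gt_eqF.
by rewrite -mulrA -/delta; lra.
Qed.

(** The running and the terminal cost contribute 4 each. In the former, exp(lam (s - t)) is exp(lam
    (T - t)) exp(-lam (T - s)), whose last factor has time integral at most [1 / lam <= 1]; no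
    factor [T - t] appears. *)
Lemma cost_le x y : x != y ->
  (cost x a <= cost y a + (8 * Cl * expR (lam * (T - t)) * `|x - y|)%:E)%E.
Proof.
move=> xy; set B := (X in (_ <= _ + X)%E).
have m4 : measurable_fun `[t, T] (fun s => (Cl * (4 * `|x - y|) * expR (lam * (T - t)))%:E *
    (expR (- lam * (T - s)))%:E)%E.
  apply: emeasurable_funM => //; apply/measurable_EFinP; apply: measurable_funTS.
  apply: measurableT_comp => //; apply: measurable_funM => //; exact: measurable_funB.
have mZs s : t <= s <= T -> measurable_fun setT (fun w => (`|X x a s w - X y a s w|)%:E).
  move=> st; apply/measurable_EFinP; apply: (measurable_section2 (x := s)
    (f := fun s w => `|X x a s w - X y a s w|) _ _ (measurable_dist x y)) => //.
have kB : (\int[leb]_(s in `[t, T]) \int[P]_w (Cl * `|X x a s w - X y a s w|)%:E +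
    \int[P]_w (Cl * `|X x a T w - X y a T w|)%:E <= B)%E.
  have hs s : t <= s <= T -> (\int[P]_w (Cl * `|X x a s w - X y a s w|)%:E <=
      (Cl * (4 * expR (lam * (s - t)) * `|x - y|))%:E)%E.
    move=> st; under eq_integral do rewrite EFinM.
    rewrite ge0_integralZl_EFin//; do ?[exact: mZs|exact: ltW].
    rewrite EFinM; apply: lee_wpmul2l; first by rewrite lee_fin ltW.
    exact: dist_mean_le.
  apply: (@le_trans _ _ ((Cl * (4 * `|x - y|) * expR (lam * (T - t)))%:E +
     (Cl * (4 * expR (lam * (T - t)) * `|x - y|))%:E)%E); last first.
    by rewrite /B -EFinD lee_fin; lra.
  apply: leeD; last by apply: hs; rewrite tT lexx.
  apply: (@le_trans _ _ (\int[leb]_(s in `[t, T])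
      ((Cl * (4 * `|x - y|) * expR (lam * (T - t)))%:E * (expR (- lam * (T - s)))%:E))%E).
    apply: ge0_le_integral => //.
    - by move=> s _; apply: integral_ge0 => w _; rewrite lee_fin mulr_ge0// ltW.
    - apply: (measurable_tonelli_F P (f := fun s w => (Cl * `|X x a s w - X y a s w|)%:E)) => //.
        by move=> s w _; rewrite lee_fin mulr_ge0// ltW.
      by apply/measurable_EFinP; apply: measurable_funM.
    move=> s; rewrite /= in_itv /= => st; apply: (le_trans (hs s st)).
    rewrite -EFinM lee_fin le_eqVlt; apply/orP; left; apply/eqP.
    have <- : expR (lam * (T - t)) * expR (- lam * (T - s)) = expR (lam * (s - t)).
      by rewrite -expRD; congr expR; ring.
    by ring.
  rewrite ge0_integralZl//; do ?[by move=> s _; rewrite lee_fin expR_ge0|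
    by rewrite lee_fin !mulr_ge0 ?expR_ge0// ltW].
    have c0 : 0 <= Cl * (4 * `|x - y|) * expR (lam * (T - t)).
      by rewrite !mulr_ge0 ?expR_ge0// ltW.
    rewrite -[leRHS]mule1; apply: lee_wpmul2l; first by rewrite lee_fin.
    have lam0 : 0 < lam by rewrite (lt_le_trans _ lam1).
    apply: (le_trans (integral_expR_le lam0 tT)).
    by rewrite lee_fin invf_le1.
  apply/measurable_EFinP; apply: measurable_funTS.
  by apply: measurableT_comp => //; apply: measurable_funM => //; exact: measurable_funB.
apply: le_trans (_ : cost y a + _ <= _)%E; last exact: leeD (lexx _) kB.
apply: (expected_cost_le (F1 := fun s w => l (X x a s w, a s w))
  (F2 := fun s w => l (X y a s w, a s w))
  (k := fun s w => Cl * `|X x a s w - X y a s w|)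
  (kT := fun w => Cl * `|X x a T w - X y a T w|)) => //.
- by apply: measurable_funM.
- apply: measurable_funM => //; apply: measurable_norm_borel; exact: measurable_subv.
- by move=> s w _; rewrite mulr_ge0// ltW.
- by move=> w; rewrite mulr_ge0// ltW.
- move=> s w st; rewrite -lerBlDl (le_trans (ler_norm _))//.
  by have [] := l_g_bounds (X x a s w) (X y a s w) (aL0 w st).
- by move=> w; rewrite -lerBlDl (le_trans (ler_norm _)).
- by apply: (le_lt_trans kB); rewrite ltry.
Qed.

(** Comparison with the zero cost from either side. The two bounds are kept apart because for
    unbounded [Lambda0] only the lower one is available uniformly in the control. *)
Lemma abs_cost_le x (k : R -> Omega -> R) (kT : Omega -> R) (B : R) :
  measurable_fun (`[t, T] `*` setT) (fun z : R * Omega => k z.1 z.2) ->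
  measurable_fun setT kT ->
  (forall s w, t <= s <= T -> 0 <= k s w) -> (forall w, 0 <= kT w) ->
  (\int[leb]_(s in `[t, T]) \int[P]_w (k s w)%:E + \int[P]_w (kT w)%:E <= B%:E)%E ->
  ((forall s w, t <= s <= T -> l (X x a s w, a s w) <= k s w) ->
   (forall w, g (X x a T w) <= kT w) -> (cost x a <= B%:E)%E) /\
  ((forall s w, t <= s <= T -> - l (X x a s w, a s w) <= k s w) ->
   (forall w, - g (X x a T w) <= kT w) -> ((- B)%:E <= cost x a)%E).
Proof.
move=> mk mkT k0 kT0 kB.
have fin : (\int[leb]_(s in `[t, T]) \int[P]_w (k s w)%:E + \int[P]_w (kT w)%:E < +oo)%E.
  by apply: (le_lt_trans kB); rewrite ltry.
have zero : (\int[P]_w (\int[leb]_(s in `[t, T]) (0 : R)%:E + (0 : R)%:E) = 0)%E.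
  by apply: integral0_eq => w _; rewrite integral0 adde0.
split=> [lk gk|lk gk].
  apply: (le_trans (expected_cost_le (F1 := fun s w => l (X x a s w, a s w))
    (F2 := fun _ _ => 0) (k := k) (G1 := fun w => g (X x a T w)) (G2 := fun=> 0) (kT := kT)
    _ _ _ _ _ _ _ _ _ _ fin)) => //.
  - by move=> s w st; rewrite add0r lk.
  - by move=> w; rewrite add0r.
  - by rewrite zero add0e.
have := expected_cost_le (F2 := fun s w => l (X x a s w, a s w))
  (F1 := fun _ _ => 0) (k := k) (G2 := fun w => g (X x a T w)) (G1 := fun=> 0) (kT := kT)
  _ _ _ _ _ _ _ _ _ _ fin; rewrite zero => h.
rewrite EFinN leeNl -[leRHS]add0e.
have {}h : (0 <= cost x a + B%:E)%E.
  apply: le_trans (leeD (lexx _) kB); apply: h => //.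
  - by move=> s w st; have := lk s w st; lra.
  - by move=> w; have := gk w; lra.
by rewrite add0e leeNl -EFinN; move: h; rewrite -leeBlDr// add0e.
Qed.

End Trajectories.

Let affine_mean_le (Y : Omega -> R) (c0 c1 m : R) : measurable_fun setT Y ->
  (forall w, 0 <= Y w) -> 0 <= c0 -> 0 <= c1 -> (\int[P]_w (Y w)%:E <= m%:E)%E ->
  (\int[P]_w (c0 + c1 * Y w)%:E <= (c0 + c1 * m)%:E)%E.
Proof.
move=> mY Y0 c00 c10 hm.
have mYE : measurable_fun setT (fun w => (Y w)%:E) by exact/measurable_EFinP.
under eq_integral do rewrite EFinD EFinM.
rewrite ge0_integralD//; do ?[by move=> w _; rewrite -?EFinM lee_fin ?mulr_ge0|
  exact: emeasurable_funM].
rewrite integral_cst//= probability_setT mule1 EFinD; apply: leeD => //.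
rewrite ge0_integralZl_EFin//; do ?[by move=> w _; rewrite lee_fin].
by rewrite EFinM; apply: lee_wpmul2l => //; rewrite lee_fin.
Qed.

Let integral_cst_itv (m : R) :
  (\int[leb]_(s in `[t, T]) m%:E = (m * (T - t))%:E)%E.
Proof.
transitivity (m%:E * leb `[t, T])%E; first exact: integral_cst.
rewrite lebesgue_measure_itv/= lte_fin; case: ltP => // Tt.
by rewrite (@le_anti _ _ t T) ?subrr ?mule0 ?mulr0// tT.
Qed.

Let integral_le_cst (k : R -> \bar R) (m : R) : measurable_fun `[t, T] k ->
  (forall s, t <= s <= T -> (0 <= k s)%E) -> (forall s, t <= s <= T -> (k s <= m%:E)%E) ->
  (\int[leb]_(s in `[t, T]) k s <= (m * (T - t))%:E)%E.
Proof.
move=> mk k0 km.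
have m0 : 0 <= m by rewrite -lee_fin (le_trans (k0 t _) (km t _))// lexx.
apply: (@le_trans _ _ (\int[leb]_(s in `[t, T]) m%:E)%E).
  by apply: ge0_le_integral.
by rewrite integral_cst_itv.
Qed.

(** [B] depends on the control only through [rho]. A constant control and, if [Lambda0] is bounded,
    all controls are thereby covered. *)
Lemma cost_bounded x (rho : R) : 0 <= rho -> exists B : R,
  forall a, admissible Lambda0 p P W t T a ->
  (forall s w, t <= s <= T -> `|a s w| <= rho) ->
  ((- B)%:E <= cost x a /\ cost x a <= B%:E)%E.
Proof.
move=> rho0.
pose M := (6 * `|x| ^+ 2 + (1 + rho) ^+ 2) * expR (2 * lam * (T - t)).
have M0 : 0 <= M by rewrite mulr_ge0 ?expR_ge0// addr_ge0 ?sqr_ge0// mulr_ge0 ?sqr_ge0.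
(* First moment bound, from the second moment bound [M] with [delta = 1]. *)
pose m1 := 2^-1 * (1 + 1^-1 * M).
exists ((Cl * (1 + rho ^+ 2) + Cl * m1) * (T - t) + (`|g 0| + Cl * m1)) => a adm arho.
have aL0 s w : t <= s <= T -> Lambda0 (a s w) by have [aL _ _] := adm; exact: aL.
have mX : measurable_fun (`[t, T] `*` setT) (fun z : R * Omega => `|X x a z.1 z.2|).
  have [pX _ _ _] := X_mild x adm; apply: measurable_norm_borel.
  exact: (progressive_measurable rs tT (lexx T) pX).
have mXs s : t <= s <= T -> measurable_fun setT (fun w => `|X x a s w|).
  move=> st; apply: (measurable_section2 (x := s) (f := fun s w => `|X x a s w|) _ _ mX) => //.
have Xmean s : t <= s <= T -> (\int[P]_w (`|X x a s w|)%:E <= m1%:E)%E.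
  move=> st; apply: integral_norm_le => //; first exact: mXs.
  apply: (le_trans (mild_sqmoment sepH normH normXi he S_semigroup sigma_HS C_gt0
    b_sigma_bounds rs aL0 rho0 arho (X_mild x adm) st)).
  rewrite lee_fin /M ler_wpM2l ?addr_ge0 ?sqr_ge0 ?mulr_ge0 ?sqr_ge0//.
  rewrite ler_expR ler_wpM2l ?mulr_ge0 ?(le_trans _ lam1)//.
  by case/andP: st => _ sT; rewrite lerD2r.
pose k s w := Cl * (1 + rho ^+ 2) + Cl * `|X x a s w|.
pose kT w := `|g 0| + Cl * `|X x a T w|.
have c0 : 0 <= Cl * (1 + rho ^+ 2) by rewrite mulr_ge0 ?(ltW Cl_gt0)// addr_ge0 ?sqr_ge0.
have TT : t <= T <= T by rewrite tT lexx.
have k0 s w : 0 <= k s w by rewrite addr_ge0// mulr_ge0// ltW.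
have mk : measurable_fun (`[t, T] `*` setT) (fun z : R * Omega => k z.1 z.2).
  by apply: measurable_funD => //; exact: measurable_funM.
have mkT : measurable_fun setT kT.
  by apply: measurable_funD => //; apply: measurable_funM => //; exact: mXs.
have lk s w : t <= s <= T -> `|l (X x a s w, a s w)| <= k s w.
  move=> st; have [_ hl _] := l_g_bounds (X x a s w) (X x a s w) (aL0 s w st).
  apply: (le_trans hl); rewrite /k -mulrDr ler_pM2l// addrAC lerD2r lerD2l.
  by rewrite ler_sqr ?nnegrE// arho.
have gk w : `|g (X x a T w)| <= kT w.
  have := lipschitz_g (X x a T w) 0; rewrite subr0 /kT => h.
  by rewrite -(subrK (g 0) (g _)) addrC (le_trans (ler_normD _ _))// lerD2l.
have kB : (\int[leb]_(s in `[t, T]) \int[P]_w (k s w)%:E + \int[P]_w (kT w)%:E <=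
    ((Cl * (1 + rho ^+ 2) + Cl * m1) * (T - t) + (`|g 0| + Cl * m1))%:E)%E.
  rewrite EFinD; apply: leeD; last first.
    by apply: affine_mean_le => //; [exact: mXs|exact: ltW|exact: Xmean].
  apply: integral_le_cst.
  - apply: (measurable_tonelli_F P (f := fun s w => (k s w)%:E)) => //.
      by move=> s w _; rewrite lee_fin.
    exact/measurable_EFinP.
  - by move=> s _; apply: integral_ge0 => w _; rewrite lee_fin.
  - by move=> s st; apply: affine_mean_le => //; [exact: mXs|exact: ltW|exact: Xmean].
have [up low] := abs_cost_le adm x mk mkT (fun s w _ => k0 s w)
  (fun w => le_trans (normr_ge0 _) (gk w)) kB.
split.
- apply: low => [s w st|w]; first by rewrite (le_trans _ (lk s w st))// -normrN ler_norm.
  by rewrite (le_trans _ (gk w))// -normrN ler_norm.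
- apply: up => [s w st|w]; first by rewrite (le_trans (ler_norm _))// lk.
  by rewrite (le_trans (ler_norm _)).
Qed.

Let admissible_cst a0 : Lambda0 a0 -> admissible Lambda0 p P W t T (fun _ _ => a0).
Proof.
move=> La0; split => //.
rewrite integral_cst_itv.
by rewrite integral_cst//= probability_setT mule1 ltry.
Qed.

(** The upper bound comes from a constant control; the lower one has to be uniform over all
    controls, which is where the two cases on [Lambda0] arise. *)
Lemma value_fin_num x : value x \is a fin_num.
Proof.
have [a0 La0] := Lambda0_ne; rewrite fin_numElt; apply/andP; split; last first.
  have [B hB] := cost_bounded x (normr_ge0 a0).
  have [_ h] := hB _ (admissible_cst La0) (fun _ _ _ => lexx _).
  apply: (@le_lt_trans _ _ (cost x (fun _ _ => a0))).
    by apply: ereal_inf_lbound; exists (fun _ _ => a0) => //; exact: admissible_cst.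
  by apply: (le_lt_trans h); rewrite ltry.
suff [B hB] : exists B : R, forall a, admissible Lambda0 p P W t T a ->
    ((- B)%:E <= cost x a)%E.
  apply: (@lt_le_trans _ _ (- B)%:E); first by rewrite ltNyr.
  by apply: le_ereal_inf_tmp => _ [a adm <-]; exact: hB.
have [[M [_ hM]]|/l_g_lower[[m hm] [m' hm']]] := pselect (bounded_set Lambda0).
  (* [bounded_set] gives the bound by every number above [M], not by [M] itself. *)
  pose rho := M + 1.
  have hrho v : Lambda0 v -> `|v| <= rho by apply: hM; rewrite ltrDl.
  have rho0 : 0 <= rho by rewrite (le_trans (normr_ge0 a0))// hrho.
  have [B hB] := cost_bounded x rho0; exists B => a adm.
  have [aL _ _] := adm.
  by have [] := hB a adm (fun s w st => hrho _ (aL s w st)).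
exists (`|m| * (T - t) + `|m'|) => a adm.
have [aL _ _] := adm.
have kB : (\int[leb]_(s in `[t, T]) \int[P]_w (`|m|)%:E + \int[P]_w (`|m'|)%:E <=
    (`|m| * (T - t) + `|m'|)%:E)%E.
  have cst u : (\int[P]_w u%:E = u%:E)%E.
    by rewrite integral_cst//= probability_setT mule1.
  by rewrite !cst integral_cst_itv.
have [_] := abs_cost_le adm x (k := fun _ _ => `|m|) (kT := fun=> `|m'|)
  (measurable_cst _) (measurable_cst _)
  (fun _ _ _ => normr_ge0 _) (fun=> normr_ge0 _) kB.
apply.
- by move=> s w st; rewrite lerNl (le_trans _ (hm (X x a s w) _ (aL s w st)))// lerNl -normrN ler_norm.
- by move=> w; rewrite lerNl (le_trans _ (hm' (X x a T w)))// lerNl -normrN ler_norm.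
Qed.

(** The constant in [cost_le] does not depend on the control, so the estimate survives the
    infimum. *)
Let value_le x y : x != y ->
  (value x <= value y + (8 * Cl * expR (lam * (T - t)) * `|x - y|)%:E)%E.
Proof.
move=> xy; rewrite -leeBlDr//; apply: le_ereal_inf_tmp => _ [a adm <-].
rewrite leeBlDr//; apply: le_trans (cost_le adm xy).
by apply: ereal_inf_lbound; exists a.
Qed.

(** For distinct points the one-sided estimate is applied both ways. Finiteness is used even for
    [x = y], to make the difference zero. *)
Lemma value_lipschitz x y : (`| value x - value y | <=
  (8 * Cl * expR (lam * (T - t)) * `|x - y|)%:E)%E.
Proof.
have [->|xy] := eqVneq x y.
  by rewrite subee ?value_fin_num// abse0 subrr normr0 mulr0.
have := value_le xy; have := value_le (y := x) (x := y).
rewrite eq_sym xy => /(_ isT); rewrite (distrC y).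
have := value_fin_num x; have := value_fin_num y.
case: (value x) => [u||]// ; case: (value y) => [v||]// _ _.
rewrite -EFinB abse_EFin -!EFinD !lee_fin ler_norml => h1 h2.
by apply/andP; split; lra.
Qed.

End ControlProblem.

Theorem theorem3p6 (R : realType) (H Xi Lambda : completeNormedModType R)
  (dotH : {dot H for idfun}) (dotXi : {dot Xi for idfun})
  (normH : norm_from_dot dotH) (normXi : norm_from_dot dotXi)
  (sepH : separable H) (sepXi : separable Xi) (sepLambda : separable Lambda)
  (E : set Xi) (onbE : orthonormal_basis dotXi E)
  (Lambda0 : set Lambda) (Lambda0_ne : Lambda0 !=set0)
  (Lambda0_convex : convex_set Lambda0)
  (p : R) (p_gt2 : 2 < p)
  (D : set H) (A : H -> H) (D_dense : dense D)
  (A_maxdiss : maximal_dissipative dotH D A)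
  (S : R -> H -> H) (S_semigroup : C0_contraction_semigroup S)
  (S_generated : infinitesimal_generator D A S)
  (b : H * Lambda -> H) (sigma : H * Lambda -> Xi -> H)
  (l : H * Lambda -> R) (g : H -> R)
  (sigma_HS : forall z, hilbert_schmidt E (sigma z))
  (b_continuous : {within setT `*` Lambda0, continuous b})
  (sigma_continuous : forall z, (setT `*` Lambda0) z ->
    hs_norm E (fun xi => sigma z' xi - sigma z xi)
      @[z' --> within (setT `*` Lambda0) (nbhs z)] --> (0 : R))
  (b_sigma_bounds : exists2 C : R, 0 < C &
    forall (x x' : H) (a : Lambda), Lambda0 a ->
    [/\ `|b (x, a) - b (x', a)| <= C * `|x - x'|,
        hs_norm E (fun xi => sigma (x, a) xi - sigma (x', a) xi)
          <= C * `|x - x'|,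
        `|b (x, a)| <= C * (1 + `|x| + `|a|) &
        hs_norm E (sigma (x, a)) <= C * (1 + `|x| + `|a|)])
  (l_continuous : {within setT `*` Lambda0, continuous l})
  (l_g_bounds : exists2 C : R, 0 < C &
    forall (x x' : H) (a : Lambda), Lambda0 a ->
    [/\ `|l (x, a) - l (x', a)| <= C * `|x - x'|,
        `|l (x, a)| <= C * (1 + `|x| + `|a| ^+ 2) &
        `|g x - g x'| <= C * `|x - x'|])
  (l_g_lower : ~ bounded_set Lambda0 ->
    (exists m : R, forall (x : H) (a : Lambda), Lambda0 a -> m <= l (x, a)) /\
    (exists m : R, forall x : H, m <= g x)) :
  exists C1 C2 : R, forall (T : R), 0 < T ->
  forall (t : R), 0 <= t <= T ->
  forall (d : measure_display) (Omega : measurableType d)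
    (P : probability Omega R) (W : R -> Xi -> Omega -> R),
  reference_space P W t T ->
  forall X : H -> (R -> Omega -> Lambda) -> R -> Omega -> H,
  (forall x a, admissible Lambda0 p P W t T a ->
     mild_solution dotXi E S b sigma P W t T x a (X x a)) ->
  forall x y : H,
  (`| value Lambda0 p l g P W t T X x - value Lambda0 p l g P W t T X y |
     <= (C1 * expR (C2 * (T - t)) * `|x - y|)%:E)%E.
Proof.
(* Separability of [Xi] makes the basis countable, hence listable as a sequence. *)
have [e he] := onb_seq_exists (orthonormal_countable normXi sepXi onbE) onbE.
have [C C_gt0 hb] := b_sigma_bounds; have [Cl Cl_gt0 hl] := l_g_bounds.
(* The exponent is [lam], a function of [C] and of the Gaussian second moment only. *)
exists (8 * Cl), (2 * ((6 + 54 * gauss_sqmoment R) * C ^+ 2) + 1).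
move=> T _ t /andP[_ tT] d Omega P W rs X hX x y.
exact: (value_lipschitz sepH sepLambda normH normXi he Lambda0_ne S_semigroup
  sigma_HS C_gt0 hb l_continuous Cl_gt0 hl l_g_lower rs tT hX).
Qed.
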